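(* Let $\mathcal{U}\subset\mathbb{R}^5$ be a domain with global Cartesian coordinates $(t,x^1,x^2,y^1,y^2)$, let $r_0\neq0$ be a constant, $\sigma=\pm1$, and let $f^0=f^0(x^1)$, $h^0=h^0(x^2)$, $u^0=u^0(x^1,x^2)$, $v^0=v^0(x^1,x^2)$ be arbitrary smooth functions on $\mathcal{U}$. Define on $\mathcal{U}$ the coframe $$\theta^0=dt,\quad\theta^1=dx^1,\quad\theta^2=dx^2,\quad\theta^3=df+u\,dx^1,\quad\theta^4=dh+v\,dx^2,$$ $$f=f^0(x^1)-y^1,\quad u=u^0(x^1,x^2)-t+\tfrac{r_0}{8}(y^1)^2,\quad h=h^0(x^2)+y^2,\quad v=v^0(x^1,x^2)-\sigma t+\tfrac{r_0}{8}(y^2)^2, \qquad( * )$$ and the almost para-contact metric structure $(\varphi,\xi,\eta,g)$ by $$\xi=\tfrac{\partial}{\partial t},\quad\eta=\theta^0=dt,\quad \theta^0\circ\varphi=0,\ \theta^1\circ\varphi=\theta^1,\ \theta^2\circ\varphi=-\theta^2,\ \theta^3\circ\varphi=-\theta^3,\ \theta^4\circ\varphi=\theta^4,$$ $$g=dt\odot dt+2\theta^1\odot\theta^3+2\theta^2\odot\theta^4.$$ Then $\mathcal{U}$ with this structure is an almost para-cosymplectic manifold which is weakly para-cosymplectic, has para-K\''ahler leaves, and is $\eta$-Einstein with constant scalar curvature $r_0$; it is elliptic for $\sigma=1$ and hyperbolic for $\sigma=-1$. Conversely, if $\mathcal{M}$ is a 5-dimensional elliptic ($\sigma=1$) or hyperbolic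 ($\sigma=-1$) weakly para-cosymplectic manifold with para-K\''ahler leaves and $\eta$-Einstein Ricci tensor with non-zero scalar curvature $r_0$, then near each point $p\in\mathcal{M}$ there are a metric-dual coframe $(\theta^0=\eta,\theta^1,\ldots,\theta^4)$ of an adopted frame and local coordinates $(t,x^1,x^2,y^1,y^2)$ such that the formulas $( * )$ for the coframe hold, that is, $\theta^0=dt$, $\theta^1=dx^1$, $\theta^2=dx^2$, $\theta^3=df+u\,dx^1$, $\theta^4=dh+v\,dx^2$ with $f=f^0(x^1)-y^1$, $u=u^0(x^1,x^2)-t+\tfrac{r_0}{8}(y^1)^2$, $h=h^0(x^2)+y^2$, $v=v^0(x^1,x^2)-\sigma t+\tfrac{r_0}{8}(y^2)^2$, for some smooth functions $f^0=f^0(x^1)$, $h^0=h^0(x^2)$, $u^0=u^0(x^1,x^2)$, $v^0=v^0(x^1,x^2)$ defined near $p$.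
   Context: All manifolds (assumed connected), tensor fields and functions are smooth. An almost para-contact metric structure on $\mathcal{M}$, $\dim\mathcal{M}=2n+1$, is a quadruple $(\varphi,\xi,\eta,g)$ ($\varphi$ a $(1,1)$-tensor field, $\xi$ a vector field, $\eta$ a 1-form, $g$ a pseudo-Riemannian metric) with $\varphi^2=Id-\eta\otimes\xi$, $\eta(\xi)=1$, $g(\varphi X,\varphi Y)=-g(X,Y)+\eta(X)\eta(Y)$, $\eta(X)=g(\xi,X)$. With $\varPhi(X,Y)=g(\varphi X,Y)$, the manifold is almost para-cosymplectic if $d\eta=0$ and $d\varPhi=0$; it is then weakly para-cosymplectic if $R(X,Y)\varphi Z=\varphi R(X,Y)Z$ for all $X,Y,Z$, where $R(X,Y)Z=\nabla_X\nabla_YZ-\nabla_Y\nabla_XZ-\nabla_{[X,Y]}Z$ and $\nabla$ is the Levi-Civita connection. $Ric(X,Y)=\mathrm{Tr}\{Z\mapsto R(Z,X)Y\}$, $r=\mathrm{Tr}_gRic$; in dimension 5, $\eta$-Einstein means $Ric(X,Y)=\frac r4\left(g(X,Y)-\eta(X)\eta(Y)\right)$, and then (weakly para-cosymplectic, para-K\''ahler leaves) $r=r_0$ is constant. Put $AX=-\nabla_X\xi$. Each leaf of the foliation $\eta=0$ inherits an almost para-Hermitian structure $(P,H)$ by restricting $\varphi$ and $g$; the manifold has para-K\''ahler leaves if $P$ is parallel for the Levi-Civita connection of $H$ on every leaf, equivalently $(\nabla_X\varphi)Y=g(A\varphi X,Y)\xi-\eta(Y)A\varphi X$. Elliptic/hyperbolic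 (dimension 5): near each point there are smooth nowhere zero vector fields $V_1,V_2$ (unique up to sign) with $\varphi V_1=-V_1$, $\varphi V_2=V_2$, $g(V_1,V_2)=0$ and $AX=\varepsilon\left(g(X,V_1)V_1+\sigma g(X,V_2)V_2\right)$, $\varepsilon=\pm1$, where $\sigma=1$ in the elliptic and $\sigma=-1$ in the hyperbolic case. Replacing $(\xi,\eta)$ by $(-\xi,-\eta)$ if necessary, it is always assumed that $\varepsilon=1$. An adopted frame is a local frame $(V_0=\xi,V_1,V_2,V_3,V_4)$ extending $(\xi,V_1,V_2)$ with $\varphi V_3=V_3$, $\varphi V_4=-V_4$ and such that the only non-zero coefficients of the metric are $g(\xi,\xi)=g(V_1,V_3)=g(V_2,V_4)=1$ (and the symmetric ones). Its metric-dual coframe is $\theta^i=g(\cdot,V_i)$. $\alpha\odot\beta=\frac12(\alpha\otimes\beta+\beta\otimes\alpha)$ for 1-forms. *)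

(* Defs.v *)
From HB Require Import structures.
From mathcomp Require Import all_boot all_order all_algebra.
From mathcomp Require Import all_classical all_reals all_analysis.

Set Implicit Arguments.
Unset Strict Implicit.
Unset Printing Implicit Defensive.

Import Order.TTheory GRing.Theory Num.Theory.
Import numFieldNormedType.Exports.

Local Open Scope classical_set_scope.
Local Open Scope ring_scope.

(* Conventions: points and tangent vectors of R^m are row vectors, covectors
   are column vectors, a (1,1)-tensor F acts by X |-> X *m F, and a bilinear
   form B is evaluated as X *m B *m Y^T.  Fields on an open subset U of R^m are
   total functions of which only the values on U matter.  Dimensions have the
   form m = n.+1 because the topology of 'rV_m is available only then. *)

Section Calculus.
Context {R : realType} {n : nat}.
Notation E := ('rV[R]_n.+1).
Implicit Types (U : set E) (X Y Z : E -> E) (G : E -> 'M[R]_n.+1).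

Definition ebase (i : 'I_n.+1) : E := delta_mx 0 i.

Definition partial (i : 'I_n.+1) (f : E -> R) : E -> R :=
  fun x => 'D_(ebase i) f x.

(* C^oo on the open set U: every iterated partial derivative is
   (Frechet-)differentiable at every point of U. *)
Definition smooth U (f : E -> R) : Prop :=
  forall (s : seq 'I_n.+1) (x : E), U x ->
    differentiable (foldr partial f s) x.

Definition smooth_mx a b U (F : E -> 'M[R]_(a, b)) : Prop :=
  forall i j, smooth U (fun x => F x i j).

Definition dfun (f : E -> R) : E -> 'cV[R]_n.+1 :=
  fun x => \col_i partial i f x.

Definition bracket X Y : E -> E := fun x => 'D_(X x) Y x - 'D_(Y x) X x.

Definition christoffel G (i j k : 'I_n.+1) (x : E) : R :=
  2^-1 * \sum_(l < n.+1) invmx (G x) k l *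
    (partial i (fun y => G y j l) x + partial j (fun y => G y i l) x
     - partial l (fun y => G y i j) x).

(* the Levi-Civita covariant derivative of Y in the direction w at x *)
Definition nabla G (w : E) Y (x : E) : E :=
  'D_w Y x +
  \row_k \sum_(i < n.+1) \sum_(j < n.+1) w 0 i * Y x 0 j * christoffel G i j k x.

Definition nablaF G X Y : E -> E := fun x => nabla G (X x) Y x.

Definition curvature G X Y Z : E -> E := fun x =>
  nablaF G X (nablaF G Y Z) x - nablaF G Y (nablaF G X Z) x
  - nablaF G (bracket X Y) Z x.

(* Ric(X,Y) = Tr (Z |-> R(Z,X)Y) *)
Definition Ric G X Y : E -> R := fun x =>
  \sum_(k < n.+1) curvature G (fun=> ebase k) X Y x 0 k.

Definition scal G : E -> R := fun x =>
  \sum_(i < n.+1) \sum_(j < n.+1)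
    invmx (G x) i j * Ric G (fun=> ebase i) (fun=> ebase j) x.

Definition closed_1form U (a : E -> 'cV[R]_n.+1) : Prop :=
  forall x, U x -> forall i j,
    partial i (fun y => a y j 0) x - partial j (fun y => a y i 0) x = 0.

(* for a skew-symmetric B *)
Definition closed_2form U (B : E -> 'M[R]_n.+1) : Prop :=
  forall x, U x -> forall i j k,
    partial i (fun y => B y j k) x + partial j (fun y => B y k i) x
    + partial k (fun y => B y i j) x = 0.

Definition tensprod (a b : 'cV[R]_n.+1) : 'M[R]_n.+1 := a *m b^T.

Definition symprod (a b : 'cV[R]_n.+1) : 'M[R]_n.+1 :=
  2^-1 *: (tensprod a b + tensprod b a).

End Calculus.

Definition pseudo_riemannian (R : realType) (n : nat)
    (U : set 'rV[R]_n.+1) (G : 'rV[R]_n.+1 -> 'M[R]_n.+1) : Prop :=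
  smooth_mx U G /\
  (forall x, U x -> (G x)^T = G x /\ G x \in unitmx).

Record pc_data (R : realType) (n : nat) := PcData {
  pc_phi : 'rV[R]_n.+1 -> 'M[R]_n.+1;
  pc_xi  : 'rV[R]_n.+1 -> 'rV[R]_n.+1;
  pc_eta : 'rV[R]_n.+1 -> 'cV[R]_n.+1;
  pc_g   : 'rV[R]_n.+1 -> 'M[R]_n.+1 }.

Section ParaContact.
Context {R : realType} {n : nat}.
Notation E := ('rV[R]_n.+1).
Implicit Types (U : set E) (S : pc_data R n) (x : E).

Definition phi S x (X : E) : E := X *m pc_phi S x.
Definition eta S x (X : E) : R := (X *m pc_eta S x) 0 0.
Definition met S x (X Y : E) : R := (X *m pc_g S x *m Y^T) 0 0.

Definition almost_paracontact_metric U S : Prop :=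
  [/\ smooth_mx U (pc_phi S), smooth_mx U (pc_xi S), smooth_mx U (pc_eta S)
    & pseudo_riemannian U (pc_g S)] /\
  forall x, U x ->
    [/\ forall X, phi S x (phi S x X) = X - eta S x X *: pc_xi S x,
        eta S x (pc_xi S x) = 1,
        forall X Y, met S x (phi S x X) (phi S x Y)
                    = - met S x X Y + eta S x X * eta S x Y
      & forall X, eta S x X = met S x (pc_xi S x) X].

(* matrix of Phi(X,Y) = g(phi X, Y) *)
Definition fundamental_form S : E -> 'M[R]_n.+1 :=
  fun x => \matrix_(i, j) met S x (phi S x (ebase i)) (ebase j).

Definition almost_paracosymplectic U S : Prop :=
  [/\ almost_paracontact_metric U S,
      closed_1form U (pc_eta S)
    & closed_2form U (fundamental_form S)].

Definition weakly_paracosymplectic U S : Prop :=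
  almost_paracosymplectic U S /\
  forall X Y Z : E -> E, smooth_mx U X -> smooth_mx U Y -> smooth_mx U Z ->
  forall x, U x ->
    curvature (pc_g S) X Y (fun y => phi S y (Z y)) x
    = phi S x (curvature (pc_g S) X Y Z x).

Definition shape_op S x (X : E) : E := - nabla (pc_g S) X (pc_xi S) x.

End ParaContact.

(* iota : W -> U is an immersion tangent to ker eta, W open in R^(n+1),
   U open in R^(n+2): the local parametrizations of the leaves of eta = 0.
   'J iota w is the matrix of X |-> d iota_w X on row vectors. *)
Definition leaf_param (R : realType) (n : nat)
    (U : set 'rV[R]_n.+2) (S : pc_data R n.+1)
    (W : set 'rV[R]_n.+1) (iota : 'rV[R]_n.+1 -> 'rV[R]_n.+2) : Prop :=
  [/\ open W, smooth_mx W iota, forall w, W w -> U (iota w)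
    & forall w, W w -> row_free ('J iota w) /\
        forall X : 'rV[R]_n.+1, eta S (iota w) (X *m 'J iota w) = 0].

(* the metric H = iota^* g induced on the leaf *)
Definition leaf_metric (R : realType) (n : nat) (S : pc_data R n.+1)
    (iota : 'rV[R]_n.+1 -> 'rV[R]_n.+2) : 'rV[R]_n.+1 -> 'M[R]_n.+1 :=
  fun w => 'J iota w *m pc_g S (iota w) *m ('J iota w)^T.

(* P is the restriction of phi to the leaf, d iota (P X) = phi (d iota X).
   Since phi preserves ker eta and iota is an immersion, this P exists and is
   unique. *)
Definition leaf_structure (R : realType) (n : nat) (S : pc_data R n.+1)
    (W : set 'rV[R]_n.+1) (iota : 'rV[R]_n.+1 -> 'rV[R]_n.+2)
    (P : 'rV[R]_n.+1 -> 'M[R]_n.+1) : Prop :=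
  forall w, W w -> forall X : 'rV[R]_n.+1,
    (X *m P w) *m 'J iota w = phi S (iota w) (X *m 'J iota w).

Definition parallel (R : realType) (n : nat) (W : set 'rV[R]_n.+1)
    (H P : 'rV[R]_n.+1 -> 'M[R]_n.+1) : Prop :=
  forall X Y : 'rV[R]_n.+1 -> 'rV[R]_n.+1, smooth_mx W X -> smooth_mx W Y ->
  forall w, W w ->
    nablaF H X (fun y => Y y *m P y) w - nablaF H X Y w *m P w = 0.

Definition para_kahler_leaves (R : realType) (n : nat)
    (U : set 'rV[R]_n.+2) (S : pc_data R n.+1) : Prop :=
  forall (W : set 'rV[R]_n.+1) (iota : 'rV[R]_n.+1 -> 'rV[R]_n.+2)
         (P : 'rV[R]_n.+1 -> 'M[R]_n.+1),
    leaf_param U S W iota -> leaf_structure S W iota P ->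
    parallel W (leaf_metric S iota) P.

Section DimensionFive.
Context {R : realType}.
Notation E := ('rV[R]_5).
Implicit Types (U W : set E) (S : pc_data R 4) (x : E).

Definition i0 : 'I_5 := @Ordinal 5 0 isT.
Definition i1 : 'I_5 := @Ordinal 5 1 isT.
Definition i2 : 'I_5 := @Ordinal 5 2 isT.
Definition i3 : 'I_5 := @Ordinal 5 3 isT.
Definition i4 : 'I_5 := @Ordinal 5 4 isT.

Definition eta_einstein U S : Prop :=
  forall X Y : E -> E, smooth_mx U X -> smooth_mx U Y -> forall x, U x ->
    Ric (pc_g S) X Y x
    = scal (pc_g S) x / 4 * (met S x (X x) (Y x) - eta S x (X x) * eta S x (Y x)).

Definition shape_fields (eps sigma : R) S W (V1 V2 : E -> E) : Prop :=
  [/\ smooth_mx W V1, smooth_mx W V2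
    & forall x, W x ->
      [/\ V1 x != 0 /\ V2 x != 0,
          phi S x (V1 x) = - V1 x,
          phi S x (V2 x) = V2 x,
          met S x (V1 x) (V2 x) = 0
        & forall X, shape_op S x X =
            eps *: (met S x X (V1 x) *: V1 x
                    + sigma *: (met S x X (V2 x) *: V2 x))]].

(* The sign eps is normalized to 1 by replacing (xi, eta) with (-xi, -eta). *)
Definition shape_type (sigma : R) U S : Prop :=
  forall x, U x -> exists W V1 V2,
    [/\ open W, W x, W `<=` U & shape_fields 1 sigma S W V1 V2].

Definition elliptic U S : Prop := shape_type 1 U S.
Definition hyperbolic U S : Prop := shape_type (-1) U S.

(* That (V i x)_i is a basis follows from its Gram matrix. *)
Definition adopted_frame (sigma : R) S W (V : 'I_5 -> E -> E) : Prop :=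
  [/\ forall i, smooth_mx W (V i),
      shape_fields 1 sigma S W (V i1) (V i2)
    & forall x, W x ->
      [/\ V i0 x = pc_xi S x,
          phi S x (V i3 x) = V i3 x,
          phi S x (V i4 x) = - V i4 x
        & forall i j, met S x (V i x) (V j x) =
            if (i, j) \in [:: (i0, i0); (i1, i3); (i3, i1); (i2, i4); (i4, i2)]
            then 1 else 0]].

Definition dual_coframe S W (V : 'I_5 -> E -> E) (th : 'I_5 -> E -> 'cV[R]_5)
  : Prop :=
  forall x, W x -> forall i (X : E), (X *m th i x) 0 0 = met S x X (V i x).

(* The coframe attached to functions t, x1, x2, y1, y2 on an open subset of
   R^5; they are the Cartesian coordinates themselves in [model], and other
   local coordinates in the converse direction. *)
Definition canonical_coframe (r0 sigma : R) (f0 h0 : R -> R)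
    (u0 v0 : R -> R -> R) (t x1 x2 y1 y2 : E -> R) (i : 'I_5) : E -> 'cV[R]_5 :=
  let f q := f0 (x1 q) - y1 q in
  let u q := u0 (x1 q) (x2 q) - t q + r0 / 8 * y1 q ^+ 2 in
  let h q := h0 (x2 q) + y2 q in
  let v q := v0 (x1 q) (x2 q) - sigma * t q + r0 / 8 * y2 q ^+ 2 in
  fun q =>
    match val i with
    | 0%N => dfun t q
    | 1%N => dfun x1 q
    | 2%N => dfun x2 q
    | 3%N => dfun f q + u q *: dfun x1 q
    | _   => dfun h q + v q *: dfun x2 q
    end.

(* f0, h0, u0, v0 are smooth as functions of the coordinates (t,x1,x2,y1,y2)
   in U depending only on x1, x2, (x1,x2), (x1,x2) respectively. *)
Definition smooth_data U (f0 h0 : R -> R) (u0 v0 : R -> R -> R) : Prop :=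
  [/\ smooth U (fun q => f0 (q 0 i1)), smooth U (fun q => h0 (q 0 i2)),
      smooth U (fun q => u0 (q 0 i1) (q 0 i2))
    & smooth U (fun q => v0 (q 0 i1) (q 0 i2))].

Definition coordf (i : 'I_5) : E -> R := fun q => q 0 i.

(* phi is determined by the forms th i o phi since (th i)_i is a coframe. *)
Definition model (r0 sigma : R) (f0 h0 : R -> R) (u0 v0 : R -> R -> R) U S
  : Prop :=
  let th := canonical_coframe r0 sigma f0 h0 u0 v0
              (coordf i0) (coordf i1) (coordf i2) (coordf i3) (coordf i4) in
  let th_phi i x := pc_phi S x *m th i x in
  forall x, U x ->
    [/\ pc_xi S x = ebase i0, pc_eta S x = th i0 x,
        [/\ th_phi i0 x = 0, th_phi i1 x = th i1 x, th_phi i2 x = - th i2 x,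
            th_phi i3 x = - th i3 x & th_phi i4 x = th i4 x]
      & pc_g S x = symprod (th i0 x) (th i0 x)
                   + 2 *: symprod (th i1 x) (th i3 x)
                   + 2 *: symprod (th i2 x) (th i4 x)].

End DimensionFive.

Record chart (R : realType) (n : nat) (M : Type) := Chart {
  chart_dom : set M;
  chart_map : M -> 'rV[R]_n.+1;
  chart_inv : 'rV[R]_n.+1 -> M }.

Section Manifold.
Context {R : realType} {n : nat} {M : topologicalType} {I : Type}.
Variable atlas : I -> chart R n M.

Definition chart_img (i : I) : set 'rV[R]_n.+1 :=
  chart_map (atlas i) @` chart_dom (atlas i).

Definition transition (i j : I) : 'rV[R]_n.+1 -> 'rV[R]_n.+1 :=
  chart_map (atlas j) \o chart_inv (atlas i).

Definition overlap (i j : I) : set 'rV[R]_n.+1 :=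
  chart_map (atlas i) @` (chart_dom (atlas i) `&` chart_dom (atlas j)).

Definition connected_smooth_manifold : Prop :=
  [/\ hausdorff_space M, @second_countable M & connected [set: M]] /\
  [/\ forall i, open (chart_dom (atlas i)) /\ open (chart_img i),
      forall i, {within chart_dom (atlas i), continuous (chart_map (atlas i))}
             /\ {within chart_img i, continuous (chart_inv (atlas i))},
      forall i p, chart_dom (atlas i) p ->
        chart_inv (atlas i) (chart_map (atlas i) p) = p,
      forall p, exists i, chart_dom (atlas i) p
    & forall i j, smooth_mx (overlap i j) (transition i j)].

(* Tensor fields (phi, xi, eta, g) on M, given by their components S i in every
   chart i, subject to the tensor transformation law. *)
Definition tensor_fields (S : I -> pc_data R n) : Prop :=
  forall i j x, overlap i j x ->
    let y := transition i j x in
    let J := 'J (transition i j) x in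
    [/\ pc_phi (S i) x *m J = J *m pc_phi (S j) y,
        pc_xi (S i) x *m J = pc_xi (S j) y,
        pc_eta (S i) x = J *m pc_eta (S j) y
      & pc_g (S i) x = J *m pc_g (S j) y *m J^T].

(* Smoothness and tensorial or local conditions are imposed in every chart. *)
Definition in_charts (S : I -> pc_data R n)
    (P : set 'rV[R]_n.+1 -> pc_data R n -> Prop) : Prop :=
  forall i, P (chart_img i) (S i).

End Manifold.

Definition diffeomorphism (R : realType) (n : nat) (W V : set 'rV[R]_n.+1)
    (k : 'rV[R]_n.+1 -> 'rV[R]_n.+1) : Prop :=
  [/\ open W, open V, smooth_mx W k, forall x, W x -> V (k x)
    & exists l : 'rV[R]_n.+1 -> 'rV[R]_n.+1,
      [/\ smooth_mx V l, forall y, V y -> W (l y),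
          forall x, W x -> l (k x) = x & forall y, V y -> k (l y) = y]].

(* The formulas for the coframe hold near x in U for the coframe dual to some
   adopted frame, in some coordinates k = (t,x1,x2,y1,y2). *)
Definition has_canonical_form (R : realType) (r0 sigma : R)
    (U : set 'rV[R]_5) (S : pc_data R 4) (x : 'rV[R]_5) : Prop :=
  exists (W V : set 'rV[R]_5) (k : 'rV[R]_5 -> 'rV[R]_5)
         (fr : 'I_5 -> 'rV[R]_5 -> 'rV[R]_5)
         (th : 'I_5 -> 'rV[R]_5 -> 'cV[R]_5)
         (f0 h0 : R -> R) (u0 v0 : R -> R -> R),
    [/\ W x /\ W `<=` U, diffeomorphism W V k, smooth_data V f0 h0 u0 v0,
        adopted_frame sigma S W fr /\ dual_coframe S W fr th
      & forall q, W q -> th i0 q = pc_eta S q /\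
        forall i, th i q =
          canonical_coframe r0 sigma f0 h0 u0 v0
            (coordf i0 \o k) (coordf i1 \o k) (coordf i2 \o k)
            (coordf i3 \o k) (coordf i4 \o k) i q].

(* Main.v *)
(** The leaves are para-Kähler exactly when [g((nabla_X phi) Y, Z) = 0] on the
    kernel of [eta]: by the Gauss formula this is the tangential part of the
    covariant derivative, and a leaf passes through every point.

    Converse.  With [d Phi = 0] this forces [nabla V1] and [nabla V2] to be
    eigenvectors of [phi], and [R(X,Y) phi xi = phi R(X,Y) xi = 0] is the Codazzi
    equation for [A]; together they give [nabla V1 = a th1 (x) V1] and
    [nabla V2 = c th2 (x) V2], so [th0], [th1], [th2] are closed.  Then
    [R(X,Y) V1 = (da /\ th1)(X,Y) V1], and the Bianchi identity and the Einstein
    condition give [V1 a = V2 c = r0/4], [xi a = V2 a = xi c = V1 c = 0] and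
    [V4 a + V3 c = 0].  Replacing [V3, V4] by [V3 + l V2, V4 - l V1] makes
    [V4 a = V3 c = 0] as well.  The coordinates are potentials [t, x1, x2] of
    [th0, th1, th2] together with [y1 = -4 a / r0] and [y2 = 4 c / r0], so that
    [f0 = h0 = 0]; the structure equations of [th3] and [th4] show that
    [u + t - r0 y1^2 / 8] and [v + sigma t - r0 y2^2 / 8] depend on [x1, x2] only.

    Direct part.  The model metric is
    [dt^2 - 2 dx1 dy1 + 2 a dx1^2 + 2 dx2 dy2 + 2 b dx2^2] with [a = f0' + u] and
    [b = h0' + v]; its Christoffel symbols are found from the uniqueness of the
    Levi-Civita connection, and the rest is a computation with 5 x 5 matrices. *)
Require Import Defs.
From HB Require Import structures.
From mathcomp Require Import all_boot all_order all_algebra.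
From mathcomp Require Import all_classical all_reals all_analysis.
From mathcomp Require Import ring lra.
Import Order.TTheory GRing.Theory Num.Theory.
Import numFieldNormedType.Exports.
Local Open Scope classical_set_scope.
Local Open Scope ring_scope.

Set Implicit Arguments.
Unset Strict Implicit.
Unset Printing Implicit Defensive.

(** * Partial derivatives and smooth functions *)

Section Differentiability.
Context {R : realType} {n : nat}.
Notation E := ('rV[R]_n.+1).
Implicit Types (U : set E) (f g : E -> R) (x v : E).

(** The tensor calculus is run on matrices: vectors are rows, the connection is a matrix [Gam i]
    acting from the right and the curvature is [curvmx i j]. Tensor identities become identities
    between matrix products, and vectors are recovered from their pairings with an adopted frame.
    Why [a] and [c] are coordinates: closed forms supply only [t], [x1], [x2], and these are
    constant along [V1] and [V2]. Since [V1 a = V2 c = r0/4] with [r0 != 0], the functions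
    [4 a / r0] and [4 c / r0] have unit derivative in exactly the two missing directions. Where the
    formula for [u] comes from: [th3 = (4/r0) da + u th1] with [th1] closed, so [d th3 = du /\ th1]
    determines [du] on [V0], [V1], [V2], which span the directions fixing [x1] and [x2]. The shape
    operator gives [V0 u = -1], hence the term [-t]; [nabla V1] gives [V1 u = a = - (r0/4) y1],
    whose primitive is [r0 y1^2 / 8]. The same holds for [v], with [-sigma] in place of [-1]. The
    covariant derivatives of [V3] and [V4] are never computed: the Gram matrix of the frame is
    constant, so derivatives can be moved to [V0], [V1], [V2]. *)

Lemma open_near U x : open U -> U x -> \forall y \near x, U y.
Proof. by move=> oU Ux; exact: open_nbhs_nbhs. Qed.

Lemma mulmx_sum_ebase (v : E) (a : 'cV[R]_n.+1) :
  (v *m a) 0 0 = \sum_i v 0 i * a i 0.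
Proof. by rewrite mxE. Qed.

Lemma normrV_ge (v : E) i : `|v 0 i| <= `|v|.
Proof.
rewrite [leRHS]/Num.norm/= mx_normrE.
exact: (le_bigmax _ (fun ij => `|v ij.1 ij.2|) (0, i)).
Qed.

Lemma normrV_le (v : E) (e : R) : 0 <= e -> (forall i, `|v 0 i| <= e) -> `|v| <= e.
Proof.
move=> e0 H; rewrite [leLHS]/Num.norm/= mx_normrE.
by apply: bigmax_le => // -[i j] _ /=; rewrite ord1.
Qed.

(** The map [h |-> h *m a] is bounded and linear, so the estimate identifies it as the differential.
    It serves where the derivative is guessed first: for the primitive of a closed form and for a
    local inverse. *)
Lemma differentiable_dfun f x (a : 'cV[R]_n.+1) :
  (forall e, 0 < e -> \forall h \near (0 : E),
     `|f (h + x) - f x - (h *m a) 0 0| <= e * `|h|) ->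
  differentiable f x /\ dfun f x = a.
Proof.
move=> H.
pose L (h : E) : R := (h *m a) 0 0.
have Llin : linear L.
  by move=> k u v; rewrite /L mulmxDl -scalemxAl !mxE.
pose Lm := GRing.isLinear.Build _ _ _ _ L Llin.
pose LL : {linear E -> R} := HB.pack L Lm.
have cL : continuous LL.
  apply: bounded_linear_continuous; apply/linear_boundedP.
  exists (\sum_i `|a i 0|); split=> [|r /ltW ar v]; first exact: num_real.
  rewrite /LL/= /L mulmx_sum_ebase; apply: (le_trans (ler_norm_sum _ _ _)).
  apply: (@le_trans _ _ (\sum_i `|v| * `|a i 0|)).
    by apply: ler_sum => i _; rewrite normrM ler_wpM2r// normrV_ge.
  by rewrite -mulr_sumr mulrC ler_wpM2r.
have E1 : f \o shift x = cst (f x) + LL +o_ (0 : E) id.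
  apply/eqaddoP => e e0; apply: filterS (H e e0) => h /=.
  by rewrite /LL/= /L opprD addrA.
have dd := diff_unique cL E1.
have df : differentiable f x.
  by apply/diff_locallyP; rewrite dd.
split=> //; apply/matrixP => i j; rewrite ord1 mxE /partial deriveE// dd /LL/= /L.
by rewrite /ebase -rowE mxE.
Qed.

Lemma differentiable_eps f x : differentiable f x ->
  forall e, 0 < e -> \forall h \near (0 : E),
     `|f (h + x) - f x - 'd f x h| <= e * `|h|.
Proof.
move=> /diff_locallyP[_ /eqaddoP H] e e0; apply: filterS (H e e0) => h /=.
by rewrite opprD addrA.
Qed.

Lemma derive_dfun f x v : differentiable f x -> 'D_v f x = (v *m dfun f x) 0 0.
Proof.
move=> df; rewrite deriveE// mulmx_sum_ebase {1}[v]row_sum_delta linear_sum.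
by apply: eq_bigr => i _; rewrite linearZ /= mxE /partial deriveE.
Qed.

Lemma derive_sum_partial f x v : differentiable f x ->
  'D_v f x = \sum_i v 0 i * partial i f x.
Proof.
by move=> df; rewrite derive_dfun// mulmx_sum_ebase; apply: eq_bigr => i _; rewrite mxE.
Qed.

Lemma near_eq_differentiable f g x : (\near x, f x = g x) ->
  differentiable f x -> differentiable g x.
Proof.
move=> fg df.
have H := differentiable_eps df.
apply: (fun K => (@differentiable_dfun g x (dfun f x) K).1) => e e0.
have fg0 : \forall h \near (0 : E), f (h + x) = g (h + x).
  by move: fg; rewrite (near_shift 0)/=; apply: filterS => h; rewrite /= subr0.
near=> h.
rewrite -(near fg0 h)// -(nbhs_singleton fg) -derive_dfun// deriveE//.
by near: h; exact: H.
Unshelve. all: by end_near. Qed.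

Lemma is_derive_line f x v (s : R) : differentiable f (x + s *: v) ->
  is_derive s 1 (fun s => f (x + s *: v)) ('D_v f (x + s *: v)).
Proof.
move=> df.
have dl : is_diff s (cst x + ( *:%R ^~ v : R -> E)) (0 + ( *:%R ^~ v : R -> E)).
  exact: is_diffD.
have dc : differentiable (f \o (cst x + ( *:%R ^~ v : R -> E))) s.
  exact: differentiable_comp.
split; first by apply: diff_derivable; exact: dc.
rewrite deriveE; last exact: dc.
by rewrite [LHS](congr1 (fun g : R -> R => g 1) (diff_comp _ _))//= diff_val/= add0r scale1r deriveE.
Qed.

End Differentiability.

Section PartialRules.
Context {R : realType} {n : nat}.
Notation E := ('rV[R]_n.+1).
Implicit Types (U : set E) (f g : E -> R) (x v : E).

Lemma near_eq_partial f g x i : (\near x, f x = g x) ->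
  partial i f x = partial i g x.
Proof. by move=> fg; exact: near_eq_derive. Qed.

Lemma partial_cst (c : R) x i : partial i (fun=> c) x = 0.
Proof. exact: derive_cst. Qed.

(** No differentiability is assumed, since the difference quotient is identically 0. Functions of
    [x1], [x2] alone can thus be treated at every point, although they are smooth only on [U]. *)
Lemma partial_const_line f i x : (forall q (t : R), f (q + t *: ebase i) = f q) ->
  partial i f x = 0.
Proof.
move=> H; rewrite /partial /derive.
rewrite (_ : (fun h => _) = cst 0) ?lim_cst//.
by apply/funext => h /=; rewrite [X in f X]addrC H subrr scaler0.
Qed.

Lemma partialD f g x i : differentiable f x -> differentiable g x ->
  partial i (fun y => f y + g y) x = partial i f x + partial i g x.
Proof. by move=> df dg; apply: deriveD; exact: diff_derivable. Qed.

Lemma partialN f x i : differentiable f x ->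
  partial i (fun y => - f y) x = - partial i f x.
Proof. by move=> df; apply: deriveN; exact: diff_derivable. Qed.

Lemma partialB f g x i : differentiable f x -> differentiable g x ->
  partial i (fun y => f y - g y) x = partial i f x - partial i g x.
Proof. by move=> df dg; apply: deriveB; exact: diff_derivable. Qed.

Lemma partialM f g x i : differentiable f x -> differentiable g x ->
  partial i (fun y => f y * g y) x = partial i f x * g x + f x * partial i g x.
Proof.
move=> df dg; rewrite /partial.
rewrite (@deriveM _ _ f g); [|exact: diff_derivable..].
by rewrite addrC [_ *: _]mulrC.
Qed.

Lemma partialV f x i : f x != 0 -> differentiable f x ->
  partial i (fun y => (f y)^-1) x = - (partial i f x * (f x)^-1 * (f x)^-1).
Proof.
move=> f0 df; rewrite /partial (@deriveV _ _ f)//; last exact: diff_derivable.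
by rewrite /GRing.scale/= mulNr; congr (- _); rewrite -exprVn expr2 mulrC mulrA.
Qed.

(** The two conclusions are proved together because the sum rule at each step asks for
    differentiability of the tail. *)
Lemma partial_sum (I : Type) (s : seq I) (P : pred I) (F : I -> E -> R) x i :
  (forall j, differentiable (F j) x) ->
  differentiable (fun y => \sum_(j <- s | P j) F j y) x /\
  partial i (fun y => \sum_(j <- s | P j) F j y) x
    = \sum_(j <- s | P j) partial i (F j) x.
Proof.
move=> dF; elim: s => [|j s [IH1 IH2]].
  rewrite big_nil (_ : (fun y => _) = (fun=> 0)).
    by rewrite partial_cst; split => //; exact: differentiable_cst.
  by apply/funext => y; rewrite big_nil.
rewrite big_cons.
rewrite (_ : (fun y => _) = (fun y => if P j
   then F j y + \sum_(j <- s | P j) F j y else \sum_(j <- s | P j) F j y)); last first.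
  by apply/funext => y; rewrite big_cons.
case: ifP => // _; split; first by apply: differentiableD.
by rewrite partialD// IH2.
Qed.

Lemma differentiable_coordf x i : differentiable (fun y : E => y 0 i) x.
Proof. exact: differentiable_coord. Qed.

Lemma partial_coordf x i j : partial i (fun y : E => y 0 j) x = (i == j)%:R.
Proof.
rewrite /partial (_ : 'D_ _ _ _ = (\matrix_(k, l) 'D_(ebase i) (fun y : E => y k l) x) 0 j).
  by rewrite -derive_mx// derive_id /ebase mxE eqxx/= eq_sym.
by rewrite mxE.
Qed.

End PartialRules.

Section ChainRule.
Context {R : realType} {m n : nat}.
Notation D := ('rV[R]_m.+1).
Notation E := ('rV[R]_n.+1).

Lemma differentiable_rV (F : D -> E) x :
  (forall j, differentiable (fun y => F y 0 j) x) -> differentiable F x.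
Proof.
move=> dF; rewrite (_ : F = \sum_j (fun y => F y 0 j *: ebase j)).
  by apply: differentiable_sum => j; exact: differentiableZl.
by apply/funext => y; rewrite fct_sumE [LHS]row_sum_delta.
Qed.

Lemma differentiable_rV_coord (F : D -> E) x j :
  differentiable F x -> differentiable (fun y => F y 0 j) x.
Proof.
move=> dF; apply: (@differentiable_comp _ _ _ _ F (fun M : E => M 0 j)) => //.
exact: differentiable_coord.
Qed.

Lemma derive_rV (F : D -> E) x v : differentiable F x ->
  'D_v F x = \row_j 'D_v (fun y => F y 0 j) x.
Proof.
move=> dF; rewrite derive_mx; last exact: diff_derivable.
by apply/matrixP => i j; rewrite !mxE ord1.
Qed.

Lemma jacobianE (F : D -> E) x i j : differentiable F x ->
  ('J F x) i j = partial i (fun y => F y 0 j) x.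
Proof.
move=> dF; have := deriveEjacobian (ebase i) dF.
by rewrite derive_rV// -rowE => /matrixP/(_ 0 j); rewrite !mxE => <-.
Qed.

Lemma differentiable_compose (f : E -> R) (F : D -> E) x :
  differentiable F x -> differentiable f (F x) ->
  differentiable (fun y => f (F y)) x.
Proof. by move=> dF df; exact: (@differentiable_comp _ _ _ _ F f). Qed.

Lemma derive_comp (f : E -> R) (F : D -> E) x v :
  differentiable F x -> differentiable f (F x) ->
  'D_v (fun y => f (F y)) x = 'D_('D_v F x) f (F x).
Proof.
move=> dF df; rewrite (deriveE _ df) (deriveE _ dF) deriveE; last first.
  exact: differentiable_compose.
exact: (congr1 (fun g : D -> R => g v) (diff_comp dF df)).
Qed.

Lemma partial_comp (f : E -> R) (F : D -> E) x i :
  differentiable F x -> differentiable f (F x) ->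
  partial i (fun y => f (F y)) x
    = \sum_j partial i (fun y => F y 0 j) x * partial j f (F x).
Proof.
move=> dF df; rewrite /partial derive_comp// derive_sum_partial//.
by apply: eq_bigr => j _; rewrite derive_rV// mxE.
Qed.

End ChainRule.

(** * Closure properties of smooth functions and matrices *)

Section Smooth.
Context {R : realType} {n : nat}.
Notation E := ('rV[R]_n.+1).
Implicit Types (U : set E) (f g : E -> R) (x v : E).

(* [smooth] unfolded as an induction on the order of differentiability. *)
Fixpoint ck (k : nat) U f : Prop :=
  (forall x, U x -> differentiable f x) /\
  if k is k'.+1 then forall i, ck k' U (partial i f) else True.

Lemma ck_diff k U f : ck k U f -> forall x, U x -> differentiable f x.
Proof. by case: k => [|k] []. Qed.

Lemma smooth_partial U f i : smooth U f -> smooth U (partial i f).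
Proof. by move=> sf s x Ux; have := sf (rcons s i) x Ux; rewrite foldr_rcons. Qed.

Lemma smooth_diff U f : smooth U f -> forall x, U x -> differentiable f x.
Proof. by move=> sf x Ux; exact: (sf [::]). Qed.

Lemma smoothP U f : smooth U f <-> forall k, ck k U f.
Proof.
split=> [sf k|ckf s].
  elim: k f sf => [|k IH] f sf /=; split=> //; first exact: smooth_diff.
    exact: smooth_diff.
  by move=> i; apply: IH; exact: smooth_partial.
(* The innermost derivative of [foldr partial f s] is the last entry of [s], hence the induction
   from the end. *)
have := ckf (size s); elim/last_ind: s f {ckf} => [|s i IH] f; first by case.
by rewrite size_rcons foldr_rcons => -[_ /(_ i)]; exact: IH.
Qed.

Lemma ckS k U f : ck k.+1 U f -> ck k U f.
Proof.
elim: k f => [|k IH] f [df pf]; split=> // i.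
exact/IH/pf.
Qed.

Lemma ck_ext k U f g : open U -> (forall x, U x -> f x = g x) ->
  ck k U f -> ck k U g.
Proof.
move=> oU; elim: k f g => [|k IH] f g fg [df pf]; split=> //.
- move=> x Ux; apply: near_eq_differentiable (df x Ux).
  by apply: filterS (open_near oU Ux); exact: fg.
- move=> x Ux; apply: near_eq_differentiable (df x Ux).
  by apply: filterS (open_near oU Ux); exact: fg.
- move=> i; apply: IH (pf i) => x Ux; apply: near_eq_partial.
  by apply: filterS (open_near oU Ux); exact: fg.
Qed.

Lemma ck_cst k U (c : R) : open U -> ck k U (fun=> c).
Proof.
move=> oU; elim: k c => [|k IH] c; split=> //; try by move=> x _; exact: differentiable_cst.
move=> i; apply: ck_ext (IH 0) => // x _; first by rewrite partial_cst.
Qed.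

Lemma ckD k U f g : open U -> ck k U f -> ck k U g -> ck k U (fun x => f x + g x).
Proof.
move=> oU; elim: k f g => [|k IH] f g [df pf] [dg pg]; split=> //.
- by move=> x Ux; apply: differentiableD; auto.
- by move=> x Ux; apply: differentiableD; auto.
- move=> i; apply: ck_ext (IH _ _ (pf i) (pg i)) => // x Ux.
  by rewrite partialD; auto.
Qed.

Lemma ckM k U f g : open U -> ck k U f -> ck k U g -> ck k U (fun x => f x * g x).
Proof.
move=> oU; elim: k f g => [|k IH] f g Cf Cg.
  by split=> // x Ux; apply: differentiableM; [apply: (ck_diff Cf)|apply: (ck_diff Cg)].
split=> [x Ux|i].
  by apply: differentiableM; [apply: (ck_diff Cf)|apply: (ck_diff Cg)].
have [[df pf] [dg pg]] := (Cf, Cg).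
have H := ckD oU (IH _ _ (pf i) (ckS Cg)) (IH _ _ (ckS Cf) (pg i)).
apply: ck_ext H => // x Ux.
by rewrite partialM; auto.
Qed.

(** The derivative [- f' / f^2] is a product of functions already known to be of class [k], one of
    them [1/f] by induction. *)
Lemma ckV k U f : open U -> (forall x, U x -> f x != 0) -> ck k U f ->
  ck k U (fun x => (f x)^-1).
Proof.
move=> oU f0; elim: k => [|k IH] Cf.
  by split=> // x Ux; apply: differentiableV; [apply: (ck_diff Cf)|apply: f0].
split=> [x Ux|i].
  by apply: differentiableV; [apply: (ck_diff Cf)|apply: f0].
have H := IH (ckS Cf).
have [df pf] := Cf.
have K := ckM oU (ck_cst k (-1) oU) (ckM oU (ckM oU (pf i) H) H).
apply: ck_ext K => // x Ux.
by rewrite partialV ?mulN1r; auto.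
Qed.

Lemma smooth_ext U f g : open U -> (forall x, U x -> f x = g x) ->
  smooth U f -> smooth U g.
Proof. by move=> oU fg /smoothP sf; apply/smoothP => k; exact: ck_ext (sf k). Qed.

Lemma smooth_sub U V f : V `<=` U -> smooth U f -> smooth V f.
Proof. by move=> VU sf s x /VU; exact: sf. Qed.

Lemma smooth_cst U (c : R) : open U -> smooth U (fun=> c).
Proof. by move=> oU; apply/smoothP => k; exact: ck_cst. Qed.

Lemma smoothD U f g : open U -> smooth U f -> smooth U g ->
  smooth U (fun x => f x + g x).
Proof. by move=> oU /smoothP sf /smoothP sg; apply/smoothP => k; exact: ckD. Qed.

Lemma smoothM U f g : open U -> smooth U f -> smooth U g ->
  smooth U (fun x => f x * g x).
Proof. by move=> oU /smoothP sf /smoothP sg; apply/smoothP => k; exact: ckM. Qed.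

Lemma smoothV U f : open U -> (forall x, U x -> f x != 0) -> smooth U f ->
  smooth U (fun x => (f x)^-1).
Proof. by move=> oU f0 /smoothP sf; apply/smoothP => k; exact: ckV. Qed.

Lemma smoothN U f : open U -> smooth U f -> smooth U (fun x => - f x).
Proof.
move=> oU sf; apply: smooth_ext (smoothM oU (smooth_cst (-1) oU) sf) => // x _.
by rewrite mulN1r.
Qed.

Lemma smoothB U f g : open U -> smooth U f -> smooth U g ->
  smooth U (fun x => f x - g x).
Proof. by move=> oU sf sg; apply: smoothD => //; exact: smoothN. Qed.

Lemma smoothX U f k : open U -> smooth U f -> smooth U (fun x => f x ^+ k).
Proof.
move=> oU sf; elim: k => [|k IH]; first exact: smooth_cst.
by apply: smooth_ext (smoothM oU sf IH) => // x _; rewrite exprS.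
Qed.

Lemma smooth_sum U (I : Type) (s : seq I) (P : pred I) (F : I -> E -> R) :
  open U -> (forall j, smooth U (F j)) ->
  smooth U (fun x => \sum_(j <- s | P j) F j x).
Proof.
move=> oU sF; elim: s => [|j s IH].
  by apply: smooth_ext (smooth_cst 0 oU) => // x _; rewrite big_nil.
have := IH; case Pj : (P j) => IHs; last first.
  by apply: smooth_ext IHs => // x _; rewrite big_cons Pj.
by apply: smooth_ext (smoothD oU (sF j) IHs) => // x _; rewrite big_cons Pj.
Qed.

Lemma smooth_prod U (I : Type) (s : seq I) (P : pred I) (F : I -> E -> R) :
  open U -> (forall j, smooth U (F j)) ->
  smooth U (fun x => \prod_(j <- s | P j) F j x).
Proof.
move=> oU sF; elim: s => [|j s IH].
  by apply: smooth_ext (smooth_cst 1 oU) => // x _; rewrite big_nil.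
have := IH; case Pj : (P j) => IHs; last first.
  by apply: smooth_ext IHs => // x _; rewrite big_cons Pj.
by apply: smooth_ext (smoothM oU (sF j) IHs) => // x _; rewrite big_cons Pj.
Qed.

Lemma ck_coordf k U i : open U -> ck k U (fun x => x 0 i).
Proof.
move=> oU; case: k => [|k]; split=> //; try by move=> x _; exact: differentiable_coordf.
by move=> j; apply: ck_ext (ck_cst k (j == i)%:R oU) => // x _; rewrite partial_coordf.
Qed.

Lemma smooth_coordf U i : open U -> smooth U (fun x => x 0 i).
Proof. by move=> oU; apply/smoothP => k; exact: ck_coordf. Qed.

Lemma smooth_continuous U f x : open U -> smooth U f -> U x -> {for x, continuous f}.
Proof. by move=> oU sf Ux; apply: differentiable_continuous; exact: smooth_diff sf x Ux. Qed.

Lemma smooth_mx_cst a b U (A : 'M[R]_(a, b)) : open U -> smooth_mx U (fun=> A).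
Proof. by move=> oU i j; exact: smooth_cst. Qed.

Lemma smooth_mx_ext a b U (F G : E -> 'M[R]_(a, b)) : open U ->
  (forall x, U x -> F x = G x) -> smooth_mx U F -> smooth_mx U G.
Proof. by move=> oU FG sF i j; apply: smooth_ext (sF i j) => // x Ux; rewrite FG. Qed.

Lemma smooth_mx_sub a b U V (F : E -> 'M[R]_(a, b)) : V `<=` U ->
  smooth_mx U F -> smooth_mx V F.
Proof. by move=> VU sF i j; apply: smooth_sub (sF i j). Qed.

Lemma smooth_mxM a b c U (F : E -> 'M[R]_(a, b)) (G : E -> 'M[R]_(b, c)) :
  open U -> smooth_mx U F -> smooth_mx U G -> smooth_mx U (fun x => F x *m G x).
Proof.
move=> oU sF sG i j.
apply: smooth_ext (@smooth_sum U _ (index_enum _) predT (fun k x => F x i k * G x k j) oU _) => //.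
  by move=> x _; rewrite mxE.
by move=> k; exact: smoothM.
Qed.

Lemma smooth_mxD a b U (F G : E -> 'M[R]_(a, b)) :
  open U -> smooth_mx U F -> smooth_mx U G -> smooth_mx U (fun x => F x + G x).
Proof.
by move=> oU sF sG i j; apply: smooth_ext (smoothD oU (sF i j) (sG i j)) => // x _; rewrite mxE.
Qed.

Lemma smooth_mxZ a b U f (G : E -> 'M[R]_(a, b)) :
  open U -> smooth U f -> smooth_mx U G -> smooth_mx U (fun x => f x *: G x).
Proof.
by move=> oU sF sG i j; apply: smooth_ext (smoothM oU sF (sG i j)) => // x _; rewrite mxE.
Qed.

Lemma smooth_mxN a b U (F : E -> 'M[R]_(a, b)) :
  open U -> smooth_mx U F -> smooth_mx U (fun x => - F x).
Proof.
by move=> oU sF i j; apply: smooth_ext (smoothN oU (sF i j)) => // x _; rewrite mxE.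
Qed.

Lemma smooth_mxT a b U (F : E -> 'M[R]_(a, b)) :
  open U -> smooth_mx U F -> smooth_mx U (fun x => (F x)^T).
Proof.
by move=> oU sF i j; apply: smooth_ext (sF j i) => // x _; rewrite mxE.
Qed.

Lemma smooth_det a U (F : E -> 'M[R]_a) : open U -> smooth_mx U F ->
  smooth U (fun x => \det (F x)).
Proof.
move=> oU sF; apply: smooth_sum => // s; apply: smoothM => //; first exact: smooth_cst.
exact: smooth_prod.
Qed.

Lemma smooth_invmx a U (F : E -> 'M[R]_a) : open U ->
  (forall x, U x -> F x \in unitmx) -> smooth_mx U F ->
  smooth_mx U (fun x => invmx (F x)).
Proof.
move=> oU uF sF i j.
have sc : smooth U (fun x => cofactor (F x) j i).
  apply: smoothM => //; first exact: smooth_cst.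
  apply: smooth_det => // k l.
  by apply: smooth_ext (sF (lift j k) (lift i l)) => // x _; rewrite !mxE.
have sd : smooth U (fun x => (\det (F x))^-1).
  apply: smoothV => //; last exact: smooth_det.
  by move=> x /uF; rewrite unitmxE unitfE.
apply: smooth_ext (smoothM oU sd sc) => // x Ux.
by rewrite /invmx uF// !mxE.
Qed.

End Smooth.

Section SmoothComp.
Context {R : realType} {m n : nat}.
Notation D := ('rV[R]_m.+1).
Notation E := ('rV[R]_n.+1).

Lemma ck_comp k (W : set D) (U : set E) (f : E -> R) (F : D -> E) : open W ->
  (forall x, W x -> U (F x)) ->
  (forall j, ck k W (fun x => F x 0 j)) -> ck k U f -> ck k W (fun x => f (F x)).
Proof.
move=> oW WU; elim: k f => [|k IH] f CF Cf.
  split=> // x Wx; apply: differentiable_compose.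
    by apply: differentiable_rV => j; exact: (ck_diff (CF j)).
  exact: ck_diff Cf _ (WU _ Wx).
have dF x : W x -> differentiable F x.
  by move=> Wx; apply: differentiable_rV => j; exact: (ck_diff (CF j)).
split=> [x Wx|i].
  by apply: differentiable_compose; [exact: dF|exact: ck_diff Cf _ (WU _ Wx)].
have H : ck k W (fun x => \sum_j partial i (fun y => F y 0 j) x * partial j f (F x)).
  elim: (index_enum _) => [|j s IHs].
    by apply: ck_ext (ck_cst k 0 oW) => // x _; rewrite big_nil.
  apply: (@ck_ext _ _ _ _ (fun x => partial i (fun y => F y 0 j) x * partial j f (F x)
    + \sum_(j <- s) partial i (fun y => F y 0 j) x * partial j f (F x))) => //.
    by move=> x _; rewrite big_cons.
  apply: ckD => //; apply: ckM => //; first exact: (CF j).2.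
  by apply: IH => [l|]; [exact/ckS/CF|exact: Cf.2].
apply: ck_ext H => // x Wx; rewrite partial_comp//; first exact: dF.
exact: ck_diff Cf _ (WU _ Wx).
Qed.

Lemma smooth_comp (W : set D) (U : set E) (f : E -> R) (F : D -> E) : open W ->
  (forall x, W x -> U (F x)) -> smooth_mx W F -> smooth U f ->
  smooth W (fun x => f (F x)).
Proof.
move=> oW WU sF /smoothP sf; apply/smoothP => k; apply: ck_comp WU _ (sf k) => // j.
by have /smoothP := sF 0 j; exact.
Qed.

Lemma smooth_mx_diff (W : set D) (F : D -> E) x : smooth_mx W F -> W x -> differentiable F x.
Proof. by move=> sF Wx; apply: differentiable_rV => j; exact: smooth_diff (sF 0 j) _ Wx. Qed.

Lemma smooth_jacobian (W : set D) (F : D -> E) : open W -> smooth_mx W F ->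
  smooth_mx W (fun x => 'J F x).
Proof.
move=> oW sF i j; apply: smooth_ext (smooth_partial i (sF 0 j)) => // x Wx.
by rewrite jacobianE//; exact: smooth_mx_diff sF Wx.
Qed.

End SmoothComp.

(** * The Schwarz and Poincaré lemmas *)

Local Opaque derive.

Section MeanValue.
Context {R : realType} {n : nat}.
Notation E := ('rV[R]_n.+1).
Implicit Types (U : set E) (f g : E -> R) (x v : E).

Lemma deriveZv f x v (c : R) : differentiable f x -> 'D_(c *: v) f x = c * 'D_v f x.
Proof. by move=> df; rewrite !derive_dfun// -scalemxAl mxE. Qed.

Lemma mean_value f x v :
  (forall s : R, 0 <= s <= 1 -> differentiable f (x + s *: v)) ->
  exists2 c : R, 0 <= c <= 1 & f (x + v) - f x = 'D_v f (x + c *: v).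
Proof.
move=> df.
have [| |c c01] := @MVT_segment R (fun s => f (x + s *: v))
    (fun s => 'D_v f (x + s *: v)) 0 1 ler01.
- move=> s; rewrite in_itv/= => /andP[/ltW s0 /ltW s1].
  by apply: is_derive_line; apply: df; rewrite s0.
- apply: continuous_in_subspaceT => t /set_mem/=; rewrite in_itv/= => t01.
  apply: differentiable_continuous; apply/derivable1_diffP.
  by have /@ex_derive := is_derive_line (df t t01).
- rewrite in_itv/= in c01; rewrite scale1r scale0r addr0 subr0 mulr1 => ->.
  by exists c.
Qed.

Lemma differentiable_shift f x v : differentiable f (x + v) ->
  differentiable (fun y => f (y + v)) x.
Proof.
move=> df; apply: (@differentiable_compose _ _ _ f (fun y => y + v)) _ df.
by apply: differentiableD => //; exact: differentiable_cst.
Qed.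

Lemma derive_shiftv f x v w : differentiable f (x + v) ->
  'D_w (fun y => f (y + v)) x = 'D_w f (x + v).
Proof.
move=> df.
have dv : differentiable (fun y : E => y + v) x.
  by apply: differentiableD => //; exact: differentiable_cst.
rewrite (derive_comp w dv df); congr ('D_ _ f _).
rewrite (@deriveD _ _ _ id (cst v)); [|exact: derivable_id|exact: derivable_cst].
by rewrite derive_id derive_cst addr0.
Qed.

(** The mean value theorem is applied along [ebase i] to the increment [phi], and then along
    [ebase j] to [partial i f]. *)
Lemma second_difference f x (i j : 'I_n.+1) (h : R) : 0 <= h ->
  (forall s t : R, 0 <= s <= h -> 0 <= t <= h ->
     let y := x + s *: ebase i + t *: ebase j in
     differentiable f y /\ differentiable (partial i f) y) ->
  exists s t : R, [/\ 0 <= s <= h, 0 <= t <= h &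
    f (x + h *: ebase i + h *: ebase j) - f (x + h *: ebase i)
     - (f (x + h *: ebase j) - f x)
    = h * h * partial j (partial i f) (x + s *: ebase i + t *: ebase j)].
Proof.
move=> h0 df.
have sh (c : R) : 0 <= c <= 1 -> 0 <= c * h <= h.
  by move=> /andP[c0 c1]; rewrite mulr_ge0//= ler_piMl.
have hh : 0 <= h <= h by rewrite h0 lexx.
have h00 : 0 <= (0 : R) <= h by rewrite lexx.
pose phi y := f (y + h *: ebase j) - f y.
have dphi s : 0 <= s <= h -> differentiable (fun y => f (y + h *: ebase j)) (x + s *: ebase i)
   /\ differentiable f (x + s *: ebase i).
  move=> sh'; split; first by apply: differentiable_shift; case: (df s h sh' hh).
  by case: (df s 0 sh' h00); rewrite scale0r addr0.
have [s /andP[s0 s1]|c c01] := @mean_value phi x (h *: ebase i).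
  rewrite scalerA; have [|d1 d2] := dphi (s * h); first by apply: sh; rewrite s0.
  exact: differentiableB.
rewrite scalerA; have [d1 d2] := dphi (c * h) (sh _ c01).
rewrite deriveZv; last exact: differentiableB.
have [d3 d4] := df _ h (sh _ c01) hh.
rewrite (@deriveB _ _ _ (fun y => f (y + h *: ebase j)) f); [|exact: diff_derivable..].
rewrite derive_shiftv// => E1.
have [s s01|c' c'01] := @mean_value (partial i f) (x + (c * h) *: ebase i) (h *: ebase j).
  by rewrite scalerA; case: (df (c * h) (s * h) (sh _ c01) (sh _ s01)).
rewrite scalerA deriveZv; last by case: (df (c * h) (c' * h) (sh _ c01) (sh _ c'01)).
move=> E2; exists (c * h), (c' * h); split; [exact: sh|exact: sh|].
by rewrite -/(phi _) -[f (x + _) - f x]/(phi x) E1 -!/(partial _ _) E2 mulrA.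
Qed.

Lemma norm_ebase i : `|ebase i : E| <= 1.
Proof.
apply: normrV_le => // j; rewrite /ebase mxE eqxx/=.
by case: eqP => _; rewrite ?normr1 ?normr0.
Qed.

Lemma smooth_near U f x e : open U -> smooth U f -> U x -> 0 < e ->
  \forall y \near x, `|f x - f y| < e.
Proof.
move=> oU sf Ux e0; have fc := smooth_continuous oU sf Ux.
by move/cvgrPdist_lt : fc; apply.
Qed.

(** The second difference over a square is symmetric in [i] and [j], so the two mixed derivatives
    agree at two nearby points; continuity brings both points to [x]. *)
Lemma schwarz U f x i j : open U -> smooth U f -> U x ->
  partial i (partial j f) x = partial j (partial i f) x.
Proof.
move=> oU sf Ux; apply/eqP; rewrite -subr_eq0 -normr_le0; apply/ler_addgt0Pl => e e0.
rewrite addr0.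
have e20 : 0 < e / 2 by rewrite divr_gt0.
have sij := smooth_partial i (smooth_partial j sf).
have sji := smooth_partial j (smooth_partial i sf).
have H2 := smooth_near oU sij Ux e20.
have H3 := smooth_near oU sji Ux e20.
have [d /= d0 Bd] := (nbhs_ballP _ _).1 (filterI (open_near oU Ux) (filterI H2 H3)).
(* Every point of the square is at distance at most [2 h < d] from [x]. *)
pose h := d / 3.
have h0 : 0 < h by rewrite divr_gt0.
have inB (a b : 'I_n.+1) s t : 0 <= s <= h -> 0 <= t <= h ->
    ball x d (x + s *: ebase a + t *: ebase b).
  move=> /andP[s0 sh] /andP[t0 th]; rewrite -ball_normE /ball_/= -addrA opprD addNKr normrN.
  apply: (le_lt_trans (ler_normD _ _)); rewrite !normrZ !ger0_norm//.
  apply: (@le_lt_trans _ _ (h + h)).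
    by apply: lerD; [apply: le_trans sh|apply: le_trans th];
      rewrite ler_piMr// norm_ebase.
  by rewrite /h; lra.
have [|s [t [sh t'h E1]]] := @second_difference f x i j h (ltW h0).
  move=> s t st tt y; have [Uy _] := Bd _ (inB i j _ _ st tt).
  by split; [exact: smooth_diff sf _ Uy|exact: smooth_diff (smooth_partial i sf) _ Uy].
have [|s2 [t2 [s2h t2h E2]]] := @second_difference f x j i h (ltW h0).
  move=> s2 t2 st tt y; have [Uy _] := Bd _ (inB j i _ _ st tt).
  by split; [exact: smooth_diff sf _ Uy|exact: smooth_diff (smooth_partial j sf) _ Uy].
have E : partial j (partial i f) (x + s *: ebase i + t *: ebase j)
       = partial i (partial j f) (x + s2 *: ebase j + t2 *: ebase i).
  apply: (@mulfI _ (h * h)); first by rewrite mulf_neq0// gt_eqF.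
  apply: etrans (esym E1) _; apply: etrans E2.
  by rewrite (addrAC x) opprB opprB addrACA [RHS]addrACA; congr (_ + _); exact: addrC.
have [_ [_ A1]] := Bd _ (inB i j _ _ sh t'h).
have [_ [A2 _]] := Bd _ (inB j i _ _ s2h t2h).
rewrite -(subrKA (partial i (partial j f) (x + s2 *: ebase j + t2 *: ebase i))).
apply: (le_trans (ler_normD _ _)); rewrite [e]splitr; apply: lerD; first exact: ltW.
by apply: ltW; rewrite distrC -E; exact: A1.
Qed.

End MeanValue.

Section Antiderivative.
Context {R : realType}.
Notation mu := (@lebesgue_measure R).

(** Derivative inside and continuity up to the end points are what the mean value theorem on
    [[0, 1]] will ask for. *)
Lemma antiderivative (g : R -> R) :
  (forall s : R, 0 <= s <= 1 -> {for s, continuous g}) ->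
  let F := parameterized_integral mu 0 ^~ g in
  [/\ F 0 = 0, {within `[0, 1], continuous F}
    & forall s : R, 0 < s < 1 -> is_derive s 1 F (g s)].
Proof.
move=> gc F.
have gint : mu.-integrable `[0, 1] (EFin \o g).
  apply: continuous_compact_integrable; first exact: segment_compact.
  apply: continuous_in_subspaceT => s /set_mem/=; rewrite in_itv/= => s01.
  exact: gc.
split.
- rewrite /F /parameterized_integral set_itv1.
  by rewrite Rintegral_set1.
- exact: parameterized_integral_continuous.
- move=> s /andP[s0 s1].
  have [|dF F'] := @continuous_FTC1_closed R g 0 s 1 s1 gint s0.
    by apply: gc; rewrite !ltW.
  by split=> //; rewrite -derive1E.
Qed.

End Antiderivative.

(** * The Poincaré lemma on a ball *)

Section Poincare.
Context {R : realType} {n : nat}.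
Notation E := ('rV[R]_n.+1).
Notation N := (n.+1%:R : R).
Implicit Types (U : set E) (f g : E -> R) (x v : E).

Lemma ball_segment (p y k : E) (r s : R) : ball p r y -> ball p r (y + k) ->
  0 <= s <= 1 -> ball p r (y + s *: k).
Proof.
rewrite -!ball_normE /ball_/= => B1 B2 /andP[s0 s1].
rewrite (_ : p - _ = (1 - s) *: (p - y) + s *: (p - (y + k))).
  apply: (le_lt_trans (ler_normD _ _)); rewrite !normrZ (ger0_norm s0) ger0_norm ?subr_ge0//.
  have [->|s'] := eqVneq s 0; first by rewrite subr0 mul1r mul0r addr0.
  have s'0 : 0 < s by rewrite lt_def s' s0.
  have : (1 - s) * `|p - y| <= (1 - s) * r by rewrite ler_wpM2l ?subr_ge0// ltW.
  have : s * `|p - (y + k)| < s * r by rewrite ltr_pM2l.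
  lra.
by apply/matrixP => i j; rewrite !mxE; ring.
Qed.

Lemma near_bounded (T : finType) (F : T -> E -> R) U x : open U -> U x ->
  (forall t, smooth U (F t)) ->
  exists2 M : R, 0 <= M & \forall y \near x, forall t, `|F t y| <= M.
Proof.
move=> oU Ux sF; exists (\sum_t (`|F t x| + 1)).
  by apply: sumr_ge0 => t _; rewrite addr_ge0.
apply: (@filter_forall _ _ (fun t y => `|F t y| <= \sum_t (`|F t x| + 1)) (nbhs x)) => t.
apply: filterS (smooth_near oU (sF t) Ux ltr01) => y Hy.
rewrite (bigD1 t)//=; apply: ler_wpDr.
  by apply: sumr_ge0 => t' _; rewrite addr_ge0.
rewrite -[F t y](subKr (F t x)); apply: (le_trans (ler_normB _ _)).
by rewrite lerD2l ltW.
Qed.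

(** Row vectors carry the maximum norm, so each pairing costs a factor [N], the dimension. *)
Lemma sum_bound (a v : E) (M : R) : (forall i, `|a 0 i| <= M) ->
  `|\sum_i v 0 i * a 0 i| <= N * M * `|v|.
Proof.
move=> aM; apply: (le_trans (ler_norm_sum _ _ _)).
apply: (@le_trans _ _ (\sum_(i < n.+1) M * `|v|)); last first.
  by rewrite sumr_const card_ord -[leLHS]mulr_natl mulrA.
by apply: ler_sum => i _; rewrite normrM mulrC ler_pM// normrV_ge.
Qed.

Lemma lipschitz_ball f p r M (y k : E) :
  (forall z, ball p r z -> differentiable f z /\ forall i, `|partial i f z| <= M) ->
  ball p r y -> ball p r (y + k) -> `|f (y + k) - f y| <= N * M * `|k|.
Proof.
move=> fB By Byk.
have [s s01|c c01 ->] := @mean_value R n f y k.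
  by case: (fB _ (ball_segment By Byk s01)).
have [df pf] := fB _ (ball_segment By Byk c01).
rewrite derive_sum_partial//.
rewrite (eq_bigr (fun i => k 0 i * (\row_j partial j f (y + c *: k)) 0 i)); last first.
  by move=> i _; rewrite mxE.
by apply: sum_bound => i; rewrite mxE.
Qed.

(** The increment equals the derivative at an intermediate point, and replacing that point by [y]
    costs the Lipschitz constant of the partial derivatives. *)
Lemma taylor_ball f p r M (y k : E) : 0 <= M ->
  (forall z, ball p r z -> [/\ differentiable f z,
     forall i, differentiable (partial i f) z
   & forall i j, `|partial i (partial j f) z| <= M]) ->
  ball p r y -> ball p r (y + k) ->
  `|f (y + k) - f y - \sum_i k 0 i * partial i f y| <= N * (N * M * `|k|) * `|k|.
Proof.
move=> M0 fB By Byk.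
have [s s01|c c01 ->] := @mean_value R n f y k.
  by case: (fB _ (ball_segment By Byk s01)).
have Bc := ball_segment By Byk c01.
have [df _ _] := fB _ Bc.
rewrite derive_sum_partial// -sumrB.
rewrite (eq_bigr (fun i => k 0 i * (\row_j (partial j f (y + c *: k) - partial j f y)) 0 i)); last first.
  by move=> i _; rewrite mxE mulrBr.
apply: sum_bound => i; rewrite mxE.
apply: (@le_trans _ _ (N * M * `|c *: k|)).
  by apply: lipschitz_ball By Bc => z /fB[_ dz pz].
case/andP: c01 => c0 c1.
by rewrite normrZ ger0_norm// ler_wpM2l ?mulr_ge0// ler_piMl.
Qed.

(** The primitive is the integral [F x 1] of the form along the segment from [p] to [x].
    Differentiation under the integral is avoided: the mean value theorem is applied to
    [Q s = F (x+h) s - F x s - s K s], where [K s] is the form at [gam x s] evaluated on [h]. [Q 1]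
    is the first-order remainder at [x], and closedness makes the derivative of [Q] quadratic in
    [h]. *)
Lemma poincare U (th : 'I_n.+1 -> E -> R) p : open U -> U p ->
  (forall i, smooth U (th i)) ->
  (forall x i j, U x -> partial i (th j) x = partial j (th i) x) ->
  exists W f, [/\ open W, W p, W `<=` U, smooth W f &
    forall x, W x -> forall i, partial i f x = th i x].
Proof.
move=> oU Up sth cth.
have [M1 M10 B1] := @near_bounded _ (fun t : 'I_n.+1 * 'I_n.+1 => partial t.1 (th t.2))
  U p oU Up (fun t => smooth_partial t.1 (sth t.2)).
have [M2 M20 B2] := @near_bounded _
  (fun t : 'I_n.+1 * 'I_n.+1 * 'I_n.+1 => partial t.1.1 (partial t.1.2 (th t.2)))
  U p oU Up (fun t => smooth_partial t.1.1 (smooth_partial t.1.2 (sth t.2))).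
have [r /= r0 Br] := (nbhs_ballP _ _).1 (filterI (open_near oU Up) (filterI B1 B2)).
pose W := ball p r.
have oW : open W by exact: ball_open.
have Wp : W p by exact: ballxx.
have WU : W `<=` U by move=> y /Br[].
pose gam x (s : R) : E := p + s *: (x - p).
have gamW x (s : R) : W x -> 0 <= s <= 1 -> W (gam x s).
  by move=> Wx s01; apply: ball_segment => //; rewrite addrC subrK.
pose g x (s : R) := \sum_m th m (gam x s) * (x - p) 0 m.
pose F x := parameterized_integral (@lebesgue_measure R) 0 ^~ (g x).
have dth m x (s : R) : W x -> 0 <= s <= 1 -> is_derive s 1 (fun s => th m (gam x s))
     (\sum_i (x - p) 0 i * partial i (th m) (gam x s)).
  move=> Wx s01; have dd := smooth_diff (sth m) (WU _ (gamW _ _ Wx s01)).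
  by rewrite -derive_sum_partial//; exact: is_derive_line.
have FP x : W x -> [/\ F x 0 = 0, {within `[0, 1], continuous (F x)}
    & forall s : R, 0 < s < 1 -> is_derive s 1 (F x) (g x s)].
  move=> Wx; apply: antiderivative => s s01.
  apply: differentiable_continuous; apply/derivable1_diffP.
  rewrite /g (_ : (fun s => _) = \sum_m (fun s => th m (gam x s) * (x - p) 0 m)); last first.
    by apply/funext => t; rewrite fct_sumE.
  apply: derivable_sum => m; apply: derivableM => //.
  by have /@ex_derive := dth m x s Wx s01.
have key x : W x -> differentiable (fun x => F x 1) x /\
    dfun (fun x => F x 1) x = \col_m th m x.
  move=> Wx; apply: differentiable_dfun => e e0.
  (* [C |h|^2] bounds the derivative of [Q]: the first summand is a Lipschitz bound for [th], the
     second a Taylor bound multiplied by [|x - p| <= r]. *)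
  pose C := N * (N * M1) + N * (r * (N * (N * M2))).
  have C0 : 0 <= C by rewrite addr_ge0// !mulr_ge0// ltW.
  have Wn : \forall h \near (0 : E), W (h + x).
    have := open_near oW Wx; rewrite (near_shift 0)/=.
    by apply: filterS => h; rewrite /= subr0.
  have hs : \forall h \near (0 : E), `|h| < e / (C + 1).
    by apply: nbhs0_lt; rewrite divr_gt0// ltr_wpDl.
  apply: filterS (filterI Wn hs) => h [Wh hlt] {Wn hs}.
  set w := x - p.
  have WP := FP x Wx; have [F0 cF dF] := WP.
  have [F0' cF' dF'] := FP _ Wh.
  pose K : R -> R := \sum_m (h 0 m *: (fun s => th m (gam x s) : R)).
  pose dK (s : R) : R := \sum_m h 0 m *: (\sum_i w 0 i * partial i (th m) (gam x s)).
  have dKs (s : R) : 0 <= s <= 1 -> is_derive s 1 K (dK s).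
    move=> s01; apply: is_derive_sum => m; apply: is_deriveZ; exact: dth.
  pose Q : R -> R := F (h + x) - F x - id * K.
  pose dQ (s : R) := g (h + x) s - g x s - (s * dK s + K s).
  have dTs (s : R) : 0 <= s <= 1 -> is_derive s 1 (id * K) (s * dK s + K s).
    move=> s01; have H := dKs s s01.
    by apply: is_derive_eq (is_deriveM _ H) _; rewrite /GRing.scale/= mulr1.
  have [s|s|c c01] := @MVT_segment R Q dQ 0 1 ler01.
  - rewrite in_itv/= => s01; apply: is_deriveB; last first.
      by apply: dTs; case/andP: s01 => /ltW-> /ltW->.
    by apply: is_deriveB; [exact: dF'|exact: dF].
  - apply: continuousB; first by apply: continuousB; [exact: cF'|exact: cF].
    move: s; apply: continuous_in_subspaceT => s /set_mem/=; rewrite in_itv/= => s01.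
    apply: differentiable_continuous; apply/derivable1_diffP.
    by have /@ex_derive := dTs s s01.
  rewrite subr0 mulr1 in_itv/= in c01 *.
  have KE (s : R) : K s = \sum_m h 0 m * th m (gam x s) by rewrite /K fct_sumE.
  have -> : Q 1 - Q 0 = F (h + x) 1 - F x 1 - (h *m \col_m th m x) 0 0.
    rewrite /Q -!/(_ - _) [X in X - _ = _](_ : _ = F (h + x) 1 - F x 1 - 1 * K 1)//.
    rewrite [X in _ - X = _](_ : _ = F (h + x) 0 - F x 0 - 0 * K 0)//.
    rewrite F0 F0' subrr mul0r !subr0 mul1r; congr (_ - _).
    rewrite KE mulmx_sum_ebase; apply: eq_bigr => m _.
    by rewrite mxE /gam scale1r addrC subrK.
  move=> ->.
  have Wy := gamW x c Wx c01; have Wyk := gamW (h + x) c Wh c01.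
  have gE : gam (h + x) c = gam x c + c *: h.
    by apply/matrixP => a b; rewrite /gam !mxE; ring.
  rewrite gE in Wyk.
  set y := gam x c in Wy Wyk gE.
  (* Closedness enters here: exchanging the two indices makes [c * dK c] the linear Taylor term of
     [th] at [y] in the direction [c *: h]. *)
  have D : c * dK c = \sum_m w 0 m * \sum_i (c *: h) 0 i * partial i (th m) y.
    rewrite /dK mulr_sumr.
    under eq_bigr do rewrite /GRing.scale/= !mulr_sumr.
    rewrite exchange_big/=; apply: eq_bigr => m _.
    rewrite mulr_sumr; apply: eq_bigr => i _.
    by rewrite !mxE (cth y m i (WU _ Wy)); ring.
  have -> : dQ c =
      \sum_m h 0 m * (\row_m (th m (y + c *: h) - th m y)) 0 m
    + \sum_m w 0 m * (\row_m (th m (y + c *: h) - th m y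
          - \sum_i (c *: h) 0 i * partial i (th m) y)) 0 m.
    rewrite /dQ D KE /g gE -/y -!big_split/= -!sumrB; apply: eq_bigr => m _.
    by rewrite /w !mxE; ring.
  have ch : `|c *: h| <= `|h|.
    by case/andP: c01 => c0 c1; rewrite normrZ ger0_norm// ler_piMl.
  have wr : `|w| <= r by move: Wx; rewrite /W -ball_normE /ball_/= distrC => /ltW.
  have S1 : `|\sum_m h 0 m * (\row_m (th m (y + c *: h) - th m y)) 0 m|
      <= N * (N * M1 * `|h|) * `|h|.
    apply: sum_bound => m; rewrite mxE.
    apply: (@le_trans _ _ (N * M1 * `|c *: h|)); last by rewrite ler_wpM2l// mulr_ge0.
    apply: lipschitz_ball Wy Wyk => z Wz; split; first exact: smooth_diff (sth m) _ (WU _ Wz).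
    by move=> i; have [_ [/(_ (i, m))]] := Br _ Wz.
  have S2 : `|\sum_m w 0 m * (\row_m (th m (y + c *: h) - th m y
          - \sum_i (c *: h) 0 i * partial i (th m) y)) 0 m|
      <= N * (N * (N * M2 * `|h|) * `|h|) * r.
    apply: (@le_trans _ _ (N * (N * (N * M2 * `|h|) * `|h|) * `|w|)); last first.
      by rewrite ler_wpM2l// !mulr_ge0.
    apply: sum_bound => m; rewrite mxE.
    apply: (@le_trans _ _ (N * (N * M2 * `|c *: h|) * `|c *: h|)); last first.
      by rewrite ler_pM// ?mulr_ge0// ler_wpM2l// ler_wpM2l// mulr_ge0.
    apply: (@taylor_ball _ p r) Wy Wyk => // z Wz; split.
    - exact: smooth_diff (sth m) _ (WU _ Wz).
    - by move=> i; exact: smooth_diff (smooth_partial i (sth m)) _ (WU _ Wz).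
    - by move=> i j; have [_ [_ /(_ (i, j, m))]] := Br _ Wz.
  apply: (le_trans (ler_normD _ _)); apply: (le_trans (lerD S1 S2)).
  rewrite [leLHS](_ : _ = C * `|h| * `|h|); last by rewrite /C; ring.
  rewrite ler_wpM2r//; move: hlt; rewrite ltr_pdivlMr ?ltr_wpDl// => /ltW.
  by apply: le_trans; rewrite mulrC ler_wpM2l// lerDl.
exists W, (fun x => F x 1); split=> //; last first.
  by move=> x Wx i; have [_ /matrixP/(_ i 0)] := key x Wx; rewrite !mxE.
(* Beyond the first derivative nothing new is needed, because the partial derivatives of the
   primitive are the smooth functions [th i]. *)
move=> s; elim/last_ind: s => [|s i _] x Wx; first by case: (key x Wx).
have H : smooth W (partial i (fun x => F x 1)).
  apply: smooth_ext (smooth_sub WU (sth i)) => // y Wy.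
  by have [_ /matrixP/(_ i 0)] := key y Wy; rewrite !mxE.
by rewrite foldr_rcons; exact: H.
Qed.

End Poincare.

(** * The inverse function theorem *)

Local Opaque derive partial.

(** Completeness of the space of row vectors, as required by the contraction principle. *)
HB.instance Definition _ (R : realType) (n : nat) := Complete.on 'rV[R]_n.+1.

Section InverseFunction.
Context {R : realType} {n : nat}.
Notation E := ('rV[R]_n.+1).
Notation N := (n.+1%:R : R).
Implicit Types (U V W : set E) (k : E -> E) (x y z v : E).

Lemma norm_mulmx v (B : 'M[R]_n.+1) : `|v *m B| <= N * `|B| * `|v|.
Proof.
apply: normrV_le => [|j]; first by rewrite !mulr_ge0.
rewrite mxE (eq_bigr (fun i => v 0 i * (\row_i B i j) 0 i)); last first.
  by move=> i _; rewrite mxE.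
apply: sum_bound => i; rewrite mxE [leRHS]/Num.norm/= mx_normrE.
exact: (le_bigmax _ (fun ij => `|B ij.1 ij.2|) (i, j)).
Qed.

Lemma norm_sub_lt_neq0 (a b : R) : `|a - b| < `|a| -> b != 0.
Proof. by apply: contraTneq => ->; rewrite subr0 ltxx. Qed.

Lemma open_preim W V k : open W -> (forall x, W x -> differentiable k x) -> open V ->
  open [set x | W x /\ V (k x)].
Proof.
rewrite !openE => oW dk oV x [Wx Vk]; apply: filterI; first exact: oW.
have kc : {for x, continuous k} by apply: differentiable_continuous; exact: dk.
exact: kc (oV _ Vk).
Qed.

(** It allows the range of a coordinate system to be cut down to a ball, where points can be joined
    by segments. *)
Lemma diffeomorphism_restrict W V V' k : diffeomorphism W V k -> open V' -> V' `<=` V ->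
  diffeomorphism [set x | W x /\ V' (k x)] V' k.
Proof.
move=> [oW oV sk WV [l [sl VW lk kl]]] oV' V'V; split=> //.
- by apply: open_preim => // x Wx; exact: smooth_mx_diff sk Wx.
- by apply: smooth_mx_sub sk => x [].
- by move=> x [].
exists l; split.
- exact: smooth_mx_sub sl.
- by move=> y V'y; split; [exact/VW/V'V|rewrite kl//; exact: V'V].
- by move=> x [/lk].
- by move=> y /V'V/kl.
Qed.

(** With [B] the inverse Jacobian at [x], the map [psi z = z - k z B] has zero derivative at [x],
    hence is Lipschitz with constant 1/2 on a small closed ball [K]. This gives injectivity with a
    Lipschitz inverse, and makes [z |-> psi z + y B] a contraction whose fixed point solves
    [k z = y]. *)
Lemma inverse_function_bijective U k x : open U -> U x -> smooth_mx U k ->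
  'J k x \in unitmx ->
  exists W V (l : E -> E), [/\ open W /\ open V, W x /\ W `<=` U,
    (forall z, W z -> V (k z) /\ 'J k z \in unitmx) /\ (forall y, V y -> W (l y)),
    (forall z, W z -> l (k z) = z) /\ (forall y, V y -> k (l y) = y) &
    exists C : R, 0 <= C /\
      forall y y', V y -> V y' -> `|l y - l y'| <= C * `|y - y'|].
Proof.
move=> oU Ux sk uJ; pose B := invmx ('J k x).
pose psi z := z - k z *m B.
have spsi : smooth_mx U psi.
  apply: smooth_mxD => //; first by move=> i j; rewrite ord1; exact: smooth_coordf.
  by apply: smooth_mxN => //; apply: smooth_mxM => //; exact: smooth_mx_cst.
have psi0 i j : partial i (fun z => psi z 0 j) x = 0.
  have dk l : differentiable (fun z => k z 0 l) x by exact: smooth_diff (sk 0 l) _ Ux.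
  have dkB l : differentiable (fun z => k z 0 l * B l j) x.
    by apply: differentiableM => //; exact: differentiable_cst.
  have [dS pS] := @partial_sum _ _ _ (index_enum _) predT (fun l z => k z 0 l * B l j) x i dkB.
  rewrite (_ : (fun z => psi z 0 j) = (fun z => z 0 j - \sum_l k z 0 l * B l j)); last first.
    by apply/funext => z; rewrite !mxE.
  rewrite partialB//; last exact: differentiable_coordf.
  rewrite partial_coordf pS.
  have /matrixP/(_ i j) := mulmxV uJ; rewrite !mxE -/B => <-.
  apply/eqP; rewrite subr_eq0; apply/eqP/eq_bigr => l _.
  rewrite partialM; [|exact: dk|exact: differentiable_cst].
  by rewrite partial_cst mulr0 addr0 jacobianE//; exact: smooth_mx_diff sk Ux.
(* Partial derivatives bounded by [e] yield the Lipschitz constant [N e = 1/2]. *)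
pose e : R := (2 * N)^-1.
have e0 : 0 < e by rewrite invr_gt0 mulr_gt0.
have H1 : \forall z \near x, forall t : 'I_n.+1 * 'I_n.+1,
    `|partial t.1 (fun z => psi z 0 t.2) z| < e.
  apply: (@filter_forall _ _ (fun (t : 'I_n.+1 * 'I_n.+1) z => `|partial t.1 (fun z => psi z 0 t.2) z| < e) (nbhs x)) => t.
  have := smooth_near oU (smooth_partial t.1 (spsi 0 t.2)) Ux e0.
  by rewrite psi0; apply: filterS => z; rewrite sub0r normrN.
have H2 : \forall z \near x, 'J k z \in unitmx.
  have sd := smooth_det oU (smooth_jacobian oU sk).
  have d0 : 0 < `|\det ('J k x)| by rewrite normr_gt0 -unitfE -unitmxE.
  apply: filterS (smooth_near oU sd Ux d0) => z; rewrite unitmxE unitfE.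
  exact: norm_sub_lt_neq0.
have [d /= d0 Bd] := (nbhs_ballP _ _).1 (filterI (open_near oU Ux) (filterI H1 H2)).
pose r := d / 2.
have r0 : 0 < r by rewrite divr_gt0.
pose K : set E := [set z | `|z - x| <= r].
have KB z : K z -> ball x d z.
  rewrite /K/= -ball_normE /ball_/= distrC => /le_lt_trans; apply.
  by rewrite /r; lra.
have psiK z z' : K z -> K z' -> `|psi z - psi z'| <= 2^-1 * `|z - z'|.
  move=> /KB Bz /KB Bz'; apply: normrV_le => [|j]; first by rewrite mulr_ge0.
  have -> : (psi z - psi z') 0 j = psi z 0 j - psi z' 0 j by rewrite !mxE.
  have := @lipschitz_ball R n (fun z => psi z 0 j) x d e z' (z - z').
  rewrite subrKC => H.
  apply: (le_trans (H _ Bz' Bz)) => [z2 /Bd[Uz2 [P1 _]]|].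
    split; first exact: smooth_diff (spsi 0 j) _ Uz2.
    by move=> i; exact: ltW (P1 (i, j)).
  by rewrite /e invfM mulrCA mulfV ?pnatr_eq0// mulr1.
have Kx : K x by rewrite /K/= subrr normr0 ltW.
have inj z z' : K z -> K z' -> `|z - z'| <= 2 * `|(k z - k z') *m B|.
  move=> Kz Kz'; have := psiK _ _ Kz Kz'.
  have -> : z - z' = (psi z - psi z') + (k z - k z') *m B.
    by rewrite /psi mulmxBl; apply/matrixP => a b; rewrite !mxE; ring.
  have := ler_normD (psi z - psi z') ((k z - k z') *m B).
  by lra.
(* The contraction moves points of [K] by at most [r/2] relative to [x], and the bound [r/2] on the
   shift keeps the image in the open ball of radius [r]. *)
pose V : set E := [set y | `|(y - k x) *m B| < r / 2].
have VE y : V y -> exists2 z, `|z - x| < r & k z = y.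
  move=> Vy.
  pose T z := psi z + y *m B.
  have TK z : K z -> `|T z - x| < r.
    move=> Kz; rewrite (_ : T z - x = (psi z - psi x) + (y - k x) *m B); last first.
      by rewrite /T /psi mulmxBl; apply/matrixP => a b; rewrite !mxE; ring.
    apply: (le_lt_trans (ler_normD _ _)).
    have P1 := psiK _ _ Kz Kx; have : `|z - x| <= r by []. move: Vy; rewrite /V/=; lra.
  have TK' : set_fun K K T by move=> z /TK/ltW.
  pose TF : {fun K >-> K} := HB.pack T (isFun.Build _ _ K K T TK').
  have cTF : is_contraction TF.
    have h2 : 0 <= (2^-1 : R) by rewrite invr_ge0.
    exists (NngNum h2); split => /=; first by lra.
    move=> [z z'] /= [Kz Kz'].
    rewrite /T (_ : _ - _ = psi z - psi z'); last by rewrite opprD addrACA subrr addr0.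
    exact: psiK.
  have cK : closed K.
    rewrite (_ : K = closed_ball x r); first exact: closed_ball_closed.
    rewrite closed_ballE//; apply/seteqP; split=> z; rewrite /K /closed_ball_/=;
      by rewrite distrC.
  have [z Kz zT] := banach_fixed_point cTF cK (ex_intro _ _ Kx).
  exists z; first by rewrite {1}zT; exact: TK.
  have : (y - k z) *m B = 0.
    move: zT; rewrite /TF/= /T /psi mulmxBl => zT.
    by apply: (addrI z); rewrite addr0 [RHS]zT; apply/matrixP => a b; rewrite !mxE; ring.
  move=> /(congr1 (mulmx^~ ('J k x))); rewrite mul0mx -mulmxA mulVmx// mulmx1.
  by move/eqP; rewrite subr_eq0 => /eqP.
have oV : open V.
  have sm : smooth_mx setT (fun y : E => (y - k x) *m B).
    apply: smooth_mxM; [exact: openT| |by apply: smooth_mx_cst; exact: openT].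
    move=> i j; apply: smooth_ext (smoothB openT (smooth_coordf j openT) (smooth_cst (k x i j) openT)) => //.
      exact: openT.
    by move=> y _; rewrite !mxE ord1.
  rewrite (_ : V = [set y | setT y /\ ball (0 : E) (r / 2) ((y - k x) *m B)]).
    apply: open_preim; [exact: openT| |exact: ball_open].
    by move=> y _; exact: smooth_mx_diff sm _.
  by apply/seteqP; split=> y; rewrite /V/= -ball_normE /ball_/= sub0r normrN => // -[].
(* The inverse has to be a total function; outside [V] its value is the dummy [x]. *)
have [l lP] : {l : E -> E & forall y, V y -> `|l y - x| < r /\ k (l y) = y}.
  apply: (@choice _ _ (fun y z => V y -> `|z - x| < r /\ k z = y)) => y.
  by have [/VE[z z1 z2]|nV] := pselect (V y); [exists z|exists x].
have Kr z : `|z - x| < r -> K z by move/ltW.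
pose W : set E := [set z | ball x r z /\ V (k z)].
have WE z : W z <-> `|z - x| < r /\ V (k z).
  by rewrite /W/= -ball_normE /ball_/= distrC.
have WU z : W z -> U z /\ 'J k z \in unitmx.
  by move=> /WE[/Kr/KB/Bd[Uz [_ H]] _].
exists W, V, l; split.
- split=> //; apply: open_preim => //; first exact: ball_open.
  move=> z; rewrite -ball_normE /ball_/= distrC => /Kr/KB/Bd[Uz _].
  exact: smooth_mx_diff sk Uz.
- split; last by move=> z /WU[].
  by apply/WE; rewrite subrr normr0; split=> //; rewrite /V/= subrr mul0mx normr0 divr_gt0.
- split; first by move=> z Wz; split; [case/WE: Wz|case: (WU _ Wz)].
  by move=> y Vy; apply/WE; have [H1' H2'] := lP y Vy; rewrite H2'.
- split; last by move=> y /lP[].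
  move=> z /WE[zr Vz]; have [lr kl] := lP _ Vz.
  have := inj _ _ (Kr _ lr) (Kr _ zr).
  by rewrite kl subrr mul0mx normr0 mulr0 normr_le0 subr_eq0 => /eqP.
- exists (2 * (N * `|B|)); split; first by rewrite !mulr_ge0.
  move=> y y' /lP[ly ky] /lP[ly' ky'].
  apply: (le_trans (inj _ _ (Kr _ ly) (Kr _ ly'))).
  by rewrite -mulrA ler_wpM2l// ky ky' norm_mulmx.
Qed.

(** For [d = l (h + y) - l y] one has [h = d J + o(d)], so the remainder of [l] is [- o(d) B]; the
    Lipschitz bound [|d| <= C |h|] turns [o(d)] into [o(h)]. *)
Lemma inverse_differentiable W V k (l : E -> E) (C : R) y j : open V ->
  smooth_mx W k -> 0 <= C -> (forall y, V y -> W (l y)) ->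
  (forall y, V y -> k (l y) = y) ->
  (forall y y', V y -> V y' -> `|l y - l y'| <= C * `|y - y'|) ->
  V y -> 'J k (l y) \in unitmx ->
  differentiable (fun y => l y 0 j) y /\
  dfun (fun y => l y 0 j) y = col j (invmx ('J k (l y))).
Proof.
move=> oV sk C0 VW kl lC Vy uJ; apply: differentiable_dfun => e e0.
set z := l y in uJ *; set J := 'J k z in uJ *; set B := invmx J.
pose o d : E := k (d + z) - k z - d *m J.
(* Chosen so that [N |B| C e' <= e]; the summand 1 keeps the denominator positive. *)
pose e' := e / (N * `|B| * C + 1).
have c0 : 0 < N * `|B| * C + 1 by rewrite ltr_wpDl// !mulr_ge0.
have e'0 : 0 < e' by rewrite divr_gt0.
have dk := smooth_mx_diff sk (VW _ Vy).
have oS : \forall d \near (0 : E), forall i : 'I_n.+1, `|o d 0 i| <= e' * `|d|.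
  apply: (@filter_forall _ _ (fun i d => `|o d 0 i| <= e' * `|d|) (nbhs (0 : E))) => i.
  have dki := differentiable_rV_coord i dk.
  apply: filterS (differentiable_eps dki e'0) => d.
  rewrite -deriveE// derive_dfun// /o !mxE; congr (`|_ - _| <= _).
  by apply: eq_bigr => a _; rewrite mxE /J jacobianE.
have [r /= r0 Br] := (nbhs_ballP _ _).1 oS.
have Vn : \forall h \near (0 : E), V (h + y).
  have := open_near oV Vy; rewrite (near_shift 0)/=.
  by apply: filterS => h; rewrite /= subr0.
have hs : \forall h \near (0 : E), `|h| < r / (C + 1).
  by apply: nbhs0_lt; rewrite divr_gt0// ltr_wpDl.
apply: filterS (filterI Vn hs) => h [Vh hlt].
pose d := l (h + y) - z.
have dh : `|d| <= C * `|h| by have := lC _ _ Vh Vy; rewrite addrK.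
have od : `|o d| <= e' * `|d|.
  apply: normrV_le => [|i]; first by rewrite mulr_ge0// ltW.
  apply: Br; rewrite -ball_normE /ball_/= sub0r normrN.
  apply: (le_lt_trans dh); move: hlt; rewrite ltr_pdivlMr ?ltr_wpDl//.
  by apply: le_lt_trans; rewrite mulrC ler_wpM2l// lerDl.
have hE : h = d *m J + o d.
  by rewrite /o /d subrK addrC subrK !kl// addrK.
have lE : l (h + y) - l y - h *m B = - (o d *m B).
  rewrite {2}hE mulmxDl -mulmxA mulmxV// mulmx1 -/z -/d.
  by rewrite opprD addrA subrr add0r.
have -> : l (h + y) 0 j - z 0 j - (h *m col j B) 0 0 = (- (o d *m B)) 0 j.
  by rewrite -lE !mxE; congr (_ - _); apply: eq_bigr => a _; rewrite mxE.
apply: (le_trans (normrV_ge _ j)); rewrite normrN.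
apply: (le_trans (norm_mulmx _ _)).
apply: (@le_trans _ _ (N * `|B| * (e' * (C * `|h|)))).
  rewrite ler_wpM2l ?mulr_ge0//; apply: (le_trans od).
  by rewrite ler_wpM2l// ltW.
rewrite (_ : _ * _ = (N * `|B| * C) * e' * `|h|); last by ring.
rewrite ler_wpM2r// /e' mulrCA ger_pMr// ler_pdivrMr// mul1r.
by rewrite lerDl.
Qed.

(** Smoothness of [l] is obtained by bootstrapping: its partial derivatives are entries of
    [invmx ('J k)] composed with [l], so class [m] for [l] gives class [m + 1]. *)
Theorem inverse_function U k x : open U -> U x -> smooth_mx U k ->
  'J k x \in unitmx ->
  exists W V, [/\ W x, W `<=` U & diffeomorphism W V k].
Proof.
move=> oU Ux sk uJ.
have [W [V [l [[oW oV] [Wx WU] [kV lW] [lk kl] [C [C0 lC]]]]]] :=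
  inverse_function_bijective oU Ux sk uJ.
have skW := smooth_mx_sub WU sk.
exists W, V; split=> //; split=> //; first by move=> z /kV[].
exists l; split=> //.
have dl y j (Vy : V y) := inverse_differentiable j oV skW C0 lW kl lC Vy (kV _ (lW _ Vy)).2.
have sB : smooth_mx W (fun z => invmx ('J k z)).
  apply: smooth_invmx; [exact: oW| |exact: smooth_jacobian].
  by move=> z Wz; exact: (kV _ Wz).2.
move=> i j; rewrite ord1; apply/smoothP => m.
elim: m j => [|m IH] j; split=> //; try by move=> y Vy; case: (dl y j Vy).
move=> a; have /smoothP/(_ m) Ca := sB a j.
have H := ck_comp (F := l) oV lW IH Ca.
refine (ck_ext oV _ H) => y Vy.
have [_ /matrixP/(_ a 0)] := dl y j Vy; rewrite mxE [RHS]mxE => E1.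
exact: esym E1.
Qed.

End InverseFunction.

(** * The Levi-Civita connection *)

(* Locked, so that failing unification attempts do not unfold the limits. *)
HB.lock Definition dmx (R : realType) (n a b : nat) (i : 'I_n.+1)
    (F : 'rV[R]_n.+1 -> 'M[R]_(a, b)) (x : 'rV[R]_n.+1) : 'M[R]_(a, b) :=
  \matrix_(r, c) partial i (fun y => F y r c) x.

(** The symbol with lower indices [i], [j] and upper index [k] is placed in row [j], column [k], so
    that the covariant derivative of a row vector adds [Y *m Gam i]. *)
HB.lock Definition Gam (R : realType) (n : nat) (G : 'rV[R]_n.+1 -> 'M[R]_n.+1)
    (i : 'I_n.+1) (x : 'rV[R]_n.+1) : 'M[R]_n.+1 :=
  \matrix_(j, k) christoffel G i j k x.

(** * Entrywise derivatives of matrix-valued functions *)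

Section MatrixDerivative.
Context {R : realType} {n : nat}.
Notation E := ('rV[R]_n.+1).
Implicit Types (U : set E) (x : E).

Definition mxdiff a b (F : E -> 'M[R]_(a, b)) x : Prop :=
  forall r c, differentiable (fun y => F y r c) x.

Lemma dmxE a b (F : E -> 'M[R]_(a, b)) i x r c :
  dmx i F x r c = partial i (fun y => F y r c) x.
Proof. by rewrite unlock mxE. Qed.

Lemma smooth_mxdiff a b U (F : E -> 'M[R]_(a, b)) x : smooth_mx U F -> U x -> mxdiff F x.
Proof. by move=> sF Ux r c; exact: smooth_diff (sF r c) _ Ux. Qed.

Lemma smooth_dmx a b U (F : E -> 'M[R]_(a, b)) i : open U -> smooth_mx U F ->
  smooth_mx U (dmx i F).
Proof.
move=> oU sF r c; apply: (smooth_ext oU _ (smooth_partial i (sF r c))) => x _.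
by rewrite dmxE.
Qed.

Lemma dmx_ext a b U (F H : E -> 'M[R]_(a, b)) i x : open U -> U x ->
  (forall y, U y -> F y = H y) -> dmx i F x = dmx i H x.
Proof.
move=> oU Ux FH; apply/matrixP => r c; rewrite !dmxE; apply: near_eq_partial.
by apply: filterS (open_near oU Ux) => y Uy; rewrite FH.
Qed.

Lemma dmx_cst a b (A : 'M[R]_(a, b)) i x : dmx i (fun=> A) x = 0.
Proof. by apply/matrixP => r c; rewrite dmxE mxE partial_cst. Qed.

Lemma dmxD a b (F H : E -> 'M[R]_(a, b)) i x : mxdiff F x -> mxdiff H x ->
  dmx i (fun y => F y + H y) x = dmx i F x + dmx i H x.
Proof.
move=> dF dH; apply/matrixP => r c; rewrite dmxE [RHS]mxE !dmxE -partialD//.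
by congr (partial i _ x); apply/funext => y; rewrite mxE.
Qed.

Lemma dmxN a b (F : E -> 'M[R]_(a, b)) i x : mxdiff F x ->
  dmx i (fun y => - F y) x = - dmx i F x.
Proof.
move=> dF; apply/matrixP => r c; rewrite dmxE [RHS]mxE dmxE -partialN//.
by congr (partial i _ x); apply/funext => y; rewrite mxE.
Qed.

Lemma dmxT a b (F : E -> 'M[R]_(a, b)) i x :
  dmx i (fun y => (F y)^T) x = (dmx i F x)^T.
Proof.
apply/matrixP => r c; rewrite mxE !dmxE.
by congr (partial i _ x); apply/funext => y; rewrite mxE.
Qed.

Lemma dmxZ a b (f : E -> R) (F : E -> 'M[R]_(a, b)) i x :
  differentiable f x -> mxdiff F x ->
  dmx i (fun y => f y *: F y) x = partial i f x *: F x + f x *: dmx i F x.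
Proof.
move=> df dF; apply/matrixP => r c; rewrite dmxE !mxE dmxE -partialM//.
by congr (partial i _ x); apply/funext => y; rewrite mxE.
Qed.

Lemma dmxM a b c (F : E -> 'M[R]_(a, b)) (H : E -> 'M[R]_(b, c)) i x :
  mxdiff F x -> mxdiff H x ->
  mxdiff (fun y => F y *m H y) x /\
  dmx i (fun y => F y *m H y) x = dmx i F x *m H x + F x *m dmx i H x.
Proof.
move=> dF dH.
have dFH r s k : differentiable (fun y => F y r k * H y k s) x by exact: differentiableM.
have dS r s := @partial_sum _ _ _ (index_enum _) predT (fun k y => F y r k * H y k s) x i (dFH r s).
have E1 r s : (fun y => (F y *m H y) r s) = (fun y => \sum_k F y r k * H y k s).
  by apply/funext => y; rewrite mxE.
split=> [r s|]; first by rewrite E1; exact: (dS r s).1.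
apply/matrixP => r s; rewrite dmxE E1 (dS r s).2 !mxE -big_split/=.
by apply: eq_bigr => k _; rewrite partialM// !dmxE.
Qed.

Lemma derive_dmx b (F : E -> 'rV[R]_b.+1) x v : mxdiff F x ->
  'D_v F x = \sum_i v 0 i *: dmx i F x.
Proof.
move=> dF.
have dF' : differentiable F x.
  by apply: differentiable_rV => j; exact: (dF 0 j).
rewrite (derive_rV v dF'); apply/rowP => j; rewrite mxE (derive_sum_partial v (dF 0 j)).
rewrite summxE; apply: eq_bigr => i _.
by rewrite !mxE dmxE.
Qed.

Lemma schwarz_dmx a b U (F : E -> 'M[R]_(a, b)) i j x : open U -> smooth_mx U F -> U x ->
  dmx i (dmx j F) x = dmx j (dmx i F) x.
Proof.
move=> oU sF Ux; apply/matrixP => r c; rewrite [LHS]dmxE [RHS]dmxE.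
have H k : (fun y => dmx k F y r c) = partial k (fun y => F y r c).
  by apply/funext => y; rewrite dmxE.
rewrite (H i) (H j).
exact: (schwarz i j oU (sF r c) Ux).
Qed.

End MatrixDerivative.

Section MatrixAlgebra.
Context {R : comRingType} {b m : nat}.

(** The commutator of two covariant derivatives of [Z]. A single [ddZ] appears because second
    partial derivatives commute, and all first derivatives of [Z] cancel. *)
Lemma commutator_algebra (Z dZi dZj ddZ : 'M[R]_(b, m)) (Gi Gj dGi dGj : 'M[R]_m) :
  ddZ + (dZi *m Gj + Z *m dGj) + (dZj + Z *m Gj) *m Gi
  - (ddZ + (dZj *m Gi + Z *m dGi) + (dZi + Z *m Gi) *m Gj)
  = Z *m (dGj - dGi + Gj *m Gi - Gi *m Gj).
Proof.
rewrite !(mulmxDl, mulmxDr, mulmxN, mulNmx, mulmxA).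
move: (dZi *m Gj) (dZj *m Gi) (Z *m dGj) (Z *m dGi) (Z *m Gj *m Gi) (Z *m Gi *m Gj).
by move=> a1 a2 a3 a4 a5 a6; apply/matrixP => r c; rewrite !mxE; ring.
Qed.

Lemma entry_algebra (A B C D : 'M[R]_m) k l :
  (A - B + C - D) k l = A k l - B k l + C k l - D k l.
Proof. by rewrite !mxE. Qed.

Lemma mulmx_row_eq (A B C : 'M[R]_m) a a' l :
  (forall k, A a k = B a' k) -> (A *m C) a l = (B *m C) a' l.
Proof. by move=> AB; rewrite !mxE; apply: eq_bigr => k _; rewrite AB. Qed.

Lemma row_entry_algebra (A B C : 'rV[R]_m) k :
  (A + B + C) 0 k = A 0 k + B 0 k + C 0 k.
Proof. by rewrite !mxE. Qed.

(** The right side is the difference of the two mixed second derivatives of the metric, written with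
    connection matrices; its vanishing will give the skew-symmetry of the curvature. *)
Lemma skew_algebra (g gi gj dij dji : 'M[R]_m) :
  (dij - dji + gj *m gi - gi *m gj) *m g + g *m (dij - dji + gj *m gi - gi *m gj)^T
  = dij *m g + gj *m (gi *m g + g *m gi^T) + (gi *m g + g *m gi^T) *m gj^T + g *m dij^T
  - (dji *m g + gi *m (gj *m g + g *m gj^T) + (gj *m g + g *m gj^T) *m gi^T + g *m dji^T).
Proof.
have tD (A B : 'M[R]_m) : (A + B)^T = A^T + B^T by rewrite linearD.
have tN (A : 'M[R]_m) : (- A)^T = - A^T by rewrite linearN.
rewrite !(tD, tN) !trmx_mul.
rewrite !(mulmxDl, mulmxDr, mulmxN, mulNmx, mulmxA, opprD).
move: (dij *m g) (dji *m g) (gj *m gi *m g) (gi *m gj *m g) (g *m dij^T) (g *m dji^T)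
  (g *m gi^T *m gj^T) (g *m gj^T *m gi^T) (gj *m g *m gi^T) (gi *m g *m gj^T).
move=> a1 a2 a3 a4 a5 a6 a7 a8 a9 a10.
by apply/matrixP => r c; rewrite !mxE; ring.
Qed.

End MatrixAlgebra.

(** Here [dX i j] is the [i]-th derivative of the [j]-th component of [X], and [n1], [n2] are the
    first and second covariant derivatives of [Z]. The bracket term cancels every derivative of [X]
    and [Y], which is the tensoriality of the curvature. *)
Lemma curvature_algebra (R : comRingType) (V : lmodType R) m (X Y : 'I_m -> R)
    (dX dY : 'I_m -> 'I_m -> R) (n1 : 'I_m -> V) (n2 : 'I_m -> 'I_m -> V) :
  \sum_i \sum_j X i *: (dY i j *: n1 j + Y j *: n2 i j)
  - \sum_i \sum_j Y i *: (dX i j *: n1 j + X j *: n2 i j)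
  - \sum_i \sum_j (X i * dY i j - Y i * dX i j) *: n1 j
  = \sum_i \sum_j (X i * Y j) *: (n2 i j - n2 j i).
Proof.
have split2 (A B : 'I_m -> 'I_m -> V) :
    \sum_i \sum_j (A i j + B i j) = \sum_i \sum_j A i j + \sum_i \sum_j B i j.
  by rewrite -big_split; apply: eq_bigr => i _; rewrite -big_split.
have e2 : \sum_i \sum_j Y i *: (dX i j *: n1 j + X j *: n2 i j)
    = \sum_i \sum_j (Y i * dX i j) *: n1 j + \sum_i \sum_j (X i * Y j) *: n2 j i.
  rewrite [X in _ = _ + X]exchange_big/= -split2.
  apply: eq_bigr => i _; apply: eq_bigr => j _.
  by rewrite scalerDr !scalerA [X j * _]mulrC.
have sub2 (A B : 'I_m -> 'I_m -> V) :
    \sum_i \sum_j (A i j - B i j) = \sum_i \sum_j A i j - \sum_i \sum_j B i j.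
  by rewrite -sumrB; apply: eq_bigr => i _; rewrite -sumrB.
have e1 : \sum_i \sum_j X i *: (dY i j *: n1 j + Y j *: n2 i j)
    = \sum_i \sum_j (X i * dY i j) *: n1 j + \sum_i \sum_j (X i * Y j) *: n2 i j.
  by rewrite -split2; apply: eq_bigr => i _; apply: eq_bigr => j _; rewrite scalerDr !scalerA.
have e3 : \sum_i \sum_j (X i * dY i j - Y i * dX i j) *: n1 j
    = \sum_i \sum_j (X i * dY i j) *: n1 j - \sum_i \sum_j (Y i * dX i j) *: n1 j.
  by rewrite -sub2; apply: eq_bigr => i _; apply: eq_bigr => j _; rewrite scalerBl.
have e4 : \sum_i \sum_j (X i * Y j) *: (n2 i j - n2 j i)
    = \sum_i \sum_j (X i * Y j) *: n2 i j - \sum_i \sum_j (X i * Y j) *: n2 j i.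
  by rewrite -sub2; apply: eq_bigr => i _; apply: eq_bigr => j _; rewrite scalerBr.
have zmod_eq (a b c d : V) : a + c - (b + d) - (a - b) = c - d.
  by rewrite opprD addrACA [X in X = _]addrC addKr.
by rewrite e1 e2 e3 e4 zmod_eq.
Qed.

(** * Christoffel symbols and curvature as matrices *)

Section LeviCivita.
Context {R : realType} {n : nat}.
Notation E := ('rV[R]_n.+1).
Variables (U : set E) (G : E -> 'M[R]_n.+1).
Hypothesis oU : open U.
Hypothesis rG : pseudo_riemannian U G.

Notation Gam := (Gam G).

Lemma GamE i j k x : Gam i x j k = christoffel G i j k x.
Proof. by rewrite unlock mxE. Qed.

Definition nab b (i : 'I_n.+1) (Y : E -> 'M[R]_(b, n.+1)) (x : E) : 'M[R]_(b, n.+1) :=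
  dmx i Y x + Y x *m Gam i x.

Let sG : smooth_mx U G := rG.1.
Let symG x : U x -> (G x)^T = G x := fun Ux => (rG.2 x Ux).1.
Let unitG x : U x -> G x \in unitmx := fun Ux => (rG.2 x Ux).2.

Lemma partial_metric_sym i j k x : U x ->
  partial i (fun y => G y j k) x = partial i (fun y => G y k j) x.
Proof.
move=> Ux; apply: near_eq_partial; apply: filterS (open_near oU Ux) => y Uy.
by have /matrixP/(_ k j) := symG Uy; rewrite mxE.
Qed.

(** Lowering the upper index cancels the inverse metric and leaves the Koszul formula. *)
Lemma Gam_lower i j k x : U x -> (Gam i x *m G x) j k =
  2^-1 * (partial i (fun y => G y j k) x + partial j (fun y => G y i k) x
          - partial k (fun y => G y i j) x).
Proof.
move=> Ux.
pose A l := partial i (fun y => G y j l) x + partial j (fun y => G y i l) x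
          - partial l (fun y => G y i j) x.
have invS : (invmx (G x))^T = invmx (G x) by rewrite trmx_inv symG.
transitivity (2^-1 * \sum_l A l * (invmx (G x) *m G x) l k).
  rewrite mxE; under eq_bigr do rewrite GamE /christoffel -mulrA mulr_suml.
  rewrite -mulr_sumr exchange_big/=; congr (_ * _); apply: eq_bigr => l _.
  rewrite mxE mulr_sumr; apply: eq_bigr => m _.
  have -> : invmx (G x) m l = invmx (G x) l m by rewrite -[in LHS]invS mxE.
  by rewrite -/(A l) -mulrA mulrCA.
rewrite mulVmx ?unitG// (bigD1 k)//= big1 ?addr0 => [|l lk].
  by rewrite mxE eqxx mulr1.
by rewrite mxE (negbTE lk) mulr0.
Qed.

Lemma Gam_sym i j k x : U x -> Gam i x j k = Gam j x i k.
Proof.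
move=> Ux; rewrite !GamE /christoffel; congr (_ * _); apply: eq_bigr => l _; congr (_ * _).
by rewrite [X in X - _]addrC (partial_metric_sym l i j Ux).
Qed.

Lemma metric_compat i x : U x -> dmx i G x = Gam i x *m G x + (Gam i x *m G x)^T.
Proof.
move=> Ux; apply/matrixP => j k; rewrite dmxE mxE [_^T _ _]mxE !Gam_lower//.
rewrite (partial_metric_sym i k j Ux).
move: (partial i _ x) (partial j _ x) (partial k _ x) => a b c; lra.
Qed.

(** Uniqueness of the Levi-Civita connection in lowered form: symmetry and compatibility let the
    Koszul combination of derivatives of the metric recover [C]. It identifies the connection of a
    leaf and that of the model without inverting a metric. *)
Lemma koszul_unique (C : 'I_n.+1 -> 'M[R]_n.+1) x : U x ->
  (forall i j k, C i j k = C j i k) ->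
  (forall i, dmx i G x = C i + (C i)^T) ->
  forall i, C i = Gam i x *m G x.
Proof.
move=> Ux Csym Cmet i; apply/matrixP => j k; rewrite Gam_lower//.
have H a b c : partial a (fun y => G y b c) x = C a b c + C a c b.
  by have /matrixP/(_ b c) := Cmet a; rewrite dmxE !mxE.
rewrite !H (Csym j i k) (Csym k i j) (Csym j k i).
apply: (@mulfI _ 2) => //; rewrite mulrA mulfV// mul1r; ring.
Qed.

Lemma smooth_Gam i : smooth_mx U (Gam i).
Proof.
move=> j k.
have sI := smooth_invmx oU unitG sG.
have H : smooth U (fun x => 2^-1 * \sum_(l < n.+1) invmx (G x) k l *
    (partial i (fun y => G y j l) x + partial j (fun y => G y i l) x
     - partial l (fun y => G y i j) x)).
  apply: smoothM => //; first exact: smooth_cst.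
  apply: smooth_sum => // l; apply: smoothM => //.
  apply: smoothB => //; last exact: smooth_partial.
  by apply: smoothD => //; exact: smooth_partial.
by apply: (smooth_ext oU _ H) => x _; rewrite GamE.
Qed.

Lemma smooth_nab b i (Y : E -> 'M[R]_(b, n.+1)) : smooth_mx U Y -> smooth_mx U (nab i Y).
Proof.
move=> sY; apply: smooth_mxD => //; first exact: smooth_dmx.
by apply: smooth_mxM => //; exact: smooth_Gam.
Qed.

Lemma nabla_sum w (Y : E -> E) x : mxdiff Y x ->
  nabla G w Y x = \sum_i w 0 i *: nab i Y x.
Proof.
move=> dY; rewrite /nabla derive_dmx//.
under [RHS]eq_bigr do rewrite scalerDr.
rewrite big_split/=; congr (_ + _); apply/rowP => k.
rewrite mxE summxE; apply: eq_bigr => i _; rewrite !mxE mulr_sumr.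
by apply: eq_bigr => j _; rewrite GamE mulrA.
Qed.

Lemma nabla_ebase i (Y : E -> E) x : mxdiff Y x -> nabla G (ebase i) Y x = nab i Y x.
Proof.
move=> dY; rewrite nabla_sum// (bigD1 i)//= big1 ?addr0 => [|j ji].
  by rewrite /ebase mxE !eqxx scale1r.
by rewrite /ebase mxE (negbTE ji) scale0r.
Qed.

Lemma nab_ext b i (F H : E -> 'M[R]_(b, n.+1)) x : U x -> (forall y, U y -> F y = H y) ->
  nab i F x = nab i H x.
Proof. by move=> Ux FH; rewrite /nab (dmx_ext _ oU Ux FH) FH. Qed.

Lemma nabZ b i (f : E -> R) (Y : E -> 'M[R]_(b, n.+1)) x : differentiable f x -> mxdiff Y x ->
  nab i (fun y => f y *: Y y) x = partial i f x *: Y x + f x *: nab i Y x.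
Proof. by move=> df dY; rewrite /nab dmxZ// -scalemxAl scalerDr addrA. Qed.

Lemma nabD b i (Y Z : E -> 'M[R]_(b, n.+1)) x : mxdiff Y x -> mxdiff Z x ->
  nab i (fun y => Y y + Z y) x = nab i Y x + nab i Z x.
Proof. by move=> dY dZ; rewrite /nab dmxD// mulmxDl addrACA. Qed.

Lemma nabN b i (Y : E -> 'M[R]_(b, n.+1)) x : mxdiff Y x ->
  nab i (fun y => - Y y) x = - nab i Y x.
Proof. by move=> dY; rewrite /nab dmxN// mulNmx opprD. Qed.

Lemma nab_sum_smooth b i (I : Type) (s : seq I) (F : I -> E -> 'M[R]_(b, n.+1)) x : U x ->
  (forall k, smooth_mx U (F k)) ->
  smooth_mx U (fun y => \sum_(k <- s) F k y) /\
  nab i (fun y => \sum_(k <- s) F k y) x = \sum_(k <- s) nab i (F k) x.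
Proof.
move=> Ux sF; elim: s => [|k s [IH1 IH2]].
  have E0 : (fun y : E => \sum_(k <- [::]) F k y) = (fun=> 0).
    by apply/funext => y; rewrite big_nil.
  rewrite E0 big_nil; split; first exact: smooth_mx_cst.
  by rewrite /nab dmx_cst mul0mx addr0.
have E1 : (fun y : E => \sum_(k <- k :: s) F k y) = (fun y => F k y + \sum_(k <- s) F k y).
  by apply/funext => y; rewrite big_cons.
rewrite E1 big_cons; split; first exact: smooth_mxD.
by rewrite nabD ?IH2//; [exact: smooth_mxdiff (sF k) Ux|exact: smooth_mxdiff IH1 Ux].
Qed.

Lemma metric_leibniz a b i (Y : E -> 'M[R]_(a, n.+1)) (Z : E -> 'M[R]_(b, n.+1)) x : U x ->
  mxdiff Y x -> mxdiff Z x ->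
  dmx i (fun y => Y y *m G y *m (Z y)^T) x =
  nab i Y x *m G x *m (Z x)^T + Y x *m G x *m (nab i Z x)^T.
Proof.
move=> Ux dY dZ; have dG := smooth_mxdiff sG Ux.
have [dYG YG] := dmxM i dY dG.
have dZT : mxdiff (fun y => (Z y)^T) x.
  by move=> r c; rewrite (_ : (fun y => _) = (fun y => Z y c r))//; apply/funext => y; rewrite mxE.
have [_ ->] := dmxM i dYG dZT; rewrite YG dmxT metric_compat// /nab.
rewrite linearD/= !trmx_mul symG//.
rewrite !(mulmxDl, mulmxDr) !mulmxA.
rewrite -!addrA; congr (_ + (_ + _)).
by rewrite addrC [(dmx i Z x + _)^T]linearD/= trmx_mul mulmxDr mulmxA.
Qed.

(** The matrix of [R(e_i, e_j)] acting on rows from the right, hence the reversed order of the two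
    products. *)
Definition curvmx i j x : 'M[R]_n.+1 :=
  dmx i (Gam j) x - dmx j (Gam i) x + Gam j x *m Gam i x - Gam i x *m Gam j x.

Lemma nab_commute b i j (Z : E -> 'M[R]_(b, n.+1)) x : U x -> smooth_mx U Z ->
  nab i (nab j Z) x - nab j (nab i Z) x = Z x *m curvmx i j x.
Proof.
move=> Ux sZ; rewrite /nab /curvmx.
have dZ := smooth_mxdiff sZ Ux.
have dG k := smooth_mxdiff (smooth_Gam k) Ux.
have ddZ k := smooth_mxdiff (smooth_dmx k oU sZ) Ux.
rewrite (dmxD _ (ddZ j) (dmxM i dZ (dG j)).1) (dmxD _ (ddZ i) (dmxM j dZ (dG i)).1).
rewrite (dmxM i dZ (dG j)).2 (dmxM j dZ (dG i)).2 (schwarz_dmx i j oU sZ Ux).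
exact: commutator_algebra.
Qed.

Lemma bracketE (X Y : E -> E) x : mxdiff X x -> mxdiff Y x ->
  bracket X Y x = \sum_i (X x 0 i *: dmx i Y x - Y x 0 i *: dmx i X x).
Proof. by move=> dX dY; rewrite /bracket !derive_dmx// sumrB. Qed.

Lemma curvatureE (X Y Z : E -> E) x : U x ->
  smooth_mx U X -> smooth_mx U Y -> smooth_mx U Z ->
  curvature G X Y Z x = \sum_i \sum_j (X x 0 i * Y x 0 j) *: (Z x *m curvmx i j x).
Proof.
move=> Ux sX sY sZ.
have H (V W : E -> E) : smooth_mx U V -> smooth_mx U W ->
  nablaF G V (nablaF G W Z) x = \sum_i \sum_j (V x 0 i *: (partial i (fun y => W y 0 j) x *: nab j Z x
     + W x 0 j *: nab i (nab j Z) x)).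
  move=> sV sW.
  have sN j : smooth_mx U (fun y => W y 0 j *: nab j Z y).
    by apply: smooth_mxZ => //; exact: smooth_nab.
  have E1 y : U y -> nablaF G W Z y = \sum_j W y 0 j *: nab j Z y.
    by move=> Uy; rewrite /nablaF nabla_sum//; exact: smooth_mxdiff sZ Uy.
  have sS : smooth_mx U (fun y => \sum_j W y 0 j *: nab j Z y).
    exact: (nab_sum_smooth ord0 _ Ux sN).1.
  rewrite {1}/nablaF nabla_sum; last first.
    have E1' y : U y -> \sum_j W y 0 j *: nab j Z y = nablaF G W Z y by move=> /E1.
    exact: smooth_mxdiff (smooth_mx_ext oU E1' sS) Ux.
  apply: eq_bigr => i _; rewrite (nab_ext i Ux E1).
  rewrite (nab_sum_smooth i _ Ux sN).2 scaler_sumr; apply: eq_bigr => j _.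
  rewrite nabZ//; first exact: smooth_diff (sW 0 j) _ Ux.
  exact: smooth_mxdiff (smooth_nab j sZ) Ux.
rewrite /curvature !H// {1}/nablaF nabla_sum; last exact: smooth_mxdiff sZ Ux.
have [dX dY] := (smooth_mxdiff sX Ux, smooth_mxdiff sY Ux).
rewrite bracketE//.
have -> : \sum_j (\sum_i (X x 0 i *: dmx i Y x - Y x 0 i *: dmx i X x)) 0 j *: nab j Z x
   = \sum_i \sum_j (X x 0 i * partial i (fun y => Y y 0 j) x
                 - Y x 0 i * partial i (fun y => X y 0 j) x) *: nab j Z x.
  rewrite exchange_big/=; apply: eq_bigr => j _.
  rewrite summxE scaler_suml; apply: eq_bigr => i _.
  by rewrite !mxE !dmxE.
rewrite (curvature_algebra (X x 0) (Y x 0) (fun i j => partial i (fun y => X y 0 j) x)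
  (fun i j => partial i (fun y => Y y 0 j) x) (fun j => nab j Z x) (fun i j => nab i (nab j Z) x)).
by apply: eq_bigr => i _; apply: eq_bigr => j _; rewrite nab_commute.
Qed.

(** The second derivatives of the metric commute; both are expanded by metric compatibility. *)
Lemma curvmx_skew i j x : U x -> curvmx i j x *m G x + (curvmx i j x *m G x)^T = 0.
Proof.
move=> Ux.
have dG := smooth_mxdiff sG Ux.
have dGam k := smooth_mxdiff (smooth_Gam k) Ux.
have H a b : dmx a (dmx b G) x =
   dmx a (Gam b) x *m G x + Gam b x *m (Gam a x *m G x + G x *m (Gam a x)^T)
   + (Gam a x *m G x + G x *m (Gam a x)^T) *m (Gam b x)^T + G x *m (dmx a (Gam b) x)^T.
  have E1 y : U y -> dmx b G y = Gam b y *m G y + G y *m (Gam b y)^T.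
    by move=> Uy; rewrite metric_compat// trmx_mul symG.
  rewrite (dmx_ext a oU Ux E1).
  have dT : mxdiff (fun y => (Gam b y)^T) x.
    move=> r c; rewrite (_ : (fun y => _) = (fun y => Gam b y c r)); first exact: dGam.
    by apply/funext => y; rewrite mxE.
  rewrite (dmxD a (dmxM a (dGam b) dG).1 (dmxM a dG dT).1).
  rewrite (dmxM a (dGam b) dG).2 (dmxM a dG dT).2 dmxT metric_compat// trmx_mul symG//.
  by rewrite addrA.
have S := schwarz_dmx i j oU sG Ux.
move: S; rewrite !H => /eqP; rewrite -subr_eq0 => /eqP S.
rewrite -[RHS]S /curvmx trmx_mul symG//; exact: skew_algebra.
Qed.

(** The first Bianchi identity: by the symmetry of the Christoffel symbols, derivative terms and
    product terms cancel in pairs in the cyclic sum. *)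
Lemma curvmx_bianchi i j k x : U x ->
  row k (curvmx i j x) + row i (curvmx j k x) + row j (curvmx k i x) = 0.
Proof.
move=> Ux; apply/rowP => l.
have Sd a b c : dmx a (Gam b) x c l = dmx a (Gam c) x b l.
  rewrite [LHS]dmxE [RHS]dmxE; apply: near_eq_partial; apply: filterS (open_near oU Ux) => y Uy.
  exact: Gam_sym.
have SS a b c : (Gam a x *m Gam c x) b l = (Gam b x *m Gam c x) a l.
  by apply: mulmx_row_eq => m; exact: Gam_sym.
have E1 a b c : (row c (curvmx a b x)) 0 l = dmx a (Gam b) x c l - dmx b (Gam a) x c l
   + (Gam b x *m Gam a x) c l - (Gam a x *m Gam b x) c l.
  by rewrite [LHS]mxE; exact: entry_algebra.
rewrite [RHS]mxE; apply: etrans (row_entry_algebra _ _ _ _) _.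
rewrite (E1 i j k) (E1 j k i) (E1 k i j).
by rewrite (Sd i j k) (Sd j i k) (Sd k j i) (SS i k j) (SS j k i) (SS j i k); ring.
Qed.

End LeviCivita.

(** * Leaves of the foliation *)

Section MatrixKernel.
Context {F : fieldType}.

Lemma row_free_ker m n (A : 'M[F]_(m, n)) :
  (forall a : 'rV_m, a *m A = 0 -> a = 0) -> row_free A.
Proof.
move=> H; rewrite -kermx_eq0; apply/rowV0P => v /sub_kermxP; exact: H.
Qed.

Lemma unitmx_ker n (A : 'M[F]_n) : (forall a : 'rV_n, a *m A = 0 -> a = 0) -> A \in unitmx.
Proof. by move=> H; rewrite -row_free_unit; exact: row_free_ker. Qed.

Lemma row_free_eq0 m n (A : 'M[F]_(m, n)) (a : 'rV_m) : row_free A -> a *m A = 0 -> a = 0.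
Proof. by move=> fA aA; apply: (row_free_inj fA); rewrite aA mul0mx. Qed.

Variables (n : nat) (J : 'M[F]_(n.+1, n.+2)) (G : 'M[F]_n.+2)
  (xi : 'rV[F]_n.+2) (eta : 'cV[F]_n.+2).
Hypotheses (fJ : row_free J) (Jeta : J *m eta = 0) (uG : G \in unitmx)
  (etaE : eta = G *m xi^T) (etaxi : xi *m eta = 1).

(** A relation between the rows of [J] and [xi] has no [xi] part, since [eta] annihilates [J] but
    not [xi]; a dimension count does the rest. *)
Lemma hyperplane_full : row_full (col_mx J xi).
Proof.
have fr : row_free (col_mx J xi).
  apply: row_free_ker => a; rewrite -[a]hsubmxK mul_row_col => H.
  have s0 : rsubmx a = 0.
    have := congr1 (mulmx^~ eta) H.
    by rewrite mulmxDl -!mulmxA Jeta etaxi mulmx0 add0r mulmx1 mul0mx.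
  rewrite s0 mul0mx addr0 in H.
  by rewrite s0 (row_free_eq0 fJ H) row_mx0.
by rewrite /row_full (eqP fr) addn1.
Qed.

Lemma hyperplane_tangent (v : 'rV[F]_n.+2) : v *m eta = 0 -> exists a, v = a *m J.
Proof.
move=> v0; have /row_fullP[B BA] := hyperplane_full.
have : v = v *m B *m col_mx J xi by rewrite -mulmxA BA mulmx1.
set a := v *m B; rewrite -[a]hsubmxK mul_row_col => H.
have s0 : rsubmx a = 0.
  have := congr1 (mulmx^~ eta) H.
  by rewrite mulmxDl -!mulmxA Jeta etaxi mulmx0 add0r mulmx1 v0.
by exists (lsubmx a); rewrite H s0 mul0mx addr0.
Qed.

(** If [a J G J^T = 0], then the covector [a J G] annihilates the rows of [J], and also [xi], which
    is orthogonal to them; together these span the space. *)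
Lemma induced_metric_unit : J *m G *m J^T \in unitmx.
Proof.
apply: unitmx_ker => a aH.
suff : a *m J *m G = 0.
  move=> /(congr1 (mulmx^~ (invmx G))); rewrite mulmxK// mul0mx.
  exact: row_free_eq0 fJ.
have /row_fullP[B BA] := hyperplane_full.
apply: trmx_inj; rewrite trmx0 -[LHS]mul1mx -BA -mulmxA mul_col_mx.
have -> : J *m (a *m J *m G)^T = 0.
  by apply: trmx_inj; rewrite trmx0 trmx_mul trmxK -!mulmxA mulmxA in aH *.
have -> : xi *m (a *m J *m G)^T = 0.
  apply: trmx_inj; rewrite trmx0 trmx_mul trmxK -(mulmxA (a *m J)) -etaE -mulmxA Jeta.
  by rewrite mulmx0.
by rewrite col_mx0 mulmx0.
Qed.

End MatrixKernel.

Lemma gauss_algebra (K : comRingType) (m n : nat) (j d : 'M[K]_(m, n)) (g A : 'M[K]_n) :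
  g^T = g ->
  (d *m g + j *m (A *m g + g *m A^T)) *m j^T + j *m g *m d^T
  = (d + j *m A) *m g *m j^T + ((d + j *m A) *m g *m j^T)^T.
Proof.
move=> gs.
have tD (a b : nat) (M N : 'M[K]_(a, b)) : (M + N)^T = M^T + N^T by rewrite linearD.
rewrite !(trmx_mul, tD, trmxK, gs) !(mulmxDl, mulmxDr) !mulmxA -!addrA; congr (_ + (_ + _)).
by rewrite addrC.
Qed.

(** [GH] is the connection of the leaf, known only through [GH *m H] with [H = J g J^T]. Skewness of
    [P] with respect to [H] moves [P] out of the way, so the Gauss formula [gE] applies to both
    terms; the derivatives of [J] then cancel. *)
Lemma leaf_algebra (K : comRingType) (m n : nat) (J dJ : 'M[K]_(m, n)) (g f df A : 'M[K]_n)
    (P dP GH : 'M[K]_m) :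
  g^T = g -> (f *m g)^T = - (f *m g) -> P *m J = J *m f ->
  dP *m J + P *m dJ = dJ *m f + J *m df ->
  GH *m (J *m g *m J^T) = (dJ + J *m A) *m g *m J^T ->
  (dP + P *m GH - GH *m P) *m (J *m g *m J^T)
  = J *m (df + f *m A - A *m f) *m g *m J^T.
Proof.
move=> gs skw PJ dPJ gE.
have PH : P *m (J *m g *m J^T) = - (J *m g *m J^T *m P^T).
  have -> : J *m g *m J^T *m P^T = J *m (f *m g)^T *m J^T.
    by rewrite -mulmxA -trmx_mul PJ !trmx_mul gs !mulmxA.
  by rewrite skw mulmxN mulNmx opprK !mulmxA PJ.
have E3 : GH *m P *m (J *m g *m J^T) = (dJ + J *m A) *m f *m g *m J^T.
  rewrite -mulmxA PH mulmxN mulmxA gE.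
  have -> : (dJ + J *m A) *m g *m J^T *m P^T = (dJ + J *m A) *m (f *m g)^T *m J^T.
    by rewrite -mulmxA -trmx_mul PJ !trmx_mul gs !mulmxA.
  by rewrite skw mulmxN mulNmx opprK !mulmxA.
rewrite mulmxBl mulmxDl E3 -(mulmxA P GH) gE !mulmxA.
have dPE : dP *m J = dJ *m f + J *m df - P *m dJ by rewrite -dPJ addrK.
rewrite dPE -!mulmxDl -!mulmxBl; congr (_ *m _ *m _).
rewrite !(mulmxDr, mulmxDl, mulmxN, opprD) !mulmxA PJ.
move: (dJ *m f) (J *m df) (P *m dJ) (J *m f *m A) (J *m A *m f) => a1 a2 a3 a4 a5.
by apply/matrixP => r c; rewrite !mxE; ring.
Qed.

Section CovariantDerivativeOfEndomorphism.
Context {R : realType} {n : nat}.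
Notation E := ('rV[R]_n.+1).
Implicit Types (G F : E -> 'M[R]_n.+1) (v : E).

Definition GamAt G v x : 'M[R]_n.+1 := \sum_a v 0 a *: Gam G a x.

(** The covariant derivative of an endomorphism acting on rows from the right, so the two connection
    terms stand in the opposite order to the usual one. *)
Definition covF G F (a : 'I_n.+1) x : 'M[R]_n.+1 :=
  dmx a F x + F x *m Gam G a x - Gam G a x *m F x.

Definition covFAt G F v x : 'M[R]_n.+1 := \sum_a v 0 a *: covF G F a x.

Lemma covFAtE G F v x :
  covFAt G F v x = \sum_a v 0 a *: dmx a F x + F x *m GamAt G v x - GamAt G v x *m F x.
Proof.
rewrite /covFAt /GamAt mulmx_sumr mulmx_suml -sumrN -!big_split/=.
by apply: eq_bigr => a _; rewrite scalerDr scalerDr scalerN scalemxAr scalemxAl.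
Qed.

Lemma nabM G F (Y : E -> E) a x : mxdiff Y x -> mxdiff F x ->
  nab G a (fun y => Y y *m F y) x = nab G a Y x *m F x + Y x *m covF G F a x.
Proof.
move=> dY dF; rewrite /nab (dmxM a dY dF).2 /covF.
rewrite !(mulmxDl, mulmxDr, mulmxN) !mulmxA -!addrA; congr (_ + _).
by rewrite [RHS]addrC -!addrA addNr addr0.
Qed.

End CovariantDerivativeOfEndomorphism.

(** * The Gauss formula for an immersion *)

Section GaussFormula.
Context {R : realType} {m n : nat}.
Notation D := ('rV[R]_m.+1).
Notation E := ('rV[R]_n.+1).
Variables (W : set D) (U : set E) (iota : D -> E) (G : E -> 'M[R]_n.+1).
Hypotheses (oW : open W) (oU : open U) (si : smooth_mx W iota)
  (WU : forall w, W w -> U (iota w)) (rG : pseudo_riemannian U G).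
Notation J w := ('J iota w).
Definition pullback_metric w := J w *m G (iota w) *m (J w)^T.
Notation H := pullback_metric.
Hypothesis uH : forall w, W w -> H w \in unitmx.

Let sJ : smooth_mx W (fun w => J w) := smooth_jacobian oW si.

Lemma smooth_mx_pullback a b (F : E -> 'M[R]_(a, b)) : smooth_mx U F ->
  smooth_mx W (fun w => F (iota w)).
Proof. by move=> sF i j; exact: smooth_comp oW WU si (sF i j). Qed.

Lemma dmx_pullback a b (F : E -> 'M[R]_(a, b)) i w : smooth_mx U F -> W w ->
  dmx i (fun w => F (iota w)) w = \sum_c J w i c *: dmx c F (iota w).
Proof.
move=> sF Ww; apply/matrixP => r s; rewrite dmxE summxE.
have di := smooth_mx_diff si Ww.
rewrite (partial_comp i di (smooth_diff (sF r s) (WU Ww))).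
by apply: eq_bigr => c _; rewrite jacobianE// mxE dmxE.
Qed.

Lemma pullback_pseudo_riemannian : pseudo_riemannian W H.
Proof.
split; last first.
  move=> w Ww; split; last exact: uH.
  by rewrite !trmx_mul trmxK mulmxA (rG.2 _ (WU Ww)).1.
apply: smooth_mxM => //; last exact: smooth_mxT.
by apply: smooth_mxM => //; apply: smooth_mx_pullback; exact: rG.1.
Qed.

(** Row [j] is the ambient covariant derivative of the [j]-th coordinate field of the immersion in
    the direction of the [i]-th; it has a tangential and a normal part. *)
Definition gauss_form i w := dmx i (fun w => J w) w + J w *m GamAt G (row i (J w)) (iota w).

(** The second derivatives of [iota] commute and the ambient connection is torsion-free. *)
Lemma gauss_form_sym i j w : W w -> row j (gauss_form i w) = row i (gauss_form j w).
Proof.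
move=> Ww; apply/rowP => c; rewrite !mxE.
have E1 a b : dmx a (fun w => J w) w b c = partial a (partial b (fun y => iota y 0 c)) w.
  rewrite dmxE; apply: near_eq_partial; apply: filterS (open_near oW Ww) => z Wz.
  by rewrite jacobianE//; exact: smooth_mx_diff si Wz.
rewrite !E1 (schwarz i j oW (si 0 c) Ww); congr (_ + _).
have E2 a b : \sum_k J w a k * GamAt G (row b (J w)) (iota w) k c
    = \sum_k \sum_l J w a k * J w b l * Gam G l (iota w) k c.
  apply: eq_bigr => k _; rewrite summxE mulr_sumr; apply: eq_bigr => l _.
  by rewrite !mxE mulrA.
rewrite !E2 exchange_big/=; apply: eq_bigr => k _; apply: eq_bigr => l _.
by rewrite (Gam_sym oU rG k l c (WU Ww)) [J w j l * _]mulrC.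
Qed.

(** Pairing with [J] discards the normal part of [gauss_form]. What remains is symmetric and
    compatible with the induced metric, hence is the lowered Levi-Civita connection by
    [koszul_unique]. *)
Lemma gauss_formula i w : W w ->
  Gam H i w *m H w = gauss_form i w *m G (iota w) *m (J w)^T.
Proof.
move=> Ww; apply/esym.
refine (koszul_unique (C := fun i => gauss_form i w *m G (iota w) *m (J w)^T)
  pullback_pseudo_riemannian Ww _ _ i) => {i} [i j k|i].
  have := gauss_form_sym i j Ww; set A := gauss_form i w; set B := gauss_form j w => AB.
  have /rowP/(_ k) : row j (A *m G (iota w) *m (J w)^T) = row i (B *m G (iota w) *m (J w)^T).
    by rewrite !row_mul AB.
  by rewrite !mxE.
have sGi := smooth_mx_pullback rG.1.
have dJ := smooth_mxdiff sJ Ww.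
have dG := smooth_mxdiff sGi Ww.
have dJT := smooth_mxdiff (smooth_mxT oW sJ) Ww.
have [dJG JG] := dmxM i dJ dG.
rewrite /pullback_metric (dmxM i dJG dJT).2 JG dmxT (dmx_pullback i rG.1 Ww).
have -> : \sum_c J w i c *: dmx c G (iota w)
   = GamAt G (row i (J w)) (iota w) *m G (iota w)
   + G (iota w) *m (GamAt G (row i (J w)) (iota w))^T.
  have symG := (rG.2 _ (WU Ww)).1.
  rewrite -[X in _ + X *m _]symG -trmx_mul /GamAt mulmx_suml linear_sum/= -big_split/=.
  apply: eq_bigr => c _; have -> : J w i c = row i (J w) 0 c by rewrite [RHS]mxE.
  rewrite (metric_compat oU rG c (WU Ww)) -scalemxAl.
  by rewrite [(_ *: _)^T]linearZ/= scalerDr.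
exact: gauss_algebra (rG.2 _ (WU Ww)).1.
Qed.

(* The Gauss formula for [phi]: the normal component of its covariant derivative drops out. *)
Lemma pullback_covariant_derivative (phi : E -> 'M[R]_n.+1) (P : D -> 'M[R]_m.+1)
    (Y : D -> D) i w :
  smooth_mx U phi -> (forall x, U x -> (phi x *m G x)^T = - (phi x *m G x)) ->
  (forall w, W w -> P w *m J w = J w *m phi (iota w)) ->
  smooth_mx W Y -> W w ->
  smooth_mx W P /\
  (nab H i (fun w => Y w *m P w) w - nab H i Y w *m P w) *m H w =
  Y w *m J w *m covFAt G phi (row i (J w)) (iota w) *m G (iota w) *m (J w)^T.
Proof.
move=> sphi skew PJ sY Ww.
(* This formula recovers [P] from smooth data; a leaf structure is not assumed to be smooth. *)
have PE z : W z -> J z *m phi (iota z) *m G (iota z) *m (J z)^T *m invmx (H z) = P z.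
  by move=> Wz; rewrite -PJ// -(mulmxA (P z)) -(mulmxA (P z)) mulmxK// uH.
have sphii := smooth_mx_pullback sphi.
have sP : smooth_mx W P.
  apply: smooth_mx_ext PE _ => //; apply: smooth_mxM => //; last first.
    by apply: smooth_invmx => //; exact: pullback_pseudo_riemannian.1.
  apply: smooth_mxM => //; last exact: smooth_mxT.
  apply: smooth_mxM => //; last by apply: smooth_mx_pullback; exact: rG.1.
  exact: smooth_mxM.
split=> //.
have [dY dP dJ dphi] := And4 (smooth_mxdiff sY Ww) (smooth_mxdiff sP Ww)
  (smooth_mxdiff sJ Ww) (smooth_mxdiff sphii Ww).
rewrite nabM// addrAC subrr add0r /covF.
have dPJ : dmx i P w *m J w + P w *m dmx i (fun w => J w) w
    = dmx i (fun w => J w) w *m phi (iota w) + J w *m dmx i (fun w => phi (iota w)) w.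
  rewrite -(dmxM i dP dJ).2 -(dmxM i dJ dphi).2; exact: dmx_ext oW Ww PJ.
have gE := gauss_formula i Ww; have PHE := PJ _ Ww.
have skw := skew _ (WU Ww); have gs := (rG.2 _ (WU Ww)).1.
have covE : covFAt G phi (row i (J w)) (iota w)
    = dmx i (fun w => phi (iota w)) w + phi (iota w) *m GamAt G (row i (J w)) (iota w)
      - GamAt G (row i (J w)) (iota w) *m phi (iota w).
  rewrite covFAtE (dmx_pullback i sphi Ww); congr (_ + _ - _).
  by apply: eq_bigr => c _; rewrite mxE.
have L := leaf_algebra gs skw PHE dPJ gE.
by rewrite covE -(mulmxA (Y w)) [X in Y w *m X]L !mulmxA.
Qed.

End GaussFormula.

(** * Pointwise algebra of a para-contact metric structure *)

Section ParacontactAlgebra.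
Context {F : fieldType} {n : nat}.
Variables (f g : 'M[F]_n) (xi : 'rV[F]_n) (e : 'cV[F]_n).
Hypotheses (ff : f *m f = 1%:M - e *m xi) (xie : xi *m e = 1%:M)
  (fgf : f *m g *m f^T = - g + e *m e^T) (eE : e = g *m xi^T) (gs : g^T = g).

(** [f] commutes with [f *m f], hence with [e *m xi]; so [e] and [xi] are eigenvectors of [f] with a
    common eigenvalue. *)
Lemma phi_eta_scalar : f *m e = (xi *m f *m e) 0 0 *: e /\ xi *m f = (xi *m f *m e) 0 0 *: xi.
Proof.
have C : f *m e *m xi = e *m xi *m f.
  have : f *m (f *m f) = (f *m f) *m f by rewrite mulmxA.
  rewrite ff mulmxBr mulmxBl mulmx1 mul1mx mulmxA => /(congr1 (fun M => f - M)).
  by rewrite !subKr.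
split.
  have := congr1 (mulmx^~ e) C; rewrite -[in LHS]mulmxA xie mulmx1 => ->.
  by rewrite -!mulmxA [X in e *m X]mx11_scalar mul_mx_scalar !mulmxA.
have := congr1 (mulmx xi) C; rewrite !mulmxA xie mul1mx => H.
by rewrite -[LHS]H [X in X *m xi]mx11_scalar mul_scalar_mx.
Qed.

(** The eigenvalue has square 0, because [xi *m f *m f = xi - xi = 0]. *)
Lemma phi_xi_eq0 : xi *m f = 0.
Proof.
have [_] := phi_eta_scalar; move: (_ 0 0) => s H.
have : xi *m f *m f = 0 by rewrite -mulmxA ff mulmxBr mulmx1 mulmxA xie mul1mx subrr.
rewrite H -scalemxAl H scalerA => /(congr1 (fun M => (M *m e) 0 0)).
rewrite mul0mx -scalemxAl xie !mxE eqxx mulr1 => /eqP; rewrite mulf_eq0 orbb => /eqP ->.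
by rewrite scale0r.
Qed.

Lemma phi_eta_eq0 : f *m e = 0.
Proof. by rewrite phi_eta_scalar.1 phi_xi_eq0 mul0mx mxE scale0r. Qed.

(** Multiplying the compatibility relation by [f] on the left turns its left side into [g f^T], as
    [f f = 1 - e xi] and [f e = 0]. *)
Lemma phi_skew : (f *m g)^T = - (f *m g).
Proof.
have := congr1 (mulmx f) fgf.
rewrite mulmxDr (mulmxA f e) phi_eta_eq0 mul0mx addr0 mulmxN !mulmxA ff => <-.
rewrite mulmxBl mul1mx mulmxBl.
have -> : e *m xi *m g *m f^T = 0.
  have xig : xi *m g = e^T by rewrite eE trmx_mul trmxK gs.
  by rewrite -(mulmxA e) xig -mulmxA -trmx_mul phi_eta_eq0 trmx0 mulmx0.
by rewrite subr0 trmx_mul gs.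
Qed.

End ParacontactAlgebra.

Section ParacontactMetric.
Context {R : realType} {n : nat}.
Notation E := ('rV[R]_n.+1).
Variables (U : set E) (S : pc_data R n).
Hypotheses (oU : open U) (pcS : almost_paracontact_metric U S).

Lemma mulmx_row_ext a b (A B : 'M[R]_(a, b)) : (forall v : 'rV_a, v *m A = v *m B) -> A = B.
Proof. by move=> AB; apply/row_matrixP => i; rewrite !rowE AB. Qed.

Lemma bilinear_ext (A B : 'M[R]_n.+1) :
  (forall X Y : E, (X *m A *m Y^T) 0 0 = (X *m B *m Y^T) 0 0) -> A = B.
Proof.
move=> AB; apply/matrixP => i j; have := AB (delta_mx 0 i) (delta_mx 0 j).
by rewrite trmx_delta -!rowE -!colE !mxE.
Qed.

Lemma paracontact_matrix x : U x ->
  [/\ pc_phi S x *m pc_phi S x = 1%:M - pc_eta S x *m pc_xi S x,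
      pc_xi S x *m pc_eta S x = 1%:M,
      pc_phi S x *m pc_g S x *m (pc_phi S x)^T = - pc_g S x + pc_eta S x *m (pc_eta S x)^T,
      pc_eta S x = pc_g S x *m (pc_xi S x)^T & (pc_g S x)^T = pc_g S x].
Proof.
move=> Ux; have [A1 A2 A3 A4] := pcS.2 x Ux.
have gs : (pc_g S x)^T = pc_g S x by have [_ _ _ [_ H]] := pcS.1; exact: (H x Ux).1.
split=> //.
- apply: mulmx_row_ext => v; rewrite mulmxA; have := A1 v; rewrite /phi => ->.
  rewrite mulmxBr mulmx1 mulmxA; congr (_ - _).
  by rewrite /Defs.eta [in RHS](mx11_scalar (v *m _)) mul_scalar_mx.
- by apply/matrixP => i j; rewrite !ord1 [LHS]A2 mxE.
- apply: bilinear_ext => X Y; have := A3 X Y; rewrite /met /phi trmx_mul !mulmxA => ->.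
  rewrite mulmxDr mulmxDl mulmxN mulNmx !mulmxA; rewrite /Defs.eta.
  rewrite -(mulmxA (X *m _)) -trmx_mul.
  move: (X *m pc_g S x *m Y^T) (X *m pc_eta S x) (Y *m pc_eta S x) => a b c.
  by rewrite [RHS]mxE [X in _ = X + _]mxE [X in _ = _ + X]mxE big_ord1 [c^T _ _]mxE.
- apply: mulmx_row_ext => v; apply/matrixP => i j; rewrite !ord1 mulmxA.
  have := A4 v; rewrite /Defs.eta /met => ->.
  have -> : v *m pc_g S x *m (pc_xi S x)^T = (pc_xi S x *m pc_g S x *m v^T)^T.
    by rewrite !trmx_mul trmxK gs mulmxA.
  by rewrite [RHS]mxE.
Qed.

Lemma paracontact_phi x : U x ->
  [/\ pc_xi S x *m pc_phi S x = 0, pc_phi S x *m pc_eta S x = 0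
    & (pc_phi S x *m pc_g S x)^T = - (pc_phi S x *m pc_g S x)].
Proof.
move=> /paracontact_matrix[A1 A2 A3 A4 A5]; split.
- exact: phi_xi_eq0 A1 A2.
- exact: phi_eta_eq0 A1 A2.
- exact: phi_skew A1 A2 A3 A4 A5.
Qed.

Lemma paracontact_smooth :
  [/\ smooth_mx U (pc_phi S), smooth_mx U (pc_xi S), smooth_mx U (pc_eta S)
    & pseudo_riemannian U (pc_g S)].
Proof. exact: pcS.1. Qed.

End ParacontactMetric.

(** * Parallelism on the leaves as a condition on the ambient structure *)

Section ParaKahlerLeaves.
Context {R : realType} {n : nat}.
Notation E := ('rV[R]_n.+2).
Notation D := ('rV[R]_n.+1).
Variables (U : set E) (S : pc_data R n.+1).
Hypotheses (oU : open U) (pcS : almost_paracontact_metric U S).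

Definition leaf_condition x := forall u b c : E,
  u *m pc_eta S x = 0 -> b *m pc_eta S x = 0 -> c *m pc_eta S x = 0 ->
  b *m covFAt (pc_g S) (pc_phi S) u x *m pc_g S x *m c^T = 0.

Lemma covFAt_mulmx (G F : E -> 'M[R]_n.+2) (v : D) (J : 'M[R]_(n.+1, n.+2)) x :
  covFAt G F (v *m J) x = \sum_i v 0 i *: covFAt G F (row i J) x.
Proof.
rewrite /covFAt; under [RHS]eq_bigr do rewrite scaler_sumr.
rewrite exchange_big/=; apply: eq_bigr => a _; rewrite mxE scaler_suml.
by apply: eq_bigr => i _; rewrite scalerA mxE.
Qed.

Lemma leaf_param_tangent W (iota : D -> E) w : leaf_param U S W iota -> W w ->
  [/\ row_free ('J iota w), 'J iota w *m pc_eta S (iota w) = 0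
    & leaf_metric S iota w \in unitmx].
Proof.
move=> [oW si WU H] Ww; have [fJ Jeta] := H w Ww.
have Je : 'J iota w *m pc_eta S (iota w) = 0.
  apply: mulmx_row_ext => v; rewrite mulmx0 mulmxA; apply/matrixP => i j.
  by rewrite !ord1 [RHS]mxE; exact: Jeta.
have [A1 A2 A3 A4 A5] := paracontact_matrix pcS (WU _ Ww).
have [_ _ _ rG] := paracontact_smooth pcS.
split=> //; exact: induced_metric_unit fJ Je (rG.2 _ (WU _ Ww)).2 A4 A2.
Qed.

Lemma leaf_covariant_derivative W (iota : D -> E) P X Y w :
  leaf_param U S W iota -> leaf_structure S W iota P ->
  smooth_mx W X -> smooth_mx W Y -> W w ->
  (nablaF (leaf_metric S iota) X (fun y => Y y *m P y) w
    - nablaF (leaf_metric S iota) X Y w *m P w) *m leaf_metric S iota w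
  = Y w *m 'J iota w *m covFAt (pc_g S) (pc_phi S) (X w *m 'J iota w) (iota w)
     *m pc_g S (iota w) *m ('J iota w)^T.
Proof.
move=> lW lP sX sY Ww; have [oW si WU _] := lW.
have [sphi _ _ rG] := paracontact_smooth pcS.
have uH z : W z -> pullback_metric iota (pc_g S) z \in unitmx.
  by move=> Wz; have [_ _] := leaf_param_tangent lW Wz.
have skew x : U x -> (pc_phi S x *m pc_g S x)^T = - (pc_phi S x *m pc_g S x).
  by move=> Ux; have [_ _] := paracontact_phi pcS Ux.
have PJ z : W z -> P z *m 'J iota z = 'J iota z *m pc_phi S (iota z).
  by move=> Wz; apply: mulmx_row_ext => v; rewrite !mulmxA; exact: lP.
have K i := pullback_covariant_derivative oW oU si WU rG uH i sphi skew PJ sY Ww.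
have sP := (K ord0).1.
rewrite /nablaF !nabla_sum; [|exact: smooth_mxdiff sY Ww|].
  rewrite mulmx_suml -sumrB mulmx_suml covFAt_mulmx mulmx_sumr !mulmx_suml.
  apply: eq_bigr => i _; rewrite -scalemxAl -scalerBr -scalemxAl (K i).2.
  by rewrite -scalemxAr -!scalemxAl.
exact: smooth_mxdiff (smooth_mxM oW sY sP) Ww.
Qed.

Lemma leaf_condition_parallel : (forall x, U x -> leaf_condition x) ->
  para_kahler_leaves U S.
Proof.
move=> LC W iota P lW lP X Y sX sY w Ww.
have [fJ Je uH] := leaf_param_tangent lW Ww.
have [oW si WU _] := lW.
have K := leaf_covariant_derivative lW lP sX sY Ww.
have Z : Y w *m 'J iota w *m covFAt (pc_g S) (pc_phi S) (X w *m 'J iota w) (iota w)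
     *m pc_g S (iota w) *m ('J iota w)^T = 0.
  apply: trmx_inj; rewrite trmx0; apply: mulmx_row_ext => v; rewrite mulmx0.
  have -> (A : E) : v *m (A *m ('J iota w)^T)^T = (A *m (v *m 'J iota w)^T)^T.
    by rewrite !trmx_mul !trmxK mulmxA.
  apply: trmx_inj; rewrite trmxK trmx0.
  by apply: LC; [exact: WU|rewrite -mulmxA Je mulmx0..].
rewrite Z in K.
by have := congr1 (mulmx^~ (invmx (leaf_metric S iota w))) K; rewrite mulmxK// mul0mx.
Qed.

End ParaKahlerLeaves.

(** * Leaves through a given point *)

Section LeafThroughPoint.
Context {R : realType} {n : nat}.
Notation E := ('rV[R]_n.+2).
Notation D := ('rV[R]_n.+1).
Variables (U : set E) (S : pc_data R n.+1).
Hypotheses (oU : open U) (pcS : almost_paracontact_metric U S)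
  (cS : closed_1form U (pc_eta S)).

(** A local potential [t] of [eta] replaces a coordinate [a] in which [eta] does not vanish at [x].
    By the inverse function theorem this is a coordinate system, and the leaf is the slice where [t]
    keeps its value at [x]. *)
Lemma leaf_exists x : U x ->
  exists W (iota : D -> E) w, [/\ leaf_param U S W iota, W w & iota w = x].
Proof.
move=> Ux; have [_ _ se _] := paracontact_smooth pcS.
have [A1 A2 A3 A4 A5] := paracontact_matrix pcS Ux.
have [a ea] : exists a, pc_eta S x a 0 != 0.
  apply/existsP; apply: contraT; rewrite negb_exists => /forallP H.
  have e0 : pc_eta S x = 0.
    by apply/matrixP => i j; rewrite ord1 [RHS]mxE; apply/eqP; have := H i; rewrite negbK.
  by move: A2; rewrite e0 mulmx0 => /matrixP/(_ 0 0); rewrite !mxE => /eqP; rewrite eq_sym oner_eq0.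
have [W0 [t [oW0 W0x W0U st dt]]] : exists W f, [/\ open W, W x, W `<=` U, smooth W f &
    forall z, W z -> forall i, partial i f z = pc_eta S z i 0].
  apply: (@poincare _ _ U (fun i z => pc_eta S z i 0)) => // z i j Uz.
  by apply/eqP; rewrite -subr_eq0; apply/eqP; exact: cS.
pose k (z : E) : E := \row_j (if j == a then t z else z 0 j).
have sk : smooth_mx W0 k.
  move=> i j; rewrite ord1; case ja : (j == a).
    by apply: smooth_ext st => // z _; rewrite mxE ja.
  by apply: smooth_ext (smooth_coordf j oW0) => // z _; rewrite mxE ja.
have kc (j : 'I_n.+2) : j != a -> (fun z => k z 0 j) = (fun z => z 0 j).
  by move=> ja; apply/funext => z; rewrite mxE (negbTE ja).
have ka : (fun z => k z 0 a) = t by apply/funext => z; rewrite mxE eqxx.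
have uJ : 'J k x \in unitmx.
  apply: unitmx_ker => v vJ.
  have dk := smooth_mx_diff sk W0x.
  have E1 j : \sum_i v 0 i * partial i (fun z => k z 0 j) x = 0.
    have /rowP/(_ j) := vJ; rewrite mxE [RHS]mxE => H; rewrite -[RHS]H.
    by apply: eq_bigr => i _; rewrite jacobianE.
  have va j : j != a -> v 0 j = 0.
    move=> ja; have := E1 j; rewrite (kc _ ja) (bigD1 j)//= partial_coordf eqxx mulr1.
    by rewrite big1 ?addr0// => i ij; rewrite partial_coordf (negbTE ij) mulr0.
  apply/rowP => j; rewrite [RHS]mxE; case: (eqVneq j a) => [->|]; last exact: va.
  have := E1 a; rewrite ka (bigD1 a)//= big1 ?addr0 => [|i ia].
    by rewrite dt// => /eqP; rewrite mulf_eq0 (negbTE ea) orbF => /eqP.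
  by rewrite va// mul0r.
have [W1 [V [W1x W1W0 [oW1 oV sk1 kV [l [sl lV lk kl]]]]]] := inverse_function oW0 W0x sk uJ.
(* [q] inserts the constant [t x] in slot [a]. *)
pose q (w : D) : E := \row_j (if unlift a j is Some b then w 0 b else t x).
have sq (T : set D) : open T -> smooth_mx T q.
  move=> oT i j; rewrite ord1; case ja : (unlift a j) => [b|].
    by apply: smooth_ext (smooth_coordf b oT) => // w _; rewrite mxE ja.
  by apply: smooth_ext (smooth_cst (t x) oT) => // w _; rewrite mxE ja.
pose W : set D := [set w | V (q w)].
have oW : open W.
  rewrite (_ : W = [set w | setT w /\ V (q w)]); last first.
    by apply/seteqP; split=> w; rewrite /W/= => // -[].
  have oT : open [set: D] by exact: openT.
  rewrite openE => w [_ Vw]; apply: filterI; first exact: filterT.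
  have qc : {for w, continuous q}.
    by apply: differentiable_continuous; exact: smooth_mx_diff (sq _ oT) _.
  by apply: qc; exact: open_near oV Vw.
pose iota w := l (q w).
have si : smooth_mx W iota.
  by move=> i j; exact: (smooth_comp (F := q) oW (fun w Ww => Ww) (sq _ oW) (sl i j)).
have WU w : W w -> U (iota w) by move=> Ww; apply/W0U/W1W0/lV.
have kiota w : W w -> k (iota w) = q w by move=> Ww; exact: kl.
exists W, iota, (\row_b x 0 (lift a b)).
have qx : q (\row_b x 0 (lift a b)) = k x.
  apply/rowP => j; rewrite /q /k !mxE; case: unliftP => [b ->|->]; last by rewrite eqxx.
  by rewrite mxE eq_sym (negbTE (neq_lift a b)).
split; [split=> // w Ww|by rewrite /W/= qx; exact: kV|by rewrite /iota qx lk].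
have di := smooth_mx_diff si Ww.
split.
  apply: row_free_ker => v vJ; apply/rowP => b; rewrite [RHS]mxE.
  have /rowP/(_ (lift a b)) := vJ; rewrite mxE [RHS]mxE => H; rewrite -[RHS]H.
  have ib z : W z -> iota z 0 (lift a b) = z 0 b.
    move=> Wz; have /rowP/(_ (lift a b)) := kiota z Wz.
    by rewrite /k /q !mxE liftK eq_sym (negbTE (neq_lift a b)).
  have E1 i : 'J iota w i (lift a b) = (i == b)%:R.
    rewrite jacobianE// -(partial_coordf w i b); apply: near_eq_partial.
    by apply: filterS (open_near oW Ww) => z; exact: ib.
  rewrite (bigD1 b)//= E1 eqxx mulr1 big1 ?addr0// => i ib'.
  by rewrite E1 (negbTE ib') mulr0.
move=> X; rewrite /Defs.eta -mulmxA.
rewrite (_ : 'J iota w *m pc_eta S (iota w) = 0) ?mulmx0 ?mxE//.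
apply/matrixP => i j; rewrite ord1 mxE [RHS]mxE.
have W0i : W0 (iota w) by apply/W1W0/lV.
have ti z : W z -> t (iota z) = t x.
  move=> Wz; have /rowP/(_ a) := kiota z Wz.
  by rewrite /k /q !mxE eqxx unlift_none.
have : partial i (fun z => t (iota z)) w = 0.
  rewrite -(partial_cst (t x) w i); apply: near_eq_partial.
  by apply: filterS (open_near oW Ww) => z; exact: ti.
rewrite (partial_comp i di (smooth_diff st W0i)) => H; rewrite -[RHS]H.
by apply: eq_bigr => c _; rewrite jacobianE// dt.
Qed.

Lemma parallel_leaf_condition x : para_kahler_leaves U S -> U x -> leaf_condition S x.
Proof.
move=> PK Ux u b c ue be ce.
have [W [iota [w [lW Ww iw]]]] := leaf_exists Ux.
have [A1 A2 A3 A4 A5] := paracontact_matrix pcS Ux.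
have [fJ Je uH] := leaf_param_tangent pcS lW Ww.
have [oW _ WU _] := lW.
rewrite iw in Je.
have [u' uE] := hyperplane_tangent fJ Je A2 ue.
have [b' bE] := hyperplane_tangent fJ Je A2 be.
have [c' cE] := hyperplane_tangent fJ Je A2 ce.
(* The restriction of [phi] to the leaf in closed form; it satisfies the defining relation because
   [phi] maps tangent vectors of the leaf to tangent vectors. *)
pose P z := 'J iota z *m pc_phi S (iota z) *m pc_g S (iota z) *m ('J iota z)^T
            *m invmx (leaf_metric S iota z).
have PJ z : W z -> P z *m 'J iota z = 'J iota z *m pc_phi S (iota z).
  move=> Wz.
  have [fJz Jez uHz] := leaf_param_tangent pcS lW Wz.
  have [_ B2 _ _ _] := paracontact_matrix pcS (WU _ Wz).
  have [_ fe _] := paracontact_phi pcS (WU _ Wz).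
  have H (i : 'I_n.+1) : exists v, row i ('J iota z *m pc_phi S (iota z)) = v *m 'J iota z.
    apply: (hyperplane_tangent fJz Jez B2).
    by rewrite row_mul -mulmxA fe mulmx0.
  have [v vE] := @choice _ _ _ H.
  have vJ : 'J iota z *m pc_phi S (iota z) = (\matrix_i v i) *m 'J iota z.
    by apply/row_matrixP => i; rewrite [RHS]row_mul rowK; exact: vE.
  rewrite /P vJ; congr (_ *m _).
  by rewrite -(mulmxA (\matrix_i v i)) -(mulmxA (\matrix_i v i)) mulmxK.
have lP : leaf_structure S W iota P.
  move=> z Wz X; apply: etrans (esym (mulmxA _ _ _)) _.
  by rewrite (PJ _ Wz); exact: mulmxA.
(* The condition is pointwise, so fields that are constant in the parameters of the leaf suffice. *)
have sX := smooth_mx_cst u' oW; have sY := smooth_mx_cst b' oW.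
have K := leaf_covariant_derivative oU pcS lW lP sX sY Ww.
rewrite (PK _ _ _ lW lP _ _ sX sY _ Ww) mul0mx iw -uE -bE in K.
by rewrite cE trmx_mul mulmxA -K mul0mx.
Qed.

End LeafThroughPoint.

(** * Adopted frames *)

Section Contractions.
Context {R : comRingType} {n : nat}.
Implicit Types (u v w : 'rV[R]_n) (T : 'I_n -> 'I_n -> 'I_n -> R).

Definition tri T u v w := \sum_i \sum_j \sum_k u 0 i * v 0 j * w 0 k * T i j k.

(** Carries cyclic identities from coordinate indices to arbitrary vectors; it is applied to the
    closedness of the fundamental form and to the Bianchi identity. *)
Lemma tri_cyclic T u v w : (forall i j k, T i j k + T j k i + T k i j = 0) ->
  tri T u v w + tri T v w u + tri T w u v = 0.
Proof.
move=> H.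
have E1 : tri T v w u = \sum_i \sum_j \sum_k u 0 i * v 0 j * w 0 k * T j k i.
  rewrite /tri exchange_big/=.
  under eq_bigr do rewrite exchange_big/=.
  rewrite exchange_big/=; apply: eq_bigr => i _; rewrite exchange_big/=.
  by apply: eq_bigr => j _; apply: eq_bigr => k _; ring.
have E2 : tri T w u v = \sum_i \sum_j \sum_k u 0 i * v 0 j * w 0 k * T k i j.
  rewrite /tri exchange_big/=; apply: eq_bigr => i _; rewrite exchange_big/=.
  by apply: eq_bigr => j _; apply: eq_bigr => k _; ring.
rewrite E1 E2 /tri -!big_split big1// => i _; rewrite -!big_split big1// => j _.
by rewrite -!big_split big1//= => k _; rewrite -!mulrDr H mulr0.
Qed.

End Contractions.

Definition pr (R : comRingType) (n : nat) (G : 'M[R]_n) (X Y : 'rV[R]_n) : R :=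
  (X *m G *m Y^T) 0 0.

Section Pairing.
Context {R : comRingType} {n : nat}.
Variable G : 'M[R]_n.
Implicit Types X Y Z : 'rV[R]_n.

Lemma prDl X Y Z : pr G (X + Y) Z = pr G X Z + pr G Y Z.
Proof. by rewrite /pr !mulmxDl mxE. Qed.

Lemma prZl c X Z : pr G (c *: X) Z = c * pr G X Z.
Proof. by rewrite /pr -!scalemxAl mxE. Qed.

Lemma prDr X Y Z : pr G Z (X + Y) = pr G Z X + pr G Z Y.
Proof. by rewrite /pr linearD mulmxDr mxE. Qed.

Lemma prZr c X Z : pr G Z (c *: X) = c * pr G Z X.
Proof. by rewrite /pr linearZ/= -scalemxAr mxE. Qed.

Lemma prNl X Z : pr G (- X) Z = - pr G X Z.
Proof. by rewrite -scaleN1r prZl mulN1r. Qed.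

Lemma prNr X Z : pr G Z (- X) = - pr G Z X.
Proof. by rewrite -scaleN1r prZr mulN1r. Qed.

Lemma pr0l Z : pr G 0 Z = 0.
Proof. by rewrite /pr !mul0mx mxE. Qed.

Lemma pr_suml (I : Type) (s : seq I) (P : pred I) (F : I -> 'rV_n) Z :
  pr G (\sum_(i <- s | P i) F i) Z = \sum_(i <- s | P i) pr G (F i) Z.
Proof. by rewrite /pr !mulmx_suml summxE. Qed.

Lemma prC : G^T = G -> forall X Y, pr G X Y = pr G Y X.
Proof.
move=> gs X Y; rewrite /pr.
have -> : X *m G *m Y^T = (Y *m G *m X^T)^T by rewrite !trmx_mul trmxK gs mulmxA.
by rewrite mxE.
Qed.

Lemma pr_skew X Y : G + G^T = 0 -> pr G X Y = - pr G Y X.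
Proof.
move=> /eqP; rewrite addr_eq0 => /eqP GE.
have -> : pr G X Y = (X *m G *m Y^T)^T 0 0 by rewrite mxE.
rewrite !trmx_mul trmxK /pr [in RHS]GE mulmxN mulNmx [in RHS]mxE opprK.
by rewrite mulmxA.
Qed.

Lemma pr_sum_delta X Y : pr G X Y = \sum_j Y 0 j * pr G X (delta_mx 0 j).
Proof.
rewrite {1}[Y]row_sum_delta /pr linear_sum mulmx_sumr summxE.
by apply: eq_bigr => j _; rewrite linearZ/= -scalemxAr mxE.
Qed.

Lemma pr_sum2 X Y : pr G X Y = \sum_i \sum_j X 0 i * Y 0 j * G i j.
Proof.
rewrite /pr mxE exchange_big/=; apply: eq_bigr => j _; rewrite !mxE mulr_suml.
by apply: eq_bigr => i _; ring.
Qed.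

End Pairing.

(** * Linear algebra in an adopted frame *)

Section FrameAlgebra.
Context {R : realFieldType}.
Notation E := ('rV[R]_5).
Variables (G : 'M[R]_5) (V : 'I_5 -> E).
Hypotheses (gs : G^T = G) (uG : G \in unitmx)
  (gram : forall i j, pr G (V i) (V j) =
     if (i, j) \in [:: (i0, i0); (i1, i3); (i3, i1); (i2, i4); (i4, i2)] then 1 else 0).

Lemma sum5 (T : nmodType) (F : 'I_5 -> T) :
  \sum_i F i = F i0 + F i1 + F i2 + F i3 + F i4.
Proof.
rewrite !big_ord_recr big_ord0/= add0r.
by do ?congr (_ + _); congr F; apply/val_inj.
Qed.

Lemma ord5P (P : 'I_5 -> Prop) : P i0 -> P i1 -> P i2 -> P i3 -> P i4 -> forall i, P i.
Proof.
move=> P0 P1 P2 P3 P4 [m Hm].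
case: m Hm => [|[|[|[|[|m]]]]] Hm //.
- by rewrite (_ : Ordinal Hm = i0)//; apply/val_inj.
- by rewrite (_ : Ordinal Hm = i1)//; apply/val_inj.
- by rewrite (_ : Ordinal Hm = i2)//; apply/val_inj.
- by rewrite (_ : Ordinal Hm = i3)//; apply/val_inj.
- by rewrite (_ : Ordinal Hm = i4)//; apply/val_inj.
Qed.

Definition frame_mx : 'M[R]_5 := \matrix_i V i.

Lemma frame_combination (a : E) j : pr G (a *m frame_mx) (V j) = \sum_i a 0 i * pr G (V i) (V j).
Proof.
rewrite mulmx_sum_row pr_suml; apply: eq_bigr => i _.
by rewrite prZl rowK.
Qed.

(** The Gram matrix is a permutation matrix, so each pairing of a combination with a frame vector
    isolates one coefficient. *)
Lemma frame_unit : frame_mx \in unitmx.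
Proof.
rewrite -row_free_unit -kermx_eq0; apply/rowV0P => a /sub_kermxP aM.
have H j : \sum_i a 0 i * pr G (V i) (V j) = 0 by rewrite -frame_combination aM pr0l.
move: (H i0) (H i1) (H i2) (H i3) (H i4); rewrite !sum5 !gram/= !(mulr0, mulr1, addr0, add0r) => H0 H1 H2 H3 H4.
by apply/rowP => j; rewrite [RHS]mxE; elim/ord5P: j.
Qed.

Lemma frame_eq0 X : (forall i, pr G X (V i) = 0) -> X = 0.
Proof.
move=> H; have : X *m G *m frame_mx^T = 0.
  apply/rowP => j; rewrite [RHS]mxE -(H j) /pr !mxE; apply: eq_bigr => k _.
  by rewrite !mxE.
move=> /(congr1 (mulmx^~ (invmx frame_mx^T))).
rewrite mulmxK ?unitmx_tr ?frame_unit// mul0mx => /(congr1 (mulmx^~ (invmx G))).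
by rewrite mulmxK// mul0mx.
Qed.

Lemma frame_ext X Y : (forall i, pr G X (V i) = pr G Y (V i)) -> X = Y.
Proof.
move=> H; apply/eqP; rewrite -subr_eq0; apply/eqP/frame_eq0 => i.
by rewrite prDl prNl H subrr.
Qed.

Lemma coframe_ext (a b : 'cV[R]_5) : (forall i, V i *m a = V i *m b) -> a = b.
Proof.
move=> H; have : frame_mx *m a = frame_mx *m b.
  by apply/row_matrixP => i; rewrite !row_mul rowK.
by move=> /(congr1 (mulmx (invmx frame_mx))); rewrite !mulmxA mulVmx ?frame_unit// !mul1mx.
Qed.

(** The vectors [V1], [V3] and [V2], [V4] form dual null pairs, which explains the crossed indices:
    the coefficient of [V1] is the pairing with [V3]. *)
Lemma frame_expand X : X = pr G X (V i0) *: V i0 + pr G X (V i3) *: V i1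
  + pr G X (V i4) *: V i2 + pr G X (V i1) *: V i3 + pr G X (V i2) *: V i4.
Proof.
by apply: frame_ext; elim/ord5P; rewrite !prDl !prZl !gram/= !(mulr0, mulr1, addr0, add0r).
Qed.

Lemma frame_trace (M : 'M[R]_5) : \tr M =
  pr G (V i0 *m M) (V i0) + pr G (V i1 *m M) (V i3) + pr G (V i2 *m M) (V i4)
  + pr G (V i3 *m M) (V i1) + pr G (V i4 *m M) (V i2).
Proof.
have -> : \tr M = \tr (frame_mx *m M *m invmx frame_mx).
  by rewrite mxtrace_mulC mulmxA mulVmx ?frame_unit// mul1mx.
rewrite /mxtrace sum5.
have H i (X : E) : (X *m invmx frame_mx) 0 i = nth 0 [:: pr G X (V i0); pr G X (V i3);
   pr G X (V i4); pr G X (V i1); pr G X (V i2)] i.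
  have XE : X = (\row_j nth 0 [:: pr G X (V i0); pr G X (V i3);
      pr G X (V i4); pr G X (V i1); pr G X (V i2)] j) *m frame_mx.
    rewrite mulmx_sum_row sum5 !rowK !mxE/=; exact: frame_expand.
  by rewrite {1}XE mulmxK ?frame_unit// [LHS]mxE.
have K i : (frame_mx *m M *m invmx frame_mx) i i = (V i *m M *m invmx frame_mx) 0 i.
  have -> : V i *m M *m invmx frame_mx = row i (frame_mx *m M *m invmx frame_mx).
    by rewrite !row_mul rowK.
  by rewrite [RHS]mxE.
by rewrite !K !H.
Qed.

Lemma pr_delta_sum (Y Z : E) : \sum_j Y 0 j * pr G (delta_mx 0 j) Z = pr G Y Z.
Proof.
rewrite (prC gs Y) (pr_sum_delta G Z Y).
by apply: eq_bigr => j _; rewrite (prC gs).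
Qed.

(** * Codazzi equation, with [A], [B] for [nabla V1], [nabla V2] and [D1], [D2] for [d th1],
    [d th2] *)

Section Codazzi.
Variables (f : 'M[R]_5) (e : 'cV[R]_5) (A B : 'I_5 -> E) (D1 D2 : 'I_5 -> 'I_5 -> R) (sigma : R).
Notation th a j := (pr G (delta_mx 0 j) (V a)).
Hypotheses (s0 : sigma != 0) (fskew : (f *m G)^T = - (f *m G)) (fe : f *m e = 0)
  (eE : e = G *m (V i0)^T)
  (V1f : V i1 *m f = - V i1) (V2f : V i2 *m f = V i2)
  (V3f : V i3 *m f = V i3) (V4f : V i4 *m f = - V i4)
  (Af : forall i, A i *m f = - A i) (Bf : forall i, B i *m f = B i)
  (AB : forall i, pr G (A i) (V i2) + pr G (V i1) (B i) = 0)
  (D1E : forall i j, D1 i j = pr G (delta_mx 0 j) (A i) - pr G (delta_mx 0 i) (A j))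
  (D2E : forall i j, D2 i j = pr G (delta_mx 0 j) (B i) - pr G (delta_mx 0 i) (B j))
  (codazzi : forall i j,
     (D1 i j *: V i1 + (th i1 j *: A i - th i1 i *: A j))
     + sigma *: (D2 i j *: V i2 + (th i2 j *: B i - th i2 i *: B j)) = 0).

Lemma pr_phi_skew X Y : pr G (X *m f) Y = - pr G X (Y *m f).
Proof.
have -> : pr G X (Y *m f) = (X *m (G *m f^T) *m Y^T) 0 0.
  by rewrite /pr trmx_mul !mulmxA.
have -> : G *m f^T = - (f *m G) by rewrite -fskew trmx_mul gs.
by rewrite /pr mulmxN mulNmx [in RHS]mxE opprK mulmxA.
Qed.

(** Eigenspaces of a skew endomorphism for [-1] are totally null; such an [X] therefore lies in the
    span of [V1] and [V4]. *)
Lemma eigen_minus X : X *m f = - X ->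
  [/\ pr G X (V i0) = 0, pr G X (V i1) = 0 & pr G X (V i4) = 0].
Proof.
move=> Xf; have half (x : R) : - x = x -> x = 0 by lra.
split; apply: half.
- have : X *m e = 0.
    by apply: oppr_inj; rewrite oppr0 -mulNmx -Xf -mulmxA fe mulmx0.
  by rewrite /pr -mulmxA -eE => ->; rewrite mxE oppr0.
- by rewrite -prNl -Xf pr_phi_skew V1f prNr opprK.
- by rewrite -prNl -Xf pr_phi_skew V4f prNr opprK.
Qed.

Lemma eigen_plus X : X *m f = X ->
  [/\ pr G X (V i0) = 0, pr G X (V i2) = 0 & pr G X (V i3) = 0].
Proof.
move=> Xf; have half (x : R) : x = - x -> x = 0 by lra.
split.
- have : X *m e = 0 by rewrite -Xf -mulmxA fe mulmx0.
  by rewrite /pr -mulmxA -eE => ->; rewrite mxE.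
- by apply: half; rewrite -{1}Xf pr_phi_skew V2f.
- by apply: half; rewrite -{1}Xf pr_phi_skew V3f.
Qed.

Lemma codazzi_pair i j a :
  D1 i j * pr G (V i1) (V a) + (th i1 j * pr G (A i) (V a) - th i1 i * pr G (A j) (V a))
  + sigma * (D2 i j * pr G (V i2) (V a) + (th i2 j * pr G (B i) (V a) - th i2 i * pr G (B j) (V a))) = 0.
Proof.
by have := congr1 (fun X => pr G X (V a)) (codazzi i j); rewrite !(prDl, prZl, prNl) pr0l.
Qed.

(** Let [beta] be this component, the coefficient of [V4] in [A]. Pairing the Codazzi equation with
    [V2] gives [beta /\ th1 = 0]; pairing it with [V1] gives [beta /\ th2 = 0], because [AB] makes
    the component of [B] along [V3] equal to [- beta]. So [beta] is proportional to both of the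
    independent forms [th1] and [th2]. *)
Lemma codazzi_beta i : pr G (A i) (V i2) = 0.
Proof.
have [B1 B2] : (forall k, pr G (B k) (V i1) = - pr G (A k) (V i2)) /\ True.
  by split=> // k; apply/eqP; rewrite -addr_eq0 addrC (prC gs (B k)) AB.
have H1 k l : th i1 l * pr G (A k) (V i2) = th i1 k * pr G (A l) (V i2).
  have := codazzi_pair k l i2; rewrite !gram/=.
  have [_ -> _] := eigen_plus (Bf k); have [_ -> _] := eigen_plus (Bf l).
  by rewrite !(mulr0, subr0, addr0, add0r, oppr0) => /eqP; rewrite subr_eq0 => /eqP.
have H2 k l : th i2 l * pr G (A k) (V i2) = th i2 k * pr G (A l) (V i2).
  have := codazzi_pair k l i1; rewrite !gram/=.
  have [_ -> _] := eigen_minus (Af k); have [_ -> _] := eigen_minus (Af l).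
  rewrite !(mulr0, subr0, addr0, add0r, oppr0) !B1 => /eqP; rewrite mulf_eq0 (negbTE s0)/=.
  by rewrite !mulrN subr_eq0 => /eqP/oppr_inj.
(* Contraction of [H1] with [V3], on which [th1] is 1. *)
have c1 k : pr G (A k) (V i2) = th i1 k * \sum_l V i3 0 l * pr G (A l) (V i2).
  have g31 : pr G (V i3) (V i1) = 1 by rewrite gram.
  rewrite -[LHS]mul1r -g31 -pr_delta_sum mulr_suml mulr_sumr.
  by apply: eq_bigr => l _; rewrite -mulrA H1 mulrCA.
have c2 k : pr G (A k) (V i2) = th i2 k * \sum_l V i4 0 l * pr G (A l) (V i2).
  have g42 : pr G (V i4) (V i2) = 1 by rewrite gram.
  rewrite -[LHS]mul1r -g42 -pr_delta_sum mulr_suml mulr_sumr.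
  by apply: eq_bigr => l _; rewrite -mulrA H2 mulrCA.
rewrite c1; under eq_bigr do rewrite c2 mulrA.
by rewrite -mulr_suml pr_delta_sum gram/= mul0r mulr0.
Qed.

(** Once [beta] vanishes, [A = alpha (x) V1], and the exterior derivative of [th1] contributes the
    same wedge of [alpha] and [th1] as the remaining terms. The Codazzi equation paired with [V3] is
    twice this wedge, so [alpha] is the multiple [alpha(V3) th1]. *)
Lemma codazzi_A i : A i = ((\sum_k V i3 0 k * pr G (A k) (V i3)) * th i1 i) *: V i1
                    /\ D1 i i = 0.
Proof.
have AE k : A k = pr G (A k) (V i3) *: V i1.
  rewrite [LHS]frame_expand codazzi_beta; have [-> -> ->] := eigen_minus (Af k).
  by rewrite !scale0r !(addr0, add0r).
have D1' k l : D1 k l = th i1 l * pr G (A k) (V i3) - th i1 k * pr G (A l) (V i3).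
  by rewrite D1E {1}(AE k) {1}(AE l) !prZr; congr (_ - _); exact: mulrC.
have H k l : th i1 l * pr G (A k) (V i3) = th i1 k * pr G (A l) (V i3).
  have := codazzi_pair k l i3; rewrite !gram/= D1'.
  have [_ _ ->] := eigen_plus (Bf k); have [_ _ ->] := eigen_plus (Bf l).
  by rewrite !(mulr0, subr0, addr0, oppr0, mulr1); lra.
split; last by rewrite D1' subrr.
rewrite {1}AE; congr (_ *: _).
have g31 : pr G (V i3) (V i1) = 1 by rewrite gram.
rewrite -[LHS]mul1r -g31 -pr_delta_sum !mulr_suml.
apply: eq_bigr => l _; transitivity (V i3 0 l * (th i1 l * pr G (A i) (V i3))); first by ring.
rewrite (H i l); ring.
Qed.

Lemma codazzi_D1 i j : D1 i j = 0.
Proof.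
rewrite D1E (codazzi_A i).1 (codazzi_A j).1 !prZr; ring.
Qed.

Lemma codazzi_B i : B i = ((\sum_k V i4 0 k * pr G (B k) (V i4)) * th i2 i) *: V i2.
Proof.
have BE k : B k = pr G (B k) (V i4) *: V i2.
  rewrite [LHS]frame_expand (prC gs (B k) (V i1)).
  have := AB k; rewrite codazzi_beta add0r => ->.
  have [-> -> ->] := eigen_plus (Bf k).
  by rewrite !scale0r !(addr0, add0r).
have D2' k l : D2 k l = th i2 l * pr G (B k) (V i4) - th i2 k * pr G (B l) (V i4).
  by rewrite D2E {1}(BE k) {1}(BE l) !prZr; congr (_ - _); exact: mulrC.
have H k l : th i2 l * pr G (B k) (V i4) = th i2 k * pr G (B l) (V i4).
  have := codazzi_pair k l i4; rewrite !gram/= D2'.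
  have [_ _ ->] := eigen_minus (Af k); have [_ _ ->] := eigen_minus (Af l).
  rewrite !(mulr0, subr0, addr0, oppr0, add0r, mulr1) => /eqP; rewrite mulf_eq0 (negbTE s0)/=.
  by move=> /eqP; lra.
rewrite {1}BE; congr (_ *: _).
have g42 : pr G (V i4) (V i2) = 1 by rewrite gram.
rewrite -[LHS]mul1r -g42 -pr_delta_sum !mulr_suml.
apply: eq_bigr => l _; transitivity (V i4 0 l * (th i2 l * pr G (B i) (V i4))); first by ring.
rewrite (H i l); ring.
Qed.

Lemma codazzi_D2 i j : D2 i j = 0.
Proof.
rewrite D2E (codazzi_B i) (codazzi_B j) !prZr; ring.
Qed.

End Codazzi.

(** * Bianchi and Einstein identities, with [da], [dc] the differentials of [a], [c] *)

Section Curvature.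
Variables (K : 'I_5 -> 'I_5 -> 'M[R]_5) (da dc : 'I_5 -> R) (r : R).
Notation th a j := (pr G (delta_mx 0 j) (V a)).
Hypotheses (kskew : forall i j, K i j *m G + (K i j *m G)^T = 0)
  (kanti : forall i j, K j i = - K i j)
  (bianchi : forall i j k, row k (K i j) + row i (K j k) + row j (K k i) = 0)
  (V0K : forall i j, V i0 *m K i j = 0)
  (V1K : forall i j, V i1 *m K i j = (da i * th i1 j - da j * th i1 i) *: V i1)
  (V2K : forall i j, V i2 *m K i j = (dc i * th i2 j - dc j * th i2 i) *: V i2).

Definition Rm (u v : E) : 'M[R]_5 := \sum_i \sum_j (u 0 i * v 0 j) *: K i j.
Notation dd d u := (\sum_i u 0 i * d i).

Hypothesis einstein : forall u w : E,
  \sum_k (w *m Rm (delta_mx 0 k) u) 0 k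
  = r / 4 * (pr G u w - pr G u (V i0) * pr G w (V i0)).

Lemma Rm_mul (w u v : E) : w *m Rm u v = \sum_i \sum_j (u 0 i * v 0 j) *: (w *m K i j).
Proof.
rewrite /Rm mulmx_sumr; apply: eq_bigr => i _; rewrite mulmx_sumr.
by apply: eq_bigr => j _; rewrite scalemxAr.
Qed.

Lemma Rm_skew X Y u v : pr G (X *m Rm u v) Y = - pr G (Y *m Rm u v) X.
Proof.
rewrite !Rm_mul !pr_suml -sumrN; apply: eq_bigr => i _.
rewrite !pr_suml -sumrN; apply: eq_bigr => j _; rewrite !prZl -mulrN; congr (_ * _).
by rewrite /pr -(mulmxA X) -(mulmxA Y); exact: pr_skew.
Qed.

Lemma Rm_anti u v : Rm v u = - Rm u v.
Proof.
rewrite /Rm exchange_big/= -sumrN; apply: eq_bigr => i _; rewrite -sumrN.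
by apply: eq_bigr => j _; rewrite kanti scalerN mulrC.
Qed.

Lemma Rm_diag u : Rm u u = 0.
Proof.
have := Rm_anti u u => /eqP; rewrite -addr_eq0 => /eqP/matrixP H.
by apply/matrixP => i j; have := H i j; rewrite !mxE; lra.
Qed.

Lemma Rm_bianchi u v w z :
  pr G (w *m Rm u v) z + pr G (u *m Rm v w) z + pr G (v *m Rm w u) z = 0.
Proof.
pose T i j k := pr G (row k (K i j)) z.
have H u' v' w' : pr G (w' *m Rm u' v') z = tri T u' v' w'.
  rewrite Rm_mul pr_suml; apply: eq_bigr => i _; rewrite pr_suml; apply: eq_bigr => j _.
  rewrite prZl mulmx_sum_row pr_suml mulr_sumr; apply: eq_bigr => k _.
  by rewrite prZl mulrA.
rewrite !H; apply: tri_cyclic => i j k.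
by rewrite /T -!prDl bianchi pr0l.
Qed.

Lemma Rm_eigen d a (X : E) u v :
  (forall i j, X *m K i j = (d i * th a j - d j * th a i) *: X) ->
  X *m Rm u v = (dd d u * pr G v (V a) - dd d v * pr G u (V a)) *: X.
Proof.
move=> XK; have thE w : pr G w (V a) = \sum_j w 0 j * th a j by rewrite pr_delta_sum.
rewrite Rm_mul.
under eq_bigr do under eq_bigr do rewrite XK scalerA.
under eq_bigr do rewrite -scaler_suml.
rewrite -scaler_suml; congr (_ *: _).
rewrite !thE mulr_suml [X in _ - X]mulrC mulr_suml -sumrB; apply: eq_bigr => i _.
rewrite !mulr_sumr -sumrB; apply: eq_bigr => j _; ring.
Qed.

Lemma Rm_V0 u v : V i0 *m Rm u v = 0.
Proof.
by rewrite Rm_mul big1// => i _; rewrite big1// => j _; rewrite V0K scaler0.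
Qed.

Lemma Rm_self X u v : pr G (X *m Rm u v) X = 0.
Proof. by have := Rm_skew X X u v; lra. Qed.

Lemma dd_delta d k : dd d (delta_mx 0 k : E) = d k.
Proof.
rewrite (bigD1 k)//= big1 ?addr0 => [|j jk]; first by rewrite mxE !eqxx mul1r.
by rewrite mxE (negbTE jk) andbF mul0r.
Qed.

(** For the two zeros, the Bianchi identity on [(V0, V3, V1)] and on [(V2, V3, V1)] is paired with
    [V3]: the curvature kills [V0], maps [V2] to a multiple of itself orthogonal to [V3], and is
    skew, so only one term survives. The last value is the Ricci trace at [(V3, V1)], in which
    [da(V3)] is multiplied by [th1(V1) = 0]. *)
Lemma curvature_da : [/\ dd da (V i0) = 0, dd da (V i2) = 0 & dd da (V i1) = r / 4].
Proof.
split.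
- have := Rm_bianchi (V i0) (V i3) (V i1) (V i3).
  rewrite (Rm_eigen _ _ V1K) Rm_V0 pr0l Rm_self prZl !gram/=.
  by rewrite !(mulr1, mulr0, subr0, addr0).
- have := Rm_bianchi (V i2) (V i3) (V i1) (V i3).
  rewrite (Rm_eigen _ _ V1K) (Rm_eigen _ _ V2K) Rm_self !prZl !gram/=.
  by rewrite !(mulr1, mulr0, subr0, addr0).
- have := einstein (V i3) (V i1); rewrite !gram/= mul0r subr0 mulr1 => <-.
  under [RHS]eq_bigr do rewrite (Rm_eigen _ _ V1K) gram/= mulr1 dd_delta mxE mulrBl.
  rewrite sumrB; under [X in _ = _ - X]eq_bigr do rewrite -mulrA [_ * V i1 0 _]mulrC.
  rewrite -mulr_sumr pr_delta_sum gram/= mulr0 subr0.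
  by apply: eq_bigr => k _; rewrite mulrC.
Qed.

Lemma curvature_dc : [/\ dd dc (V i0) = 0, dd dc (V i1) = 0 & dd dc (V i2) = r / 4].
Proof.
split.
- have := Rm_bianchi (V i0) (V i4) (V i2) (V i4).
  rewrite (Rm_eigen _ _ V2K) Rm_V0 pr0l Rm_self prZl !gram/=.
  by rewrite !(mulr1, mulr0, subr0, addr0).
- have := Rm_bianchi (V i1) (V i4) (V i2) (V i4).
  rewrite (Rm_eigen _ _ V1K) (Rm_eigen _ _ V2K) Rm_self !prZl !gram/=.
  by rewrite !(mulr1, mulr0, subr0, addr0).
- have := einstein (V i4) (V i2); rewrite !gram/= mul0r subr0 mulr1 => <-.
  under [RHS]eq_bigr do rewrite (Rm_eigen _ _ V2K) gram/= mulr1 dd_delta mxE mulrBl.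
  rewrite sumrB; under [X in _ = _ - X]eq_bigr do rewrite -mulrA [_ * V i2 0 _]mulrC.
  rewrite -mulr_sumr pr_delta_sum gram/= mulr0 subr0.
  by apply: eq_bigr => k _; rewrite mulrC.
Qed.

(** The trace computing [Ric(V4, V3) = 0] is taken in the frame. Only the terms of [V2] and [V3]
    survive: the latter is [da(V4)] by skewness, the former becomes [dc(V3)] by the Bianchi
    identity. *)
Lemma curvature_mixed : dd da (V i4) + dd dc (V i3) = 0.
Proof.
have := einstein (V i4) (V i3); rewrite !gram/= mul0r subr0 mulr0 => H.
(* The matrix of [Z |-> R(Z, V4) V3]. *)
pose M : 'M[R]_5 := \matrix_k (V i3 *m Rm (delta_mx 0 k) (V i4)).
have MV v : v *m M = V i3 *m Rm v (V i4).
  rewrite mulmx_sum_row {2}[v]row_sum_delta.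
  rewrite Rm_mul.
  under eq_bigr do rewrite rowK Rm_mul scaler_sumr.
  rewrite exchange_big/=; apply: eq_bigr => i _.
  under eq_bigr do rewrite scaler_sumr.
  rewrite exchange_big/=; apply: eq_bigr => j _.
  under eq_bigr do rewrite scalerA mulrA.
  rewrite -scaler_suml -mulr_suml; congr ((_ * _) *: _).
  by rewrite summxE; apply: eq_bigr => k _; rewrite [RHS]mxE.
have trM : \tr M = 0.
  by rewrite -[RHS]H; apply: eq_bigr => k _; rewrite mxE.
move: trM; rewrite frame_trace !MV Rm_self Rm_diag mulmx0 pr0l.
rewrite Rm_skew Rm_V0 pr0l oppr0 add0r addr0.
rewrite (Rm_skew (V i3) (V i1)) (Rm_eigen _ _ V1K) prZl !gram/=.
have := Rm_bianchi (V i2) (V i4) (V i3) (V i4).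
rewrite (Rm_eigen _ _ V2K) Rm_self prZl !gram/=.
rewrite !(mulr1, mulr0, subr0, sub0r, addr0, add0r); lra.
Qed.

End Curvature.

End FrameAlgebra.

(** * Covariant form of the closedness of the fundamental form *)

Section FundamentalForm.
Context {R : realType} {n : nat}.
Notation E := ('rV[R]_n.+1).
Variables (U : set E) (S : pc_data R n).
Hypotheses (oU : open U) (apc : almost_paracosymplectic U S).
Notation g := (pc_g S).
Notation f := (pc_phi S).

Let pcS : almost_paracontact_metric U S. Proof. by case: apc. Qed.
Let rG : pseudo_riemannian U g. Proof. by case: (paracontact_smooth pcS). Qed.
Let sf : smooth_mx U f. Proof. by case: (paracontact_smooth pcS). Qed.
Let gs x : U x -> (g x)^T = g x. Proof. by move=> /rG.2[]. Qed.

Lemma pr_leibniz i (Y Z : E -> E) x : U x -> mxdiff Y x -> mxdiff Z x ->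
  partial i (fun y => pr (g y) (Y y) (Z y)) x
  = pr (g x) (nab g i Y x) (Z x) + pr (g x) (Y x) (nab g i Z x).
Proof.
move=> Ux dY dZ.
have /matrixP/(_ 0 0) := metric_leibniz oU rG i Ux dY dZ.
by rewrite dmxE [RHS]mxE.
Qed.

Lemma fundamental_formE x : fundamental_form S x = f x *m g x.
Proof.
apply/matrixP => i j; rewrite mxE /met /phi /ebase -rowE -row_mul trmx_delta -colE.
by rewrite [LHS]mxE [LHS]mxE.
Qed.

Lemma skew_derivative_algebra m (cF G A F : 'M[R]_m) :
  (F *m G)^T = - (F *m G) -> G^T = G ->
  (cF + A *m F - F *m A) *m G + F *m (A *m G + (A *m G)^T)
  = cF *m G + (A *m (F *m G) - (A *m (F *m G))^T).
Proof.
move=> skw gsym.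
rewrite [in RHS]trmx_mul skw trmx_mul gsym.
rewrite !(mulmxDl, mulmxDr, mulNmx, mulmxN, opprK, mulmxA).
move: (cF *m G) (A *m F *m G) (F *m A *m G) (F *m G *m A^T) => a b c d.
by apply/matrixP => i j; rewrite !mxE; ring.
Qed.

Lemma dmx_fundamental i x : U x ->
  dmx i (fun y => f y *m g y) x = covF g f i x *m g x
   + (Gam g i x *m (f x *m g x) - (Gam g i x *m (f x *m g x))^T).
Proof.
move=> Ux; have [_ _ skw] := paracontact_phi pcS Ux.
rewrite (dmxM i (smooth_mxdiff sf Ux) (smooth_mxdiff rG.1 Ux)).2 (metric_compat oU rG i Ux).
have -> : dmx i f x = covF g f i x + Gam g i x *m f x - f x *m Gam g i x.
  by rewrite /covF subrK addrK.
exact: skew_derivative_algebra skw (gs Ux).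
Qed.

Lemma covF_skew i x : U x -> (covF g f i x *m g x)^T = - (covF g f i x *m g x).
Proof.
move=> Ux; have H := dmx_fundamental i Ux.
have T : (dmx i (fun y => f y *m g y) x)^T = - dmx i (fun y => f y *m g y) x.
  have sfg : smooth_mx U (fun y => f y *m g y) by apply: smooth_mxM => //; exact: rG.1.
  rewrite -dmxT -(dmxN i (smooth_mxdiff sfg Ux)).
  apply: (dmx_ext i oU Ux) => y Uy.
  by have [_ _] := paracontact_phi pcS Uy.
move: T; rewrite H; move: (covF _ _ _ _ *m _) (Gam _ _ _ *m _) => A B T.
have tD (M N : 'M[R]_n.+1) : (M + N)^T = M^T + N^T by rewrite linearD.
have tN (M : 'M[R]_n.+1) : (- M)^T = - M^T by rewrite linearN.
move: T; rewrite !(tD, tN) trmxK => /matrixP T; apply/matrixP => j k.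
by have := T j k; rewrite !mxE; lra.
Qed.

(** For a torsion-free connection the Christoffel terms cancel in the cyclic sum, so the exterior
    derivative can be computed with [nabla] in place of partial derivatives. *)
Lemma covF_cyclic i j k x : U x ->
  (covF g f i x *m g x) j k + (covF g f j x *m g x) k i + (covF g f k x *m g x) i j = 0.
Proof.
move=> Ux; have [_ _ /(_ x Ux i j k)] := apc.
have E1 a b c : partial a (fun y => fundamental_form S y b c) x
   = (covF g f a x *m g x) b c + ((Gam g a x *m (f x *m g x)) b c
      - (Gam g a x *m (f x *m g x)) c b).
  rewrite -dmxE (_ : fundamental_form S = fun y => f y *m g y); last first.
    by apply/funext => y; exact: fundamental_formE.
  rewrite dmx_fundamental//.
  move: (covF _ _ _ _ *m _) (Gam _ _ _ *m _) => A B.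
  by rewrite !mxE.
rewrite !E1.
have SS a b c : (Gam g a x *m (f x *m g x)) b c = (Gam g b x *m (f x *m g x)) a c.
  by apply: mulmx_row_eq => m; exact: (Gam_sym oU rG).
rewrite (SS i j k) (SS j k i) (SS k i j).
move: ((covF _ _ _ _ *m _) j k) ((covF _ _ _ _ *m _) k i) ((covF _ _ _ _ *m _) i j).
move=> a b c; move: ((Gam _ j _ *m _) i k) ((Gam _ i _ *m _) k j) ((Gam _ k _ *m _) j i).
by move=> a' b' c'; lra.
Qed.

Lemma cov_form_cyclic (u v w : E) x : U x ->
  pr (g x) (v *m covFAt g f u x) w + pr (g x) (w *m covFAt g f v x) u
   + pr (g x) (u *m covFAt g f w x) v = 0.
Proof.
move=> Ux; pose T i j k := (covF g f i x *m g x) j k.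
have H a b c : pr (g x) (b *m covFAt g f a x) c = tri T a b c.
  rewrite /pr /covFAt mulmx_sumr !mulmx_suml summxE; apply: eq_bigr => i _.
  rewrite -scalemxAr -!scalemxAl mxE -(mulmxA b) -/(pr (covF g f i x *m g x) b c).
  rewrite pr_sum2 mulr_sumr; apply: eq_bigr => j _; rewrite mulr_sumr.
  by apply: eq_bigr => k _; rewrite !mulrA.
rewrite !H; apply: tri_cyclic => i j k; exact: covF_cyclic.
Qed.

Lemma cov_form_skew (u v w : E) x : U x ->
  pr (g x) (v *m covFAt g f u x) w = - pr (g x) (w *m covFAt g f u x) v.
Proof.
move=> Ux; rewrite /covFAt !mulmx_sumr !pr_suml -sumrN; apply: eq_bigr => i _.
rewrite -!scalemxAr !prZl -mulrN; congr (_ * _).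
rewrite /pr -(mulmxA v) -(mulmxA w); apply: pr_skew.
by rewrite covF_skew// subrr.
Qed.

End FundamentalForm.

Section CurvatureConditions.
Context {R : realType}.
Notation E := ('rV[R]_5).
Variables (U : set E) (S : pc_data R 4).
Hypotheses (oU : open U) (pcS : almost_paracontact_metric U S).
Notation g := (pc_g S).
Notation f := (pc_phi S).

Let rG : pseudo_riemannian U g. Proof. by case: (paracontact_smooth pcS). Qed.

Lemma curvature_const (u v : E) (Z : E -> E) x : U x -> smooth_mx U Z ->
  curvature g (fun=> u) (fun=> v) Z x = Z x *m Rm (fun i j => curvmx g i j x) u v.
Proof.
move=> Ux sZ; rewrite (curvatureE oU rG Ux _ _ sZ); [|exact: smooth_mx_cst..].
by rewrite Rm_mul.
Qed.

Lemma Rm_delta (K : 'I_5 -> 'I_5 -> 'M[R]_5) i j :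
  Rm K (delta_mx 0 i) (delta_mx 0 j) = K i j.
Proof.
rewrite /Rm (bigD1 i)//= [X in _ + X]big1 ?addr0 => [|k ki].
  rewrite (bigD1 j)//= [X in _ + X]big1 ?addr0 => [|k kj].
    by rewrite !mxE !eqxx mulr1 scale1r.
  by rewrite !mxE (negbTE kj) andbF mulr0 scale0r.
by rewrite big1// => l _; rewrite mxE (negbTE ki) andbF mul0r scale0r.
Qed.

Lemma weakly_paracosymplectic_curvmx x i j : weakly_paracosymplectic U S -> U x ->
  f x *m curvmx g i j x = curvmx g i j x *m f x.
Proof.
move=> [_ H] Ux; apply: mulmx_row_ext => v.
have [sf _ _ _] := paracontact_smooth pcS.
have sv := smooth_mx_cst v oU.
have := H _ _ _ (smooth_mx_cst (delta_mx 0 i) oU) (smooth_mx_cst (delta_mx 0 j) oU) sv x Ux.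
rewrite (curvature_const _ _ Ux sv) curvature_const//; last exact: smooth_mxM.
by rewrite Rm_delta /phi !mulmxA.
Qed.

Lemma eta_einstein_curvmx r0 x (u w : E) : eta_einstein U S -> scal g x = r0 -> U x ->
  \sum_k (w *m Rm (fun i j => curvmx g i j x) (delta_mx 0 k) u) 0 k
  = r0 / 4 * (pr (g x) u w - pr (g x) u (pc_xi S x) * pr (g x) w (pc_xi S x)).
Proof.
move=> H sx Ux; have sw := smooth_mx_cst w oU.
have := H _ _ (smooth_mx_cst u oU) sw x Ux; rewrite sx /Ric /met.
have [_ _ _ eE _] := paracontact_matrix pcS Ux.
have etaE X : Defs.eta S x X = pr (g x) X (pc_xi S x) by rewrite /Defs.eta eE mulmxA.
rewrite !etaE => <-; apply: eq_bigr => k _.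
by rewrite curvature_const.
Qed.

End CurvatureConditions.

(** * Structure equations of an adopted frame *)

Section AdoptedFrame.
Context {R : realType}.
Notation E := ('rV[R]_5).
Variables (U W : set E) (S : pc_data R 4) (sigma r0 : R) (V : 'I_5 -> E -> E).
Notation g := (pc_g S).
Notation f := (pc_phi S).
Notation xi := (pc_xi S).
Notation K x i j := (curvmx g i j x).
Notation th a j x := (pr (g x) (delta_mx 0 j) (V a x)).
Hypotheses (oU : open U) (apc : almost_paracosymplectic U S)
  (Kf : forall x i j, U x -> f x *m K x i j = K x i j *m f x)
  (LC : forall x, U x -> leaf_condition S x)
  (ein : forall x (u w : E), U x ->
    \sum_k (w *m Rm (fun i j => K x i j) (delta_mx 0 k) u) 0 k
    = r0 / 4 * (pr (g x) u w - pr (g x) u (xi x) * pr (g x) w (xi x)))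
  (oW : open W) (WU : W `<=` U) (s0 : sigma != 0) (fr : adopted_frame sigma S W V).

Let pcS : almost_paracontact_metric U S. Proof. by case: apc. Qed.
Let rG : pseudo_riemannian U g. Proof. by case: (paracontact_smooth pcS). Qed.
Let sf : smooth_mx U f. Proof. by case: (paracontact_smooth pcS). Qed.
Let sxi : smooth_mx U xi. Proof. by case: (paracontact_smooth pcS). Qed.
Let gs x : W x -> (g x)^T = g x. Proof. by move=> /WU/rG.2[]. Qed.
Let ug x : W x -> g x \in unitmx. Proof. by move=> /WU/rG.2[]. Qed.
Let sV a : smooth_mx W (V a). Proof. by case: fr. Qed.
Let sgW : smooth_mx W g. Proof. exact: smooth_mx_sub WU rG.1. Qed.
Let rGW : pseudo_riemannian W g. Proof. by split=> // x /WU/rG.2. Qed.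

Let gram x : W x -> forall i j, pr (g x) (V i x) (V j x) =
  if (i, j) \in [:: (i0, i0); (i1, i3); (i3, i1); (i2, i4); (i4, i2)] then 1 else 0.
Proof. by case: fr => _ _ H Wx i j; have [_ _ _] := H x Wx; exact. Qed.

Let V0E x : W x -> V i0 x = xi x.
Proof. by case: fr => _ _ H Wx; have [] := H x Wx. Qed.

Let V1f x : W x -> V i1 x *m f x = - V i1 x.
Proof. by case: fr => _ [_ _ H] _ Wx; have [_] := H x Wx. Qed.
Let V2f x : W x -> V i2 x *m f x = V i2 x.
Proof. by case: fr => _ [_ _ H] _ Wx; have [_ _] := H x Wx. Qed.
Let V3f x : W x -> V i3 x *m f x = V i3 x.
Proof. by case: fr => _ _ H Wx; have [_] := H x Wx. Qed.
Let V4f x : W x -> V i4 x *m f x = - V i4 x.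
Proof. by case: fr => _ _ H Wx; have [_ _] := H x Wx. Qed.

Let dVx a x : W x -> mxdiff (V a) x. Proof. by move=> Wx; exact: smooth_mxdiff (sV a) Wx. Qed.

Lemma smooth_pr (Y Z : E -> E) : smooth_mx W Y -> smooth_mx W Z ->
  smooth W (fun y => pr (g y) (Y y) (Z y)).
Proof.
move=> sY sZ; have H := smooth_mxM oW (smooth_mxM oW sY sgW) (smooth_mxT oW sZ).
exact: (H 0 0).
Qed.

Lemma smooth_th a j : smooth W (fun y => th a j y).
Proof. by apply: smooth_pr; [exact: smooth_mx_cst|exact: sV]. Qed.

Lemma nab_V0 i x : W x -> nab g i (V i0) x = - (th i1 i x *: V i1 x + sigma *: (th i2 i x *: V i2 x)).
Proof.
move=> Wx; rewrite (nab_ext g oW i Wx V0E).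
case: fr => _ [_ _ H] _; have [_ _ _ _ /(_ (delta_mx 0 i))] := H x Wx.
rewrite /shape_op scale1r => <-; rewrite opprK.
by rewrite -nabla_ebase//; exact: smooth_mxdiff sxi (WU Wx).
Qed.

(** Differentiating [phi xi = 0] gives [(nabla phi) xi = - phi (nabla xi)], and [nabla xi] is the
    shape operator up to sign. *)
Lemma xi_covF (u : E) x : W x ->
  V i0 x *m covFAt g f u x = - pr (g x) u (V i1 x) *: V i1 x
    + sigma *: (pr (g x) u (V i2 x) *: V i2 x).
Proof.
move=> Wx; rewrite /covFAt mulmx_sumr.
have E1 i : V i0 x *m covF g f i x = - th i1 i x *: V i1 x + sigma *: (th i2 i x *: V i2 x).
  have H := nabM g i (dVx i0 Wx) (smooth_mxdiff sf (WU Wx)).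
  have Z : nab g i (fun y => V i0 y *m f y) x = 0.
    rewrite (nab_ext (H := fun=> 0) g oW i Wx); first by rewrite /nab dmx_cst mul0mx addr0.
    by move=> y Wy; rewrite V0E//; have [] := paracontact_phi pcS (WU Wy).
  move: H; rewrite Z nab_V0// mulNmx mulmxDl -!scalemxAl V1f// V2f// => /esym/eqP.
  rewrite addrC subr_eq0 => /eqP ->.
  by rewrite scalerN scaleNr.
under eq_bigr do rewrite -scalemxAr E1 scalerDr !scalerA.
rewrite big_split/=; congr (_ + _).
  rewrite -(pr_delta_sum (gs Wx)) scaleNr scaler_suml -sumrN; apply: eq_bigr => i _.
  by rewrite mulrN scaleNr.
rewrite -(pr_delta_sum (gs Wx)) scalerA mulr_sumr scaler_suml; apply: eq_bigr => i _.
by congr (_ *: _); ring.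
Qed.

Lemma eta_pr x (u : E) : W x -> u *m pc_eta S x = 0 <-> pr (g x) u (V i0 x) = 0.
Proof.
move=> Wx; have [_ _ _ eE _] := paracontact_matrix pcS (WU Wx).
rewrite /pr V0E// -mulmxA -eE; split=> [->|H]; first by rewrite mxE.
by apply/matrixP => i j; rewrite !ord1 H mxE.
Qed.

(** Direction and test vector are split along [xi] and the kernel of [eta]. The leaf condition
    covers the tangential part, [xi_covF] the test vector [xi]. For the direction [xi], the cyclic
    identity reduces to two terms that cancel, since [g((nabla_b phi) xi, c)] is symmetric in [b]
    and [c]; hence [nabla_xi phi = 0]. *)
Lemma eigen_covF a (u : E) x : W x -> a = i1 \/ a = i2 -> V a x *m covFAt g f u x = 0.
Proof.
move=> Wx ai; have G := gram Wx.
have [Ga0 Ga1 Ga2] : [/\ pr (g x) (V a x) (V i0 x) = 0, pr (g x) (V a x) (V i1 x) = 0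
   & pr (g x) (V a x) (V i2 x) = 0] by case: ai => ->; rewrite !G.
have covD (v w : E) : covFAt g f (v + w) x = covFAt g f v x + covFAt g f w x.
  rewrite /covFAt -big_split; apply: eq_bigr => i _ /=.
  by rewrite mxE scalerDl.
have covZ c (v : E) : covFAt g f (c *: v) x = c *: covFAt g f v x.
  rewrite /covFAt scaler_sumr; apply: eq_bigr => i _.
  by rewrite mxE scalerA.
have A1 (v : E) : pr (g x) (V i0 x *m covFAt g f v x) (V a x) = 0.
  by rewrite xi_covF// prDl !prZl !(prC (gs Wx) _ (V a x)) Ga1 Ga2 !mulr0 addr0.
have A2 (b c : E) : pr (g x) (b *m covFAt g f (V i0 x) x) c = 0.
  have := cov_form_cyclic oU apc (V i0 x) b c (WU Wx).
  rewrite (cov_form_skew oU apc b c (V i0 x) (WU Wx)) !xi_covF//.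
  rewrite !(prDl, prZl) !(prC (gs Wx) (V _ x)) => H.
  by move: H; lra.
apply: (frame_eq0 (ug Wx) G) => b.
set u0 := pr (g x) u (V i0 x); set b0 := pr (g x) (V b x) (V i0 x).
have -> : u = (u - u0 *: V i0 x) + u0 *: V i0 x by rewrite subrK.
rewrite covD mulmxDr prDl covZ -scalemxAr prZl A2 mulr0 addr0.
have -> : V b x = (V b x - b0 *: V i0 x) + b0 *: V i0 x by rewrite subrK.
have G0 : pr (g x) (V i0 x) (V i0 x) = 1 by rewrite G.
rewrite prDr prZr (cov_form_skew oU apc _ _ (V i0 x) (WU Wx)) A1 oppr0 mulr0 addr0.
rewrite {1}/pr LC ?mxE//; first exact: WU.
- by apply/eta_pr => //; rewrite prDl prNl prZl G0 mulr1 subrr.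
- exact/eta_pr.
- by apply/eta_pr => //; rewrite prDl prNl prZl G0 mulr1 subrr.
Qed.

Lemma nab_eigen_minus i x : W x -> nab g i (V i1) x *m f x = - nab g i (V i1) x.
Proof.
move=> Wx; have H := nabM g i (dVx i1 Wx) (smooth_mxdiff sf (WU Wx)).
have E0 : V i1 x *m covF g f i x = 0.
  have := eigen_covF (delta_mx 0 i) Wx (or_introl (erefl i1)).
  rewrite /covFAt (bigD1 i)//= mxE !eqxx scale1r big1 ?addr0// => j ji.
  by rewrite mxE (negbTE ji) andbF scale0r.
rewrite -[LHS]addr0 -E0 -H -(nabN g i (dVx i1 Wx)).
exact: (nab_ext g oW i Wx V1f).
Qed.

Lemma nab_eigen_plus i x : W x -> nab g i (V i2) x *m f x = nab g i (V i2) x.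
Proof.
move=> Wx; have H := nabM g i (dVx i2 Wx) (smooth_mxdiff sf (WU Wx)).
have E0 : V i2 x *m covF g f i x = 0.
  have := eigen_covF (delta_mx 0 i) Wx (or_intror (erefl i2)).
  rewrite /covFAt (bigD1 i)//= mxE !eqxx scale1r big1 ?addr0// => j ji.
  by rewrite mxE (negbTE ji) andbF scale0r.
rewrite -[LHS]addr0 -E0 -H.
exact: (nab_ext g oW i Wx V2f).
Qed.

Lemma partial_pr a b i x : W x ->
  pr (g x) (nab g i (V a) x) (V b x) + pr (g x) (V a x) (nab g i (V b) x) = 0.
Proof.
move=> Wx; rewrite -(pr_leibniz oU apc i (WU Wx) (dVx a Wx) (dVx b Wx)).
have H : \near x, pr (g x) (V a x) (V b x) =
   if (a, b) \in [:: (i0, i0); (i1, i3); (i3, i1); (i2, i4); (i4, i2)] then 1 else 0.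
  by apply: filterS (open_near oW Wx) => y Wy; exact: gram.
by rewrite (near_eq_partial i H) partial_cst.
Qed.

Lemma exterior_th a i j x : W x ->
  partial i (fun y => th a j y) x - partial j (fun y => th a i y) x
  = pr (g x) (delta_mx 0 j) (nab g i (V a) x) - pr (g x) (delta_mx 0 i) (nab g j (V a) x).
Proof.
move=> Wx; have Ux := WU Wx.
have dc (k : 'I_5) : mxdiff (fun _ : E => delta_mx 0 k : E) x.
  by move=> r c; exact: differentiable_cst.
rewrite (pr_leibniz oU apc i Ux (dc j) (dVx a Wx)) (pr_leibniz oU apc j Ux (dc i) (dVx a Wx)).
have -> : nab g i (fun _ : E => delta_mx 0 j : E) x = nab g j (fun _ : E => delta_mx 0 i : E) x.
  rewrite /nab !dmx_cst !add0r -!rowE; apply/rowP => k; rewrite !mxE.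
  exact: (Gam_sym oU rG).
by rewrite opprD addrACA subrr add0r.
Qed.

(** The curvature commutes with [phi], so [R xi] lies in the kernel of [phi] and is a multiple of
    [xi]; skewness makes the multiple 0. *)
Lemma V0_curvmx i j x : W x -> V i0 x *m K x i j = 0.
Proof.
move=> Wx; have Ux := WU Wx; rewrite V0E//.
have [A1 A2 A3 A4 A5] := paracontact_matrix pcS Ux.
have [B1 B2 B3] := paracontact_phi pcS Ux.
have H : xi x *m K x i j *m f x = 0 by rewrite -mulmxA -Kf// mulmxA B1 mul0mx.
have := congr1 (mulmx^~ (f x)) H; rewrite mul0mx -(mulmxA _ (f x)) A1 mulmxBr mulmx1.
move=> /eqP; rewrite subr_eq0 => /eqP ->.
rewrite mulmxA (_ : xi x *m K x i j *m pc_eta S x = 0) ?mul0mx//.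
have := curvmx_skew oU rG i j Ux => sk.
have := pr_skew (xi x) (xi x) sk; rewrite /pr mulmxA -mulmxA -A4 => H2.
by apply/matrixP => a b; rewrite !ord1 [RHS]mxE; lra.
Qed.

Lemma codazzi_equation i j x : W x ->
  ((partial i (fun y => th i1 j y) x - partial j (fun y => th i1 i y) x) *: V i1 x
     + (th i1 j x *: nab g i (V i1) x - th i1 i x *: nab g j (V i1) x))
  + sigma *: ((partial i (fun y => th i2 j y) x - partial j (fun y => th i2 i y) x) *: V i2 x
     + (th i2 j x *: nab g i (V i2) x - th i2 i x *: nab g j (V i2) x)) = 0.
Proof.
move=> Wx; have := nab_commute oW rGW i j Wx (sV i0); rewrite V0_curvmx//.
have dth a k : differentiable (fun y => th a k y) x by exact: smooth_diff (smooth_th a k) _ Wx.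
have sthV a k : smooth_mx W (fun y => th a k y *: V a y).
  by apply: smooth_mxZ => //; exact: smooth_th.
have sthV2 k : smooth_mx W (fun y => sigma *: (th i2 k y *: V i2 y)).
  by apply: smooth_mxZ => //; exact: smooth_cst.
have E1 k l : nab g k (nab g l (V i0)) x
  = - ((partial k (fun y => th i1 l y) x *: V i1 x + th i1 l x *: nab g k (V i1) x)
     + sigma *: (partial k (fun y => th i2 l y) x *: V i2 x + th i2 l x *: nab g k (V i2) x)).
  rewrite (nab_ext g oW k Wx (nab_V0 l)).
  rewrite nabN; last exact: smooth_mxdiff (smooth_mxD oW (sthV i1 l) (sthV2 l)) Wx.
  rewrite nabD; [|exact: smooth_mxdiff (sthV i1 l) Wx|exact: smooth_mxdiff (sthV2 l) Wx].
  rewrite nabZ//; last exact: dVx.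
  rewrite (nabZ g k (f := fun=> sigma)); [|exact: differentiable_cst|exact: smooth_mxdiff (sthV i2 l) Wx].
  rewrite partial_cst scale0r add0r nabZ//; exact: dVx.
rewrite !E1.
move: (partial _ _ x) (partial _ _ x) (partial _ _ x) (partial _ _ x) => p1 p2 p3 p4.
move: (nab _ _ (V i1) x) (nab _ _ (V i1) x) (nab _ _ (V i2) x) (nab _ _ (V i2) x) => n1 n2 n3 n4.
move=> /matrixP H; apply/matrixP => a b; have := H a b.
rewrite !mxE => H0; rewrite -[RHS]oppr0 -H0; ring.
Qed.

Lemma sigma_codazzi x (Wx : W x) :
  let A i := nab g i (V i1) x in let B i := nab g i (V i2) x in
  [/\ forall i, A i = ((\sum_k V i3 x 0 k * pr (g x) (A k) (V i3 x)) * th i1 i x) *: V i1 x,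
      forall i, B i = ((\sum_k V i4 x 0 k * pr (g x) (B k) (V i4 x)) * th i2 i x) *: V i2 x,
      forall i j, partial i (fun y => th i1 j y) x - partial j (fun y => th i1 i y) x = 0
    & forall i j, partial i (fun y => th i2 j y) x - partial j (fun y => th i2 i y) x = 0].
Proof.
move=> A B; have Ux := WU Wx.
have [_ _ _ eE _] := paracontact_matrix pcS Ux; rewrite -V0E// in eE.
have [_ fe fskew] := paracontact_phi pcS Ux.
have AB i : pr (g x) (A i) (V i2 x) + pr (g x) (V i1 x) (B i) = 0 by exact: partial_pr.
have D1 i j := exterior_th i1 i j Wx.
have D2 i j := exterior_th i2 i j Wx.
have cod i j := codazzi_equation i j Wx.
have eA i := nab_eigen_minus i Wx.
have eB i := nab_eigen_plus i Wx.
have V1 := V1f Wx; have V2 := V2f Wx; have V3 := V3f Wx; have V4 := V4f Wx.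
have G := gram Wx; have gsx := gs Wx; have ugx := ug Wx.
split=> [i|i|i j|i j].
- exact: (codazzi_A gsx ugx G s0 fskew fe eE V1 V2 V3 V4 eA eB AB D1 cod i).1.
- exact: (codazzi_B gsx ugx G s0 fskew fe eE V1 V2 V3 V4 eA eB AB D2 cod i).
- exact: (codazzi_D1 gsx ugx G s0 fskew fe eE V1 V2 V3 V4 eA eB AB D1 cod i j).
- exact: (codazzi_D2 gsx ugx G s0 fskew fe eE V1 V2 V3 V4 eA eB AB D2 cod i j).
Qed.

(** This is [g(nabla_V3 V1, V3)], the function called [a] in the overview; [fc] is the corresponding
    [c]. *)
Definition fa x := \sum_k V i3 x 0 k * pr (g x) (nab g k (V i1) x) (V i3 x).
Definition fc x := \sum_k V i4 x 0 k * pr (g x) (nab g k (V i2) x) (V i4 x).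

Lemma smooth_fa : smooth W fa.
Proof.
apply: smooth_sum => // k; apply: smoothM => //; first exact: sV.
by apply: smooth_pr => //; apply: smooth_nab.
Qed.

Lemma smooth_fc : smooth W fc.
Proof.
apply: smooth_sum => // k; apply: smoothM => //; first exact: sV.
by apply: smooth_pr => //; apply: smooth_nab.
Qed.

Lemma nab_V1 i x : W x -> nab g i (V i1) x = (fa x * th i1 i x) *: V i1 x.
Proof. by move=> Wx; have [H _ _ _] := sigma_codazzi Wx; exact: H. Qed.

Lemma nab_V2 i x : W x -> nab g i (V i2) x = (fc x * th i2 i x) *: V i2 x.
Proof. by move=> Wx; have [_ H _ _] := sigma_codazzi Wx; exact: H. Qed.

Lemma closed_th a i j x : W x -> a = i0 \/ a = i1 \/ a = i2 ->
  partial i (fun y => th a j y) x = partial j (fun y => th a i y) x.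
Proof.
move=> Wx ai; apply/eqP; rewrite -subr_eq0; apply/eqP.
have [_ _ H1 H2] := sigma_codazzi Wx.
case: ai => [->|[->|->]]; [|exact: H1|exact: H2].
rewrite exterior_th// !nab_V0// !prNr !prDr !prZr; ring.
Qed.

(** If [nabla V = F th (x) V] with [th] closed, then the quadratic terms are symmetric in the two
    directions and only [dF /\ th] remains. *)
Lemma curvmx_eigen a (F : E -> R) i j x : W x -> smooth W F ->
  (forall k y, W y -> nab g k (V a) y = (F y * th a k y) *: V a y) ->
  (forall k l, partial k (fun y => th a l y) x = partial l (fun y => th a k y) x) ->
  V a x *m K x i j = (partial i F x * th a j x - partial j F x * th a i x) *: V a x.
Proof.
move=> Wx sF nV cl; rewrite -(nab_commute oW rGW i j Wx (sV a)).
have E1 k l : nab g k (nab g l (V a)) x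
   = (partial k F x * th a l x + F x * partial k (fun y => th a l y) x) *: V a x
     + (F x * th a l x) *: ((F x * th a k x) *: V a x).
  rewrite (nab_ext g oW k Wx (nV l)) nabZ; last exact: dVx.
    rewrite (nV k x Wx) partialM//; first exact: smooth_diff sF _ Wx.
    exact: smooth_diff (smooth_th a l) _ Wx.
  by apply: smooth_diff Wx; apply: smoothM => //; exact: smooth_th.
rewrite !E1 (cl j i).
move: (partial i F x) (partial j F x) (partial i _ x) (V a x) => p1 p2 p3 v.
by rewrite !scalerA -!scalerDl -scalerBl; congr (_ *: _); ring.
Qed.

Lemma curvmx_anti i j x : K x j i = - K x i j.
Proof.
rewrite /curvmx; move: (dmx _ _ x) (dmx _ _ x) (_ *m _) (_ *m _) => A B C D.
by apply/matrixP => a b; rewrite !mxE; ring.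
Qed.

Lemma frame_derivatives x : W x ->
  let da a := \sum_i V a x 0 i * partial i fa x in
  let dc a := \sum_i V a x 0 i * partial i fc x in
  [/\ [/\ da i0 = 0, da i2 = 0 & da i1 = r0 / 4],
      [/\ dc i0 = 0, dc i1 = 0 & dc i2 = r0 / 4] & da i4 + dc i3 = 0].
Proof.
move=> Wx da dc; have Ux := WU Wx; have G := gram Wx; have gsx := gs Wx; have ugx := ug Wx.
have ks i j := curvmx_skew oU rG i j Ux.
have ka i j := curvmx_anti i j x.
have kb i j k := curvmx_bianchi oU rG i j k Ux.
have k0 i j := V0_curvmx i j Wx.
have k1 i j := curvmx_eigen i j Wx smooth_fa nab_V1
  (fun k l => closed_th k l Wx (or_intror (or_introl (erefl i1)))).
have k2 i j := curvmx_eigen i j Wx smooth_fc nab_V2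
  (fun k l => closed_th k l Wx (or_intror (or_intror (erefl i2)))).
have e : forall u w : E, \sum_k (w *m Rm (fun i j => K x i j) (delta_mx 0 k) u) 0 k
    = r0 / 4 * (pr (g x) u w - pr (g x) u (V i0 x) * pr (g x) w (V i0 x)).
  by move=> u w; rewrite (V0E Wx); exact: ein.
split.
- exact: (curvature_da gsx G ks kb k0 k1 k2 e).
- exact: (curvature_dc gsx G ks kb k0 k1 k2 e).
- exact: (curvature_mixed gsx ugx G ks ka kb k0 k1 k2 e).
Qed.

(** As the pairings of frame vectors are constant, a derivative of [V a] paired with [V b] can be
    traded for one of [V b]. Thus [d th3] and [d th4] are accessible without [nabla V3] and
    [nabla V4]. *)
Lemma contract_exterior_th a b x : W x -> pr (g x) (V a x) (V a x) = 0 ->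
  \sum_i \sum_j (V b x 0 i * V a x 0 j) *
    (partial i (fun y => th a j y) x - partial j (fun y => th a i y) x)
  = \sum_j V a x 0 j * pr (g x) (nab g j (V b) x) (V a x).
Proof.
move=> Wx gaa; have gsx := gs Wx.
have H1 i : pr (g x) (V a x) (nab g i (V a) x) = 0.
  by have := partial_pr a a i Wx; rewrite (prC gsx (nab _ _ _ _)); lra.
have H2 j : pr (g x) (V b x) (nab g j (V a) x) = - pr (g x) (nab g j (V b) x) (V a x).
  by have := partial_pr b a j Wx; lra.
under eq_bigr do under eq_bigr do rewrite exterior_th// mulrBr.
under eq_bigr do rewrite sumrB.
rewrite sumrB [X in X - _]big1 ?sub0r => [|i _]; last first.
  under eq_bigr do rewrite -mulrA.
  by rewrite -mulr_sumr (pr_delta_sum gsx) H1 mulr0.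
rewrite exchange_big/= -sumrN; apply: eq_bigr => j _.
under eq_bigr do rewrite [_ * V a x 0 j]mulrC -mulrA.
by rewrite -mulr_sumr (pr_delta_sum gsx) H2 mulrN opprK.
Qed.

(** These numbers will be the derivatives of [u] along [V0], [V1], [V2]; the first is
    [- g(A V3, V3)]. *)
Lemma exterior_th3 x : W x ->
  let d b := \sum_i \sum_j (V b x 0 i * V i3 x 0 j) *
    (partial i (fun y => th i3 j y) x - partial j (fun y => th i3 i y) x) in
  [/\ d i0 = -1, d i1 = fa x & d i2 = 0].
Proof.
move=> Wx d; have G := gram Wx; have gsx := gs Wx.
have g33 : pr (g x) (V i3 x) (V i3 x) = 0 by rewrite G.
rewrite /d !contract_exterior_th//; split.
- under eq_bigr do rewrite nab_V0// prNl prDl !prZl !G/= mulr1 !mulr0 addr0 mulrN.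
  by rewrite sumrN (pr_delta_sum gsx) G.
- under eq_bigr do rewrite nab_V1// prZl G/= mulr1 mulrCA.
  by rewrite -mulr_sumr (pr_delta_sum gsx) G/= mulr1.
- by rewrite big1// => j _; rewrite nab_V2// prZl G/= !mulr0.
Qed.

Lemma exterior_th4 x : W x ->
  let d b := \sum_i \sum_j (V b x 0 i * V i4 x 0 j) *
    (partial i (fun y => th i4 j y) x - partial j (fun y => th i4 i y) x) in
  [/\ d i0 = - sigma, d i1 = 0 & d i2 = fc x].
Proof.
move=> Wx d; have G := gram Wx; have gsx := gs Wx.
have g44 : pr (g x) (V i4 x) (V i4 x) = 0 by rewrite G.
rewrite /d !contract_exterior_th//; split.
- under eq_bigr do rewrite nab_V0// prNl prDl !prZl !G/= mulr1 !mulr0 add0r mulrN mulrCA.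
  by rewrite sumrN -mulr_sumr (pr_delta_sum gsx) G/= mulr1.
- by rewrite big1// => j _; rewrite nab_V1// prZl G/= !mulr0.
- under eq_bigr do rewrite nab_V2// prZl G/= mulr1 mulrCA.
  by rewrite -mulr_sumr (pr_delta_sum gsx) G/= mulr1.
Qed.

End AdoptedFrame.

Section OpenNonzero.
Context {R : realType} {n : nat}.
Notation E := ('rV[R]_n.+1).

Lemma open_neq0 (W : set E) (h : E -> R) : open W -> smooth W h ->
  open [set y | W y /\ h y != 0].
Proof.
rewrite !openE => oW sh y [Wy hy]; apply: filterI; first exact: oW.
have oW' : open W by rewrite openE.
have h0 : 0 < `|h y| by rewrite normr_gt0.
by apply: filterS (smooth_near oW' sh Wy h0) => z; exact: norm_sub_lt_neq0.
Qed.

End OpenNonzero.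

(** * Construction of adopted frames *)

Section AdoptedFrames.
Context {R : realType}.
Notation E := ('rV[R]_5).
Variables (U : set E) (S : pc_data R 4) (sigma : R).
Notation g := (pc_g S).
Notation f := (pc_phi S).
Notation xi := (pc_xi S).
Hypotheses (oU : open U) (pcS : almost_paracontact_metric U S).

Let rG : pseudo_riemannian U g. Proof. by case: (paracontact_smooth pcS). Qed.
Let sf : smooth_mx U f. Proof. by case: (paracontact_smooth pcS). Qed.
Let sxi : smooth_mx U xi. Proof. by case: (paracontact_smooth pcS). Qed.

Lemma pr_phi x (X Y : E) : U x -> pr (g x) (X *m f x) Y = - pr (g x) X (Y *m f x).
Proof.
move=> Ux; have [_ _ skw] := paracontact_phi pcS Ux; have gs := (rG.2 x Ux).1.
have -> : pr (g x) X (Y *m f x) = (X *m (g x *m (f x)^T) *m Y^T) 0 0.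
  by rewrite /pr trmx_mul !mulmxA.
have -> : g x *m (f x)^T = - (f x *m g x) by rewrite -skw trmx_mul gs.
by rewrite /pr mulmxN mulNmx [in RHS]mxE opprK mulmxA.
Qed.

Lemma pr_minus x (X Y : E) : U x -> X *m f x = - X -> Y *m f x = - Y -> pr (g x) X Y = 0.
Proof.
by move=> Ux Xf Yf; have := pr_phi X Y Ux; rewrite Xf Yf prNl prNr; lra.
Qed.

Lemma pr_plus x (X Y : E) : U x -> X *m f x = X -> Y *m f x = Y -> pr (g x) X Y = 0.
Proof. by move=> Ux Xf Yf; have := pr_phi X Y Ux; rewrite Xf Yf; lra. Qed.

Lemma pr_xi x (X : E) : U x -> X *m f x = X \/ X *m f x = - X -> pr (g x) (xi x) X = 0.
Proof.
move=> Ux; have [xf _ _] := paracontact_phi pcS Ux.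
by have := pr_phi (xi x) X Ux; rewrite xf pr0l => H [] Xf; move: H; rewrite Xf ?prNr; lra.
Qed.

Definition mkframe (V0 V1 V2 V3 V4 : E -> E) (a : 'I_5) : E -> E :=
  match val a with 0%N => V0 | 1%N => V1 | 2%N => V2 | 3%N => V3 | _ => V4 end.

(** The other entries of the Gram matrix are automatic: eigenvectors of [phi] for the same
    eigenvalue are orthogonal, and all are orthogonal to [xi]. *)
Lemma mkframe_adopted (W : set E) (V1 V2 V3 V4 : E -> E) : open W -> W `<=` U ->
  shape_fields 1 sigma S W V1 V2 -> smooth_mx W V3 -> smooth_mx W V4 ->
  (forall x, W x -> [/\ V3 x *m f x = V3 x, V4 x *m f x = - V4 x,
     pr (g x) (V1 x) (V3 x) = 1, pr (g x) (V2 x) (V4 x) = 1 & pr (g x) (V3 x) (V4 x) = 0]) ->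
  adopted_frame sigma S W (mkframe xi V1 V2 V3 V4).
Proof.
move=> oW WU [s1 s2 sh] s3 s4 H; split=> //.
  by elim/ord5P => //=; exact: smooth_mx_sub WU sxi.
move=> x Wx; have Ux := WU _ Wx; have [V3f V4f g13 g24 g34] := H x Wx.
have [_ V1f V2f g12 _] := sh x Wx.
have gs := (rG.2 x Ux).1; have sym := prC gs.
have [_ B _ A _] := paracontact_matrix pcS Ux.
have g00 : pr (g x) (xi x) (xi x) = 1.
  by rewrite /pr -mulmxA -A B mxE.
have g01 := pr_xi Ux (or_intror V1f); have g02 := pr_xi Ux (or_introl V2f).
have g03 := pr_xi Ux (or_introl V3f); have g04 := pr_xi Ux (or_intror V4f).
have g11 := pr_minus Ux V1f V1f; have g14 := pr_minus Ux V1f V4f.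
have g44 := pr_minus Ux V4f V4f; have g22 := pr_plus Ux V2f V2f.
have g23 := pr_plus Ux V2f V3f; have g33 := pr_plus Ux V3f V3f.
split=> // i j.
elim/ord5P: i; elim/ord5P: j; rewrite /mkframe /=;
  by [|apply: etrans (sym _ _) _].
Qed.

(** [p] is the component of [w] in the eigenspace of [s]. Eigenvectors for [- s] do not see the
    discarded components. *)
Lemma eigen_projection x (w : E) (s : R) : U x -> s * s = 1 ->
  let p := 2^-1 *: (w *m f x *m f x + s *: (w *m f x)) in
  p *m f x = s *: p /\
  forall X, X *m f x = - s *: X -> pr (g x) X p = pr (g x) X w.
Proof.
move=> Ux ss p; have [A1 A2 A3 A4 A5] := paracontact_matrix pcS Ux.
have [xf fe skw] := paracontact_phi pcS Ux.
have fff : w *m f x *m f x *m f x = w *m f x.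
  by rewrite -mulmxA A1 mulmxBr mulmx1 mulmxA -(mulmxA w) fe mulmx0 mul0mx subr0.
split.
  rewrite /p -scalemxAl mulmxDl fff -scalemxAl !scalerDr !scalerA addrC.
  by congr (_ *: _ + _ *: _); [exact: mulrC|rewrite -[LHS]mul1r -ss; ring].
move=> X Xf; have ph Y : pr (g x) X (Y *m f x) = s * pr (g x) X Y.
  by have := pr_phi X Y Ux; rewrite Xf prZl; lra.
by rewrite /p prZr prDr prZr !ph !mulrA ss mul1r; lra.
Qed.

(** Constant vectors [w], [z] not orthogonal to [V1], [V2] at [x] are projected to the eigenspaces
    required of [V3], [V4] and normalized on the open set where the pairings stay non-zero. *)
Lemma adopted_frame_exists (W : set E) (V1 V2 : E -> E) x : open W -> W `<=` U -> W x ->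
  shape_fields 1 sigma S W V1 V2 ->
  exists W' V, [/\ open W', W' x, W' `<=` W & adopted_frame sigma S W' V].
Proof.
move=> oW WU Wx sh; have [s1 s2 H] := sh.
have sgW : smooth_mx W g := smooth_mx_sub WU rG.1.
have sfW : smooth_mx W f := smooth_mx_sub WU sf.
have nz (X : E) : X != 0 -> exists w, pr (g x) X w != 0.
  move=> X0; apply: contrapT => /forallNP no.
  move/eqP: X0; apply.
  have XG : X *m g x = 0.
    apply/rowP => j; rewrite [RHS]mxE; have /negP := no (delta_mx 0 j); rewrite negbK => /eqP.
    by rewrite /pr trmx_delta -colE [LHS]mxE.
  by have := congr1 (mulmx^~ (invmx (g x))) XG; rewrite mulmxK ?mul0mx// (rG.2 _ (WU _ Wx)).2.
have [[V10 V20] _ _ _ _] := H x Wx.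
have [w w0] := nz _ V10; have [z z0] := nz _ V20.
pose h1 y := pr (g y) (V1 y) w; pose h2 y := pr (g y) (V2 y) z.
have spr (Y Z : E -> E) : smooth_mx W Y -> smooth_mx W Z -> smooth W (fun y => pr (g y) (Y y) (Z y)).
  move=> sY sZ; have K := smooth_mxM oW (smooth_mxM oW sY sgW) (smooth_mxT oW sZ).
  exact: (K 0 0).
have sh1 : smooth W h1 by apply: spr => //; exact: smooth_mx_cst.
have sh2 : smooth W h2 by apply: spr => //; exact: smooth_mx_cst.
pose W1 := [set y | W y /\ h1 y != 0].
have oW1 : open W1 by exact: open_neq0.
have W1W : W1 `<=` W by move=> y [].
have sh2' : smooth W1 h2 by exact: smooth_sub sh2.
pose W' := [set y | W1 y /\ h2 y != 0].
have oW' : open W' by exact: open_neq0.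
have W'W : W' `<=` W by move=> y [/W1W].
have W'1 y : W' y -> h1 y != 0 by move=> [[]].
have W'2 y : W' y -> h2 y != 0 by move=> [].
pose proj (v : E) (s : R) y := 2^-1 *: (v *m f y *m f y + s *: (v *m f y)).
have sproj v s : smooth_mx W' (proj v s).
  have sv := smooth_mx_cst v oW'; have sf' := smooth_mx_sub W'W sfW.
  have svf := smooth_mxM oW' sv sf'.
  apply: smooth_mxZ => //; first exact: smooth_cst.
  apply: smooth_mxD => //; first exact: smooth_mxM.
  by apply: smooth_mxZ => //; exact: smooth_cst.
pose V3 y := (h1 y)^-1 *: proj w 1 y.
pose V4' y := (h2 y)^-1 *: proj z (-1) y.
(* The correction is a multiple of [V1], also an eigenvector for [-1] and orthogonal to [V2]; it
   only changes the pairing with [V3], which becomes 0. *)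
pose V4 y := V4' y - pr (g y) (V3 y) (V4' y) *: V1 y.
have s3 : smooth_mx W' V3.
  by apply: smooth_mxZ => //; apply: smoothV => //; exact: smooth_sub sh1.
have s4' : smooth_mx W' V4'.
  apply: smooth_mxZ => //; apply: smoothV => //.
  exact: smooth_sub W'W sh2.
have sg' := smooth_mx_sub W'W sgW; have s1' := smooth_mx_sub W'W s1.
have s34 : smooth W' (fun y => pr (g y) (V3 y) (V4' y)).
  have K := smooth_mxM oW' (smooth_mxM oW' s3 sg') (smooth_mxT oW' s4').
  exact: (K 0 0).
have s4 : smooth_mx W' V4.
  by apply: smooth_mxD => //; apply: smooth_mxN => //; exact: smooth_mxZ.
exists W', (mkframe xi V1 V2 V3 V4); split=> //.
apply: mkframe_adopted => //.
- by move=> y /W'W/WU.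
- split=> //; first exact: smooth_mx_sub W'W s2.
  by move=> y /W'W/H.
move=> y W'y; have Wy := W'W _ W'y; have Uy := WU _ Wy.
have [_ V1f V2f g12 _] := H y Wy; rewrite /phi in V1f V2f.
have gs := (rG.2 y Uy).1.
have [P3 Q3] := eigen_projection w Uy (mul1r 1).
have m1 : (-1) * (-1) = 1 :> R by rewrite mulrNN mul1r.
have [P4 Q4] := eigen_projection z Uy m1.
rewrite -/(proj w 1 y) scale1r in P3 Q3; rewrite -/(proj z (-1) y) scaleN1r in P4 Q4.
have V3f : V3 y *m f y = V3 y by rewrite /V3 -scalemxAl P3.
have V4'f : V4' y *m f y = - V4' y by rewrite /V4' -scalemxAl P4 scalerN.
have V4f : V4 y *m f y = - V4 y.
  by rewrite /V4 mulmxBl V4'f -scalemxAl V1f scalerN opprB opprK addrC.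
have g13 : pr (g y) (V1 y) (V3 y) = 1.
  by rewrite /V3 prZr Q3 ?scaleN1r// mulVf// W'1.
have g24' : pr (g y) (V2 y) (V4' y) = 1.
  by rewrite /V4' prZr Q4 ?opprK ?scale1r// mulVf// W'2.
split=> //.
- by rewrite /V4 prDr prNr prZr (prC gs (V2 y) (V1 y)) [pr _ (V1 y) (V2 y)]g12 mulr0 subr0.
- by rewrite /V4 prDr prNr prZr (prC gs (V3 y) (V1 y)) g13 mulr1 subrr.
Qed.

End AdoptedFrames.

(** * Canonical coordinates *)

Section NormalizedFrame.
Context {R : realType}.
Notation E := ('rV[R]_5).
Variables (U W : set E) (S : pc_data R 4) (sigma r0 : R).
Notation g := (pc_g S).
Notation f := (pc_phi S).
Notation xi := (pc_xi S).
Notation K x i j := (curvmx g i j x).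
Notation th V a j x := (pr (g x) (delta_mx 0 j) (V a x)).
Hypotheses (oU : open U) (apc : almost_paracosymplectic U S)
  (Kf : forall x i j, U x -> f x *m K x i j = K x i j *m f x)
  (LC : forall x, U x -> leaf_condition S x)
  (ein : forall x (u w : E), U x ->
    \sum_k (w *m Rm (fun i j => K x i j) (delta_mx 0 k) u) 0 k
    = r0 / 4 * (pr (g x) u w - pr (g x) u (xi x) * pr (g x) w (xi x)))
  (oW : open W) (WU : W `<=` U) (s0 : sigma != 0) (r00 : r0 != 0).

Let pcS : almost_paracontact_metric U S. Proof. by case: apc. Qed.
Let rG : pseudo_riemannian U g. Proof. by case: (paracontact_smooth pcS). Qed.
Let gs x : W x -> (g x)^T = g x. Proof. by move=> /WU/rG.2[]. Qed.

Notation dF F X x := (\sum_i X 0 i * partial i F x).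

Lemma adopted_gram (V : 'I_5 -> E -> E) x : adopted_frame sigma S W V -> W x ->
  forall i j, pr (g x) (V i x) (V j x) =
  if (i, j) \in [:: (i0, i0); (i1, i3); (i3, i1); (i2, i4); (i4, i2)] then 1 else 0.
Proof. by move=> [_ _ H] Wx i j; have [_ _ _] := H x Wx; exact. Qed.

(** [nabla V1 = a th1 (x) V1] determines [a] from [V1] alone; likewise [c] from [V2]. *)
Lemma fa_frame_independent (V V' : 'I_5 -> E -> E) x :
  adopted_frame sigma S W V -> adopted_frame sigma S W V' -> V' i1 = V i1 -> V' i2 = V i2 ->
  W x -> fa S V x = fa S V' x /\ fc S V x = fc S V' x.
Proof.
move=> fr fr' e1 e2 Wx; have G := adopted_gram fr Wx; have gsx := gs Wx.
split.
  rewrite {1}/fa; under eq_bigr do rewrite -e1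
    (nab_V1 oU apc Kf LC oW WU s0 fr' _ Wx) prZl e1 G/= mulr1 mulrCA.
  by rewrite -mulr_sumr (pr_delta_sum gsx) G/= mulr1.
rewrite {1}/fc; under eq_bigr do rewrite -e2
  (nab_V2 oU apc Kf LC oW WU s0 fr' _ Wx) prZl e2 G/= mulr1 mulrCA.
by rewrite -mulr_sumr (pr_delta_sum gsx) G/= mulr1.
Qed.

Lemma normalized_frame_exists (V : 'I_5 -> E -> E) : adopted_frame sigma S W V ->
  exists V', adopted_frame sigma S W V' /\ forall x, W x ->
    dF (fa S V') (V' i4 x) x = 0 /\ dF (fc S V') (V' i3 x) x = 0.
Proof.
move=> fr; have [sV sh fr3] := fr.
have sa : smooth W (fa S V) := smooth_fa apc oW WU fr.
(* [V1 a = r0/4] makes [V4 - lam V1] annihilate [a]; since [V4 a + V3 c = 0] and [V2 c = r0/4], the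
   same [lam] makes [V3 + lam V2] annihilate [c]. The opposite signs preserve the orthogonality of
   [V3] and [V4]. *)
pose lam x := 4 / r0 * dF (fa S V) (V i4 x) x.
have slam : smooth W lam.
  apply: smoothM => //; first exact: smooth_cst.
  apply: smooth_sum => // i; apply: smoothM => //; first exact: sV.
  exact: smooth_partial.
pose V3 x := V i3 x + lam x *: V i2 x.
pose V4 x := V i4 x - lam x *: V i1 x.
exists (mkframe xi (V i1) (V i2) V3 V4).
have fr' : adopted_frame sigma S W (mkframe xi (V i1) (V i2) V3 V4).
  apply: (mkframe_adopted pcS) => //.
  - by apply: smooth_mxD => //; exact: smooth_mxZ.
  - by apply: smooth_mxD => //; apply: smooth_mxN => //; exact: smooth_mxZ.
  move=> x Wx; have G := adopted_gram fr Wx; have [_ A B _] := fr3 x Wx.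
  have [_ _ H] := sh; have [_ V1f V2f _ _] := H x Wx.
  rewrite /phi in A B V1f V2f; rewrite /V3 /V4; split.
  - by rewrite mulmxDl A -scalemxAl V2f.
  - by rewrite mulmxBl B -scalemxAl V1f scalerN opprB opprK addrC.
  - by rewrite prDr prZr !G/= mulr0 addr0.
  - by rewrite prDr prNr prZr !G/= mulr0 subr0.
  - by rewrite !(prDl, prDr, prZl, prNr, prZr) !G/=; ring.
split=> // x Wx.
have ind y : W y -> _ := fa_frame_independent fr fr' erefl erefl.
have Ea i : partial i (fa S (mkframe xi (V i1) (V i2) V3 V4)) x = partial i (fa S V) x.
  apply: near_eq_partial; apply: filterS (open_near oW Wx) => y Wy.
  by have [] := ind y Wy.
have Ec i : partial i (fc S (mkframe xi (V i1) (V i2) V3 V4)) x = partial i (fc S V) x.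
  apply: near_eq_partial; apply: filterS (open_near oW Wx) => y Wy.
  by have [] := ind y Wy.
have [[a0 a2 a1] [c0 c1 c2] ac] := frame_derivatives oU apc Kf LC ein oW WU s0 fr Wx.
split.
  rewrite (eq_bigr (fun i => V i4 x 0 i * partial i (fa S V) x
     - lam x * (V i1 x 0 i * partial i (fa S V) x))); last first.
    by move=> i _; rewrite Ea /mkframe/= /V4 !mxE; ring.
  by rewrite sumrB -mulr_sumr a1 /lam; field.
rewrite (eq_bigr (fun i => V i3 x 0 i * partial i (fc S V) x
     + lam x * (V i2 x 0 i * partial i (fc S V) x))); last first.
  by move=> i _; rewrite Ec /mkframe/= /V3 !mxE; ring.
rewrite big_split/= -mulr_sumr c2 /lam -[RHS]ac; field.
exact: r00.
Qed.

End NormalizedFrame.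

Section DependsOnTwo.
Context {R : realType}.
Notation E := ('rV[R]_5).

Definition point5 (a b c d e : R) : E :=
  \row_j match val j with 0%N => a | 1%N => b | 2%N => c | 3%N => d | _ => e end.

(** A ball of the maximum norm is a box, so resetting the coordinates [i0], [i3], [i4] to those of
    the centre stays inside; the mean value theorem along that segment applies. *)
Lemma depends_on_x1_x2 (F : E -> R) (p0 : E) (r : R) :
  (forall p, ball p0 r p -> differentiable F p /\
     [/\ partial i0 F p = 0, partial i3 F p = 0 & partial i4 F p = 0]) ->
  forall p, ball p0 r p -> ball p0 r (point5 (p0 0 i0) (p 0 i1) (p 0 i2) (p0 0 i3) (p0 0 i4)) /\
    F p = F (point5 (p0 0 i0) (p 0 i1) (p 0 i2) (p0 0 i3) (p0 0 i4)).
Proof.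
move=> H p Bp; set q := point5 _ _ _ _ _.
have Bq : ball p0 r q.
  move: Bp; rewrite -!ball_normE /ball_/=; apply: le_lt_trans.
  apply: normrV_le => // j; have := normrV_ge (p0 - p) j; rewrite !mxE.
  by elim/ord5P: j => //=; rewrite subrr normr0 => _; exact: normr_ge0.
split=> //.
have pq : p + (q - p) = q by rewrite addrC subrK.
have seg (s : R) : 0 <= s <= 1 -> ball p0 r (p + s *: (q - p)).
  by move=> s01; apply: ball_segment => //; rewrite pq.
have [s s01|c c01] := @mean_value R 4 F p (q - p).
  by case: (H _ (seg s s01)).
have [dF [P0 P3 P4]] := H _ (seg c c01).
rewrite pq derive_sum_partial// sum5 P0 P3 P4 !mulr0 !addr0 !add0r.
rewrite !mxE/= !subrr !mul0r addr0 => /eqP; rewrite subr_eq0 => /eqP ->//.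
Qed.

End DependsOnTwo.

Section CanonicalCoordinates.
Context {R : realType}.
Notation E := ('rV[R]_5).
Variables (U W : set E) (S : pc_data R 4) (sigma r0 : R) (V : 'I_5 -> E -> E).
Notation g := (pc_g S).
Notation f := (pc_phi S).
Notation xi := (pc_xi S).
Notation K x i j := (curvmx g i j x).
Notation th a j x := (pr (g x) (delta_mx 0 j) (V a x)).
Notation dF F X x := (\sum_i X 0 i * partial i F x).
Notation fa := (fa S V).
Notation fc := (fc S V).
Hypotheses (oU : open U) (apc : almost_paracosymplectic U S)
  (Kf : forall x i j, U x -> f x *m K x i j = K x i j *m f x)
  (LC : forall x, U x -> leaf_condition S x)
  (ein : forall x (u w : E), U x ->
    \sum_k (w *m Rm (fun i j => K x i j) (delta_mx 0 k) u) 0 k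
    = r0 / 4 * (pr (g x) u w - pr (g x) u (xi x) * pr (g x) w (xi x)))
  (oW : open W) (WU : W `<=` U) (s0 : sigma != 0) (r00 : r0 != 0)
  (fr : adopted_frame sigma S W V)
  (nf : forall x, W x -> dF fa (V i4 x) x = 0 /\ dF fc (V i3 x) x = 0).

Let pcS : almost_paracontact_metric U S. Proof. by case: apc. Qed.
Let rG : pseudo_riemannian U g. Proof. by case: (paracontact_smooth pcS). Qed.
Let gs x : W x -> (g x)^T = g x. Proof. by move=> /WU/rG.2[]. Qed.
Let ug x : W x -> g x \in unitmx. Proof. by move=> /WU/rG.2[]. Qed.
Let gram x : W x -> forall i j, pr (g x) (V i x) (V j x) =
  if (i, j) \in [:: (i0, i0); (i1, i3); (i3, i1); (i2, i4); (i4, i2)] then 1 else 0.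
Proof. by move=> Wx; exact: (adopted_gram fr Wx). Qed.
Let sa : smooth W fa. Proof. exact: smooth_fa apc oW WU fr. Qed.
Let sc : smooth W fc. Proof. exact: smooth_fc apc oW WU fr. Qed.
Let sV a : smooth_mx W (V a). Proof. by case: fr. Qed.
Let sth a j : smooth W (fun y => th a j y). Proof. exact: smooth_th apc oW WU fr a j. Qed.

(** The coefficient of [th1] in [th3 = (4/r0) da + u th1], read off at [V3], where [th3] is 0 and
    [th1] is 1. *)
Definition fu x : R := - (4 / r0) * dF fa (V i3 x) x.
Definition fv x : R := - (4 / r0) * dF fc (V i4 x) x.

Lemma smooth_fu : smooth W fu.
Proof.
apply: smoothM => //; first exact: smooth_cst.
apply: smooth_sum => // i; apply: smoothM => //; first exact: sV.
exact: smooth_partial.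
Qed.

Lemma smooth_fv : smooth W fv.
Proof.
apply: smoothM => //; first exact: smooth_cst.
apply: smooth_sum => // i; apply: smoothM => //; first exact: sV.
exact: smooth_partial.
Qed.

Let fd x (Wx : W x) := frame_derivatives oU apc Kf LC ein oW WU s0 fr Wx.

Lemma coframe_entry x a (c : 'cV[R]_5) : (forall b, pr (g x) (V b x) (V a x) = (V b x *m c) 0 0) ->
  W x -> g x *m (V a x)^T = c.
Proof.
move=> H Wx; apply: (coframe_ext (gram Wx)) => b; apply/matrixP => i j.
by rewrite !ord1 -H mulmxA.
Qed.

Lemma dF_dfun F (X x : E) : (X *m dfun F x) 0 0 = dF F X x.
Proof. by rewrite mulmx_sum_ebase; apply: eq_bigr => i _; rewrite mxE. Qed.

(** Both sides are compared on the frame. Agreement on [V4] is the normalization of the frame; on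
    [V1] it is [V1 a = r0/4]. *)
Lemma coframe3 x : W x ->
  g x *m (V i3 x)^T = (4 / r0) *: dfun fa x + fu x *: (g x *m (V i1 x)^T).
Proof.
move=> Wx; apply: coframe_entry => // b.
have [[a0 a2 a1] _ _] := fd Wx; have [a4 _] := nf Wx.
rewrite mulmxDr -!scalemxAr mulmxA [RHS]mxE [X in X + _]mxE [X in _ + X]mxE dF_dfun.
rewrite -/(pr (g x) (V b x) (V i1 x)) !(gram Wx).
elim/ord5P: b; rewrite /= ?a0 ?a1 ?a2 ?a4 ?mulr0 ?addr0 ?mulr1 //; last by rewrite /fu; ring.
by field.
Qed.

Lemma coframe4 x : W x ->
  g x *m (V i4 x)^T = (4 / r0) *: dfun fc x + fv x *: (g x *m (V i2 x)^T).
Proof.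
move=> Wx; apply: coframe_entry => // b.
have [_ [c0 c1 c2] _] := fd Wx; have [_ c3] := nf Wx.
rewrite mulmxDr -!scalemxAr mulmxA [RHS]mxE [X in X + _]mxE [X in _ + X]mxE dF_dfun.
rewrite -/(pr (g x) (V b x) (V i2 x)) !(gram Wx).
elim/ord5P: b; rewrite /= ?c0 ?c1 ?c2 ?c3 ?mulr0 ?addr0 ?mulr1 //; last by rewrite /fv; ring.
by field.
Qed.

Lemma thE a j x : th a j x = (g x *m (V a x)^T) j 0.
Proof. by rewrite /pr -mulmxA -rowE mxE. Qed.

(** With [dF] exact and [th B] closed, [d (th A) = du /\ th B]; this is evaluated on
    [(V b, V A)]. *)
Lemma transverse_derivative A B b F u c x : W x -> smooth W F -> smooth W u ->
  (forall y, W y -> g y *m (V A y)^T = c *: dfun F y + u y *: (g y *m (V B y)^T)) ->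
  (forall i j, partial i (fun y => th B j y) x = partial j (fun y => th B i y) x) ->
  pr (g x) (V A x) (V B x) = 1 -> pr (g x) (V b x) (V B x) = 0 ->
  dF u (V b x) x = \sum_i \sum_j (V b x 0 i * V A x 0 j) *
    (partial i (fun y => th A j y) x - partial j (fun y => th A i y) x).
Proof.
move=> Wx sF su AE cB gAB gbB.
have ptA i j : partial i (fun y => th A j y) x
    = c * partial i (partial j F) x + (partial i u x * th B j x + u x * partial i (fun y => th B j y) x).
  have H : \near x, th A j x = c * partial j F x + u x * th B j x.
    apply: filterS (open_near oW Wx) => y Wy.
    by rewrite !thE AE// !mxE.
  have d1 := smooth_diff (smooth_partial j sF) Wx.
  have d2 := smooth_diff su Wx; have d3 := smooth_diff (sth B j) Wx.
  rewrite (near_eq_partial i H) partialD; [|exact: differentiableM|exact: differentiableM].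
  rewrite (partialM i d2 d3) (partialM i (differentiable_cst c x) d1).
  by rewrite partial_cst mul0r add0r.
have E1 i j : (V b x 0 i * V A x 0 j) *
    (partial i (fun y => th A j y) x - partial j (fun y => th A i y) x)
  = V b x 0 i * partial i u x * (V A x 0 j * th B j x)
    - V A x 0 j * partial j u x * (V b x 0 i * th B i x).
  rewrite !ptA (schwarz i j oW sF Wx) (cB i j).
  move: (partial j (partial i F) x) (partial i u x) (partial j u x) (partial j _ x) => p1 p2 p3 p4.
  by ring.
under [RHS]eq_bigr do under eq_bigr do rewrite E1.
under [RHS]eq_bigr do rewrite sumrB -mulr_sumr (pr_delta_sum (gs Wx)) gAB mulr1.
rewrite sumrB [X in _ - X]exchange_big/= [X in _ - X]big1 ?subr0// => j _.
by rewrite -mulr_sumr (pr_delta_sum (gs Wx)) gbB mulr0.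
Qed.

Lemma du_frame x : W x -> [/\ dF fu (V i0 x) x = -1, dF fu (V i1 x) x = fa x & dF fu (V i2 x) x = 0].
Proof.
move=> Wx; have [e0 e1 e2] := exterior_th3 oU apc Kf LC oW WU s0 fr Wx; have G := gram Wx.
have cl i j := closed_th oU apc Kf LC oW WU s0 fr i j Wx (or_intror (or_introl (erefl i1))).
have T b := transverse_derivative (A := i3) (B := i1) (b := b) Wx sa smooth_fu coframe3 cl.
by rewrite !T ?G.
Qed.

Lemma dv_frame x : W x ->
  [/\ dF fv (V i0 x) x = - sigma, dF fv (V i1 x) x = 0 & dF fv (V i2 x) x = fc x].
Proof.
move=> Wx; have [e0 e1 e2] := exterior_th4 oU apc Kf LC oW WU s0 fr Wx; have G := gram Wx.
have cl i j := closed_th oU apc Kf LC oW WU s0 fr i j Wx (or_intror (or_intror (erefl i2))).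
have T b := transverse_derivative (A := i4) (B := i2) (b := b) Wx sc smooth_fv coframe4 cl.
by rewrite !T ?G.
Qed.

Lemma potential a x : W x -> a = i0 \/ a = i1 \/ a = i2 ->
  exists W' F, [/\ open W', W' x, W' `<=` W, smooth W' F &
    forall y, W' y -> dfun F y = g y *m (V a y)^T].
Proof.
move=> Wx ai.
have [W' [F [oW' W'x W'W sF dF]]] := poincare oW Wx (sth a)
  (fun y i j Wy => closed_th oU apc Kf LC oW WU s0 fr i j Wy ai).
exists W', F; split=> // y W'y; apply/matrixP => i j.
by rewrite ord1 mxE dF// thE.
Qed.

Lemma dF_pr F a x (X : E) : dfun F x = g x *m (V a x)^T -> dF F X x = pr (g x) X (V a x).
Proof. by move=> H; rewrite -dF_dfun H mulmxA. Qed.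

Lemma canonical_coordinates x : W x -> has_canonical_form r0 sigma U S x.
Proof.
move=> Wx.
have [W0 [t [oW0 W0x W0W st dt]]] := potential Wx (or_introl (erefl i0)).
have [W1 [x1 [oW1 W1x W1W sx1 dx1]]] := potential Wx (or_intror (or_introl (erefl i1))).
have [W2 [x2 [oW2 W2x W2W sx2 dx2]]] := potential Wx (or_intror (or_intror (erefl i2))).
pose W' := W0 `&` W1 `&` W2.
have oW' : open W' by apply: openI => //; exact: openI.
have W'W : W' `<=` W by move=> y [[/W0W]].
have W'0 : W' `<=` W0 by move=> y [[]].
have W'1 : W' `<=` W1 by move=> y [[]].
have W'2 : W' `<=` W2 by move=> y [].
have W'x : W' x by [].
(* The sign matches [f = f0 - y1] against [h = h0 + y2]: both [df] and [dh] must be the positive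
   multiples of [da] and [dc]. *)
pose y1 y := - (4 / r0 * fa y).
pose y2 y := 4 / r0 * fc y.
pose k y : E := point5 (t y) (x1 y) (x2 y) (y1 y) (y2 y).
have st' := smooth_sub W'0 st; have sx1' := smooth_sub W'1 sx1; have sx2' := smooth_sub W'2 sx2.
have sa' := smooth_sub W'W sa; have sc' := smooth_sub W'W sc.
have sy1 : smooth W' y1 by apply: smoothN => //; apply: smoothM => //; exact: smooth_cst.
have sy2 : smooth W' y2 by apply: smoothM => //; exact: smooth_cst.
have k0 : (fun y => k y 0 i0) = t by apply/funext => y; rewrite mxE.
have k1 : (fun y => k y 0 i1) = x1 by apply/funext => y; rewrite mxE.
have k2 : (fun y => k y 0 i2) = x2 by apply/funext => y; rewrite mxE.
have k3 : (fun y => k y 0 i3) = y1 by apply/funext => y; rewrite mxE.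
have k4 : (fun y => k y 0 i4) = y2 by apply/funext => y; rewrite mxE.
have sk : smooth_mx W' k.
  by move=> i j; rewrite ord1; elim/ord5P: j; rewrite ?k0 ?k1 ?k2 ?k3 ?k4.
have py1 y i : W' y -> partial i y1 y = - (4 / r0 * partial i fa y).
  move=> W'y; have da := smooth_diff sa' W'y.
  rewrite partialN; last by apply: differentiableM => //; exact: differentiable_cst.
  by rewrite (partialM i (differentiable_cst _ y) da) partial_cst mul0r add0r.
have py2 y i : W' y -> partial i y2 y = 4 / r0 * partial i fc y.
  move=> W'y; have dc := smooth_diff sc' W'y.
  by rewrite (partialM i (differentiable_cst _ y) dc) partial_cst mul0r add0r.
have c0 : 4 / r0 != 0 by rewrite mulf_neq0// invr_eq0.
(* A vector killed by [dt], [dx1], [dx2] is a combination of [V1] and [V2], on which [da] and [dc]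
   are diagonal with entries [r0/4]. *)
have uJ : 'J k x \in unitmx.
  apply: unitmx_ker => v vJ; have dk := smooth_mx_diff sk W'x; have G := gram Wx.
  have Z j : \sum_i v 0 i * partial i (fun y => k y 0 j) x = 0.
    have /rowP/(_ j) := vJ; rewrite mxE [RHS]mxE => H; rewrite -[RHS]H.
    by apply: eq_bigr => i _; rewrite jacobianE.
  have Z0 := Z i0; rewrite k0 (dF_pr v (dt x W0x)) in Z0.
  have Z1 := Z i1; rewrite k1 (dF_pr v (dx1 x W1x)) in Z1.
  have Z2 := Z i2; rewrite k2 (dF_pr v (dx2 x W2x)) in Z2.
  have vE := frame_expand (ug Wx) G v; rewrite Z0 Z1 Z2 !scale0r !addr0 add0r in vE.
  have [[a0 a2 a1] [b0 b1 b2] _] := fd Wx.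
  have lin F : dF F v x = pr (g x) v (V i3 x) * dF F (V i1 x) x + pr (g x) v (V i4 x) * dF F (V i2 x) x.
    rewrite {1}vE !mulr_sumr -big_split/=; apply: eq_bigr => i _.
    by rewrite !mxE; ring.
  have Z3 : dF fa v x = 0.
    have := Z i3; rewrite k3; under eq_bigr do rewrite py1// mulrN mulrCA.
    rewrite sumrN -mulr_sumr => /eqP; rewrite oppr_eq0 mulf_eq0 (negbTE c0) => /eqP; exact.
  have Z4 : dF fc v x = 0.
    have := Z i4; rewrite k4; under eq_bigr do rewrite py2// mulrCA.
    rewrite -mulr_sumr => /eqP; rewrite mulf_eq0 (negbTE c0) => /eqP; exact.
  have r4 : r0 / 4 != 0 by rewrite mulf_neq0// invr_eq0.
  move: Z3 Z4; rewrite !lin a1 a2 b1 b2 !mulr0 addr0 add0r => /eqP.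
  rewrite mulf_eq0 (negbTE r4) orbF => /eqP A1 /eqP; rewrite mulf_eq0 (negbTE r4) orbF => /eqP A2.
  by rewrite vE A1 A2 !scale0r addr0.
have [W3 [V3 [W3x W3W' D3]]] := inverse_function oW' W'x sk uJ.
have [oW3 oV3 _ kV3 _] := D3.
have [r /= rr0 Br] := (nbhs_ballP _ _).1 (open_near oV3 (kV3 x W3x)).
(* A ball as coordinate range, required by [depends_on_x1_x2]. *)
pose B := ball (k x) r.
have oB : open B by exact: ball_open.
have D := diffeomorphism_restrict D3 oB Br.
pose Wf : set E := [set y | W3 y /\ B (k y)].
have WfW' : Wf `<=` W' by move=> y [/W3W'].
have [oWf _ skf kB [l [sl lWf lk kl]]] := D.
(* What is left of [u] and [v] after removing the prescribed dependence on [t], [y1], [y2]; it has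
   to be a function of [x1], [x2] only. *)
pose uh y := fu y + t y - r0 / 8 * y1 y ^+ 2.
pose vh y := fv y + sigma * t y - r0 / 8 * y2 y ^+ 2.
have su' := smooth_sub W'W smooth_fu; have sv' := smooth_sub W'W smooth_fv.
have sq F : smooth W' F -> smooth W' (fun y => r0 / 8 * F y ^+ 2).
  by move=> sF; apply: smoothM => //; [exact: smooth_cst|exact: smoothX].
have suh : smooth W' uh.
  by apply: smoothB => //; [exact: smoothD|exact: sq].
have svh : smooth W' vh.
  apply: smoothB => //; last exact: sq.
  by apply: smoothD => //; apply: smoothM => //; exact: smooth_cst.
have psq F i y : smooth W' F -> W' y ->
    partial i (fun y => r0 / 8 * F y ^+ 2) y = r0 / 4 * F y * partial i F y.
  move=> sF W'y; have dd := smooth_diff sF W'y.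
  have d2 : differentiable (fun y => F y ^+ 2) y by exact: differentiableM.
  rewrite (partialM i (differentiable_cst (r0 / 8) y) d2) partial_cst mul0r add0r.
  rewrite (partialM i dd dd). by rewrite /cst; field.
have duh y a : W' y -> dF uh (V a y) y
    = dF fu (V a y) y + pr (g y) (V a y) (V i0 y) + 4 / r0 * fa y * (- dF fa (V a y) y).
  move=> W'y; have H i : partial i uh y = partial i fu y + partial i t y
       - r0 / 4 * y1 y * (- (4 / r0 * partial i fa y)).
    have d1 := smooth_diff su' W'y; have d2 := smooth_diff st' W'y.
    have d3 := smooth_diff (sq _ sy1) W'y.
    rewrite (partialB i (differentiableD d1 d2) d3) (partialD i d1 d2) (psq _ i y sy1 W'y).
    by rewrite py1.
  rewrite -(dF_pr (V a y) (dt y (W'0 _ W'y))) -sumrN mulr_sumr -!big_split/=.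
  by apply: eq_bigr => i _; rewrite H /y1; field.
have dvh y a : W' y -> dF vh (V a y) y
    = dF fv (V a y) y + sigma * pr (g y) (V a y) (V i0 y) + 4 / r0 * fc y * (- dF fc (V a y) y).
  move=> W'y; have H i : partial i vh y = partial i fv y + sigma * partial i t y
       - r0 / 4 * y2 y * (4 / r0 * partial i fc y).
    have d1 := smooth_diff sv' W'y; have d2 := smooth_diff st' W'y.
    have d2' : differentiable (fun y => sigma * t y) y.
      by apply: differentiableM => //; exact: differentiable_cst.
    have d3 := smooth_diff (sq _ sy2) W'y.
    rewrite (partialB i (differentiableD d1 d2') d3) (partialD i d1 d2') (psq _ i y sy2 W'y).
    by rewrite (partialM i (differentiable_cst sigma y) d2) partial_cst mul0r add0r py2.
  rewrite -(dF_pr (V a y) (dt y (W'0 _ W'y))) -sumrN [sigma * _]mulr_sumr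
    [_ * (\sum_i - _)]mulr_sumr -!big_split/=.
  by apply: eq_bigr => i _; rewrite H /y2; field.
have uh0 y : W' y -> [/\ dF uh (V i0 y) y = 0, dF uh (V i1 y) y = 0 & dF uh (V i2 y) y = 0].
  move=> W'y; have Wy := W'W _ W'y; have [u0 u1 u2] := du_frame Wy; have G := gram Wy.
  have [[a0 a2 a1] _ _] := fd Wy.
  rewrite !duh// u0 u1 u2 a0 a1 a2 !G/=; split; [ring|by field|ring].
have vh0 y : W' y -> [/\ dF vh (V i0 y) y = 0, dF vh (V i1 y) y = 0 & dF vh (V i2 y) y = 0].
  move=> W'y; have Wy := W'W _ W'y; have [v0 v1 v2] := dv_frame Wy; have G := gram Wy.
  have [_ [b0 b1 b2] _] := fd Wy.
  rewrite !dvh// v0 v1 v2 b0 b1 b2 !G/=; split; [ring|ring|by field].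
(* The coordinate fields of [t], [y1], [y2] are annihilated by [dx1] and [dx2], hence are
   combinations of [V0], [V1], [V2]. *)
have lc F : smooth W' F ->
    (forall y, W' y -> [/\ dF F (V i0 y) y = 0, dF F (V i1 y) y = 0 & dF F (V i2 y) y = 0]) ->
    forall p, B p -> differentiable (fun p => F (l p)) p /\
     [/\ partial i0 (fun p => F (l p)) p = 0, partial i3 (fun p => F (l p)) p = 0
       & partial i4 (fun p => F (l p)) p = 0].
  move=> sF F0 p Bp; have W'l := WfW' _ (lWf p Bp); have Wl := W'W _ W'l.
  have dl := smooth_mx_diff sl Bp; have dFl := smooth_diff sF W'l.
  have G := gram Wl; have [z0 z1 z2] := F0 _ W'l.
  split; first exact: differentiable_compose.
  have key i : i != i1 -> i != i2 -> partial i (fun p => F (l p)) p = 0.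
    move=> ni1 ni2; rewrite (partial_comp i dl dFl).
    pose w : E := \row_j partial i (fun p => l p 0 j) p.
    rewrite (eq_bigr (fun j => w 0 j * partial j F (l p))); last by move=> j _; rewrite mxE.
    have crd j (X : E -> R) : smooth W' X -> (fun y => k y 0 j) = X -> i != j ->
        dF X w (l p) = 0.
      move=> sX kX ij; have dX := smooth_diff sX W'l.
      rewrite (eq_bigr (fun a => partial i (fun p => l p 0 a) p * partial a X (l p))); last first.
        by move=> a _; rewrite mxE.
      rewrite -(partial_comp i dl dX).
      have H : \near p, X (l p) = p 0 j.
        by apply: filterS (open_near oB Bp) => q Bq; rewrite -kX kl.
      by rewrite (near_eq_partial i H) partial_coordf (negbTE ij).
    have w1 := crd i1 _ sx1' k1 ni1; rewrite (dF_pr w (dx1 _ (W'1 _ W'l))) in w1.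
    have w2 := crd i2 _ sx2' k2 ni2; rewrite (dF_pr w (dx2 _ (W'2 _ W'l))) in w2.
    have wE := frame_expand (ug Wl) G w; rewrite w1 w2 !scale0r !addr0 in wE.
    rewrite wE; set p0 := pr _ _ _; set p3 := pr _ _ _; set p4 := pr _ _ _.
    rewrite (_ : \sum_i _ = p0 * dF F (V i0 (l p)) (l p) + p3 * dF F (V i1 (l p)) (l p)
       + p4 * dF F (V i2 (l p)) (l p)); first by rewrite z0 z1 z2 !mulr0 !addr0.
    rewrite !mulr_sumr -!big_split/=; apply: eq_bigr => j _.
    by rewrite !mxE; ring.
  by split; apply: key.
have dep_u := depends_on_x1_x2 (lc uh suh uh0).
have dep_v := depends_on_x1_x2 (lc vh svh vh0).
(* The coordinates other than [x1], [x2] are frozen at their values in the base point. *)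
pose q0 a b := point5 (k x 0 i0) a b (k x 0 i3) (k x 0 i4).
pose u0 a b := uh (l (q0 a b)); pose v0 a b := vh (l (q0 a b)).
pose thf i y : 'cV[R]_5 := g y *m (V i y)^T.
exists Wf, B, k, V, thf, (fun=> 0), (fun=> 0), u0, v0.
have sB F : smooth W' F -> smooth B (fun p => F (l p)).
  by move=> sF; apply: (smooth_comp oB _ sl sF) => p /lWf/WfW'.
have WfW : Wf `<=` W by move=> y /WfW'/W'W.
split.
- split; last by move=> y /WfW/WU.
  by split=> //; exact: ballxx.
- exact: D.
- split; [exact: smooth_cst|exact: smooth_cst| |].
    by apply: smooth_ext (sB _ suh) => // p Bp; have [_ ->] := dep_u p Bp.
  by apply: smooth_ext (sB _ svh) => // p Bp; have [_ ->] := dep_v p Bp.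
- split; last by move=> y Wy i X; rewrite /thf mulmxA.
  have [_ [s1 s2 sh] H] := fr; split.
  + by move=> i; exact: smooth_mx_sub WfW (sV i).
  + split; [exact: smooth_mx_sub s1|exact: smooth_mx_sub s2|].
    by move=> y /WfW; exact: sh.
  + by move=> y /WfW; exact: H.
move=> q Wfq; have W'q := WfW' _ Wfq; have Wq := W'W _ W'q; have Bq := kB q Wfq.
have e0 : thf i0 q = pc_eta S q.
  have [_ _ _ eE _] := paracontact_matrix pcS (WU Wq).
  have [_ _ H] := fr; have [V0 _ _ _] := H q Wq.
  by rewrite /thf V0 eE.
have c_t : coordf i0 \o k = t by [].
have c_1 : coordf i1 \o k = x1 by [].
have c_2 : coordf i2 \o k = x2 by [].
have c_3 : coordf i3 \o k = y1 by [].
have c_4 : coordf i4 \o k = y2 by [].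
split=> //; rewrite c_t c_1 c_2 c_3 c_4.
have fE : dfun (fun q => 0 - y1 q) q = (4 / r0) *: dfun fa q.
  apply/matrixP => i j; rewrite !mxE.
  rewrite (partialB i (differentiable_cst 0 q) (smooth_diff sy1 W'q)) partial_cst py1//.
  by rewrite sub0r opprK.
have hE : dfun (fun q => 0 + y2 q) q = (4 / r0) *: dfun fc q.
  apply/matrixP => i j; rewrite !mxE.
  rewrite (partialD i (differentiable_cst 0 q) (smooth_diff sy2 W'q)) partial_cst py2//.
  by rewrite add0r.
have uE : u0 (x1 q) (x2 q) - t q + r0 / 8 * y1 q ^+ 2 = fu q.
  have [_ H] := dep_u _ Bq; rewrite /u0.
  have -> : q0 (x1 q) (x2 q) = point5 (k x 0 i0) (k q 0 i1) (k q 0 i2) (k x 0 i3) (k x 0 i4).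
    by rewrite -k1 -k2.
  by rewrite -H lk// /uh; ring.
have vE : v0 (x1 q) (x2 q) - sigma * t q + r0 / 8 * y2 q ^+ 2 = fv q.
  have [_ H] := dep_v _ Bq; rewrite /v0.
  have -> : q0 (x1 q) (x2 q) = point5 (k x 0 i0) (k q 0 i1) (k q 0 i2) (k x 0 i3) (k x 0 i4).
    by rewrite -k1 -k2.
  by rewrite -H lk// /vh; ring.
elim/ord5P; rewrite /canonical_coframe/=.
- by rewrite dt//; exact: W'0.
- by rewrite dx1//; exact: W'1.
- by rewrite dx2//; exact: W'2.
- by rewrite uE fE (dx1 q (W'1 _ W'q)); exact: coframe3.
- by rewrite vE hE (dx2 q (W'2 _ W'q)); exact: coframe4.
Qed.

End CanonicalCoordinates.

Lemma canonical_form_local (R : realType) (U : set 'rV[R]_5) (S : pc_data R 4) (sigma r0 : R) x :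
  open U -> weakly_paracosymplectic U S -> para_kahler_leaves U S -> eta_einstein U S ->
  (forall x, U x -> scal (pc_g S) x = r0) -> shape_type sigma U S -> sigma != 0 -> r0 != 0 ->
  U x -> has_canonical_form r0 sigma U S x.
Proof.
move=> oU weak leaves ein sc shape s0 r00 Ux.
have apc : almost_paracosymplectic U S by case: weak.
have [pcS clS _] := apc.
have Kf y i j (Uy : U y) := weakly_paracosymplectic_curvmx oU pcS i j weak Uy.
have LC y (Uy : U y) := parallel_leaf_condition oU pcS clS leaves Uy.
have Ein y u w (Uy : U y) := eta_einstein_curvmx oU pcS u w ein (sc y Uy) Uy.
have [W0 [V1 [V2 [oW0 W0x W0U sh]]]] := shape x Ux.
have [W [V [oW Wx WW0 fr]]] := adopted_frame_exists pcS oW0 W0U W0x sh.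
have WU : W `<=` U by move=> y /WW0/W0U.
have [V' [fr' nf]] := normalized_frame_exists oU apc Kf LC Ein oW WU s0 r00 fr.
exact: (canonical_coordinates oU apc Kf LC Ein oW WU s0 r00 fr' nf Wx).
Qed.

(** * The model *)

Section ModelMatrices.
Context {R : realFieldType}.
Implicit Types (a b sigma : R).

(** Entries are given on natural numbers so that pattern matching reduces them once the five cases
    are split. *)
Definition mx5 (f : nat -> nat -> R) : 'M[R]_5 := \matrix_(i, j) f i j.

Definition metric_entry a b (i j : nat) : R := match i, j with
  | 0%N, 0%N => 1 | 1%N, 1%N => 2 * a | 1%N, 3%N => -1 | 3%N, 1%N => -1
  | 2%N, 2%N => 2 * b | 2%N, 4%N => 1 | 4%N, 2%N => 1 | _, _ => 0 end.
Definition model_g a b := mx5 (metric_entry a b).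

Definition model_ginv a b := mx5 (fun i j => match i, j with
  | 0%N, 0%N => 1 | 1%N, 3%N => -1 | 3%N, 1%N => -1 | 3%N, 3%N => - (2 * a)
  | 2%N, 4%N => 1 | 4%N, 2%N => 1 | 4%N, 4%N => - (2 * b) | _, _ => 0 end).

Definition phi_entry a b (i j : nat) : R := match i, j with
  | 1%N, 1%N => 1 | 1%N, 3%N => 2 * a | 3%N, 3%N => -1
  | 2%N, 2%N => -1 | 2%N, 4%N => 2 * b | 4%N, 4%N => 1 | _, _ => 0 end.
Definition model_phi a b := mx5 (phi_entry a b).

(** The fundamental form; its constant coefficients make it closed. *)
Definition model_form := mx5 (fun i j => match i, j with
  | 1%N, 3%N => -1 | 3%N, 1%N => 1 | 2%N, 4%N => -1 | 4%N, 2%N => 1 | _, _ => 0 end).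

(* The Christoffel symbol [Gamma_(jr)^c] is [p.1 * s p.2] with
   [p := model_index sigma j r c], where [s 0 = 1, s 1 = a_y1,
   s 2 = 2 a a_y1 - a_x1, s 3 = a_x2, s 4 = b_x1, s 5 = b_y2,
   s 6 = 2 b b_y2 + b_x2]. *)
Definition model_index sigma (j r c : nat) : R * nat := (match j, r, c with
  | 0%N, 1%N, 3%N => (1, 0) | 0%N, 2%N, 4%N => (- sigma, 0)
  | 1%N, 1%N, 0%N => (1, 0) | 1%N, 1%N, 1%N => (1, 1) | 1%N, 1%N, 3%N => (1, 2) | 1%N, 0%N, 3%N => (1, 0)
  | 1%N, 2%N, 3%N => (-1, 3) | 1%N, 3%N, 3%N => (-1, 1) | 1%N, 2%N, 4%N => (1, 4) | 1%N, 1%N, 4%N => (-1, 3)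
  | 2%N, 2%N, 0%N => (sigma, 0) | 2%N, 2%N, 2%N => (-1, 5) | 2%N, 2%N, 4%N => (1, 6) | 2%N, 0%N, 4%N => (- sigma, 0)
  | 2%N, 1%N, 4%N => (1, 4) | 2%N, 4%N, 4%N => (1, 5) | 2%N, 1%N, 3%N => (-1, 3) | 2%N, 2%N, 3%N => (1, 4)
  | 3%N, 1%N, 3%N => (-1, 1) | 4%N, 2%N, 4%N => (1, 5)
  | _, _, _ => (0, 0) end).

Definition model_Gam sigma (s : nat -> R) (j : 'I_5) : 'M[R]_5 :=
  mx5 (fun r c => let p := model_index sigma j r c in p.1 * s p.2).

(** Besides the planes [(x1, y1)] and [(x2, y2)], only [(x1, x2)] has curvature. Its entry [k] never
    meets the Ricci trace, so it is left free. *)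
Definition model_curv (r0 k : R) a b (i j : nat) : 'M[R]_5 := (match i, j with
  | 1%N, 3%N => mx5 (fun r c => match r, c with
      | 1%N, 1%N => - (r0 / 4) | 1%N, 3%N => - (r0 / 2 * a) | 3%N, 3%N => r0 / 4 | _, _ => 0 end)
  | 3%N, 1%N => mx5 (fun r c => match r, c with
      | 1%N, 1%N => r0 / 4 | 1%N, 3%N => r0 / 2 * a | 3%N, 3%N => - (r0 / 4) | _, _ => 0 end)
  | 2%N, 4%N => mx5 (fun r c => match r, c with
      | 2%N, 2%N => r0 / 4 | 2%N, 4%N => - (r0 / 2 * b) | 4%N, 4%N => - (r0 / 4) | _, _ => 0 end)
  | 4%N, 2%N => mx5 (fun r c => match r, c with
      | 2%N, 2%N => - (r0 / 4) | 2%N, 4%N => r0 / 2 * b | 4%N, 4%N => r0 / 4 | _, _ => 0 end)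
  | 1%N, 2%N => mx5 (fun r c => match r, c with | 1%N, 4%N => k | 2%N, 3%N => k | _, _ => 0 end)
  | 2%N, 1%N => mx5 (fun r c => match r, c with | 1%N, 4%N => - k | 2%N, 3%N => - k | _, _ => 0 end)
  | _, _ => 0 end).

Lemma mx5_ext (f h : nat -> nat -> R) :
  (forall i j : 'I_5, f i j = h i j) -> mx5 f = mx5 h.
Proof. by move=> fh; apply/matrixP => i j; rewrite !mxE. Qed.

Lemma mx5M (f h : nat -> nat -> R) : mx5 f *m mx5 h =
  mx5 (fun i j => f i 0%N * h 0%N j + f i 1%N * h 1%N j + f i 2%N * h 2%N j
                + f i 3%N * h 3%N j + f i 4%N * h 4%N j).
Proof. by apply/matrixP => i j; rewrite !mxE sum5 !mxE. Qed.

Lemma mx5D (f h : nat -> nat -> R) : mx5 f + mx5 h = mx5 (fun i j => f i j + h i j).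
Proof. by apply/matrixP => i j; rewrite !mxE. Qed.

Lemma mx5N (f : nat -> nat -> R) : - mx5 f = mx5 (fun i j => - f i j).
Proof. by apply/matrixP => i j; rewrite !mxE. Qed.

Lemma mx5T (f : nat -> nat -> R) : (mx5 f)^T = mx5 (fun i j => f j i).
Proof. by apply/matrixP => i j; rewrite !mxE. Qed.

Lemma mx51 : 1%:M = mx5 (fun i j => (i == j)%:R).
Proof. by apply/matrixP => i j; rewrite !mxE. Qed.

Lemma mx5_delta00 : delta_mx i0 (0 : 'I_1) *m delta_mx (0 : 'I_1) i0
  = mx5 (fun i j => match i, j with 0%N, 0%N => 1 | _, _ => 0 end) :> 'M[R]_5.
Proof.
rewrite mul_delta_mx; apply/matrixP => i j; rewrite !mxE.
by elim/ord5P: i; elim/ord5P: j.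
Qed.

Lemma model_gK a b : model_g a b *m model_ginv a b = 1%:M.
Proof.
rewrite mx5M mx51; apply: mx5_ext; elim/ord5P; elim/ord5P => /=; ring.
Qed.

Lemma model_g_unit a b : model_g a b \in unitmx.
Proof. by have /mulmx1_unit[] := model_gK a b. Qed.

Lemma model_g_sym a b : (model_g a b)^T = model_g a b.
Proof. by rewrite mx5T; apply: mx5_ext; elim/ord5P; elim/ord5P. Qed.

Lemma model_phiK a b :
  model_phi a b *m model_phi a b = 1%:M - delta_mx i0 (0 : 'I_1) *m delta_mx (0 : 'I_1) i0.
Proof.
rewrite mx5_delta00 mx5M mx51 mx5N mx5D; apply: mx5_ext.
by elim/ord5P; elim/ord5P => /=; ring.
Qed.

Lemma model_phi_form a b : model_phi a b *m model_g a b = model_form.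
Proof. by rewrite mx5M; apply: mx5_ext; elim/ord5P; elim/ord5P => /=; ring. Qed.

Lemma model_phi_metric a b : model_phi a b *m model_g a b *m (model_phi a b)^T
  = - model_g a b + delta_mx i0 (0 : 'I_1) *m delta_mx (0 : 'I_1) i0.
Proof.
rewrite model_phi_form mx5_delta00 mx5T mx5M mx5N mx5D; apply: mx5_ext.
by elim/ord5P; elim/ord5P => /=; ring.
Qed.

Lemma model_curv_phi (r0 k : R) a b i j :
  model_phi a b *m model_curv r0 k a b i j = model_curv r0 k a b i j *m model_phi a b.
Proof.
rewrite /model_curv; case: i => [|[|[|[|[|i]]]]]; case: j => [|[|[|[|[|j]]]]];
  rewrite ?mulmx0 ?mul0mx//.
all: by rewrite !mx5M; apply: mx5_ext; elim/ord5P; elim/ord5P => /=; field.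
Qed.

Lemma model_ricci (r0 k : R) a b (j m : 'I_5) :
  \sum_(i < 5) model_curv r0 k a b i j m i
  = r0 / 4 * (model_g a b - delta_mx i0 (0 : 'I_1) *m delta_mx (0 : 'I_1) i0) j m.
Proof.
rewrite mx5_delta00 mx5N mx5D sum5 [in RHS]mxE.
by elim/ord5P: j; elim/ord5P: m; rewrite /= ?mxE/=; field.
Qed.

Lemma model_scal (r0 : R) a b :
  \sum_(i < 5) \sum_(j < 5) model_ginv a b i j
    * (r0 / 4 * (model_g a b - delta_mx i0 (0 : 'I_1) *m delta_mx (0 : 'I_1) i0) i j) = r0.
Proof. by rewrite mx5_delta00 mx5N mx5D !sum5 !mxE/=; field. Qed.

Lemma model_Gam_sym sigma s (i j k : 'I_5) :
  model_Gam sigma s i j k = model_Gam sigma s j i k.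
Proof. by rewrite !mxE; elim/ord5P: i; elim/ord5P: j; elim/ord5P: k. Qed.

End ModelMatrices.

(** * Connection and curvature of the model, with derivatives of [a], [b] as free scalars *)

Section ModelConnection.
Context {R : realFieldType}.
Variables (sigma r0 a b a1 a2 b1 b2 a11 a12 a22 b11 b12 b22 y1 y2 : R).

Definition model_da (i : nat) : R :=
  match i with 0%N => -1 | 1%N => a1 | 2%N => a2 | 3%N => r0 / 4 * y1 | _ => 0 end.
Definition model_db (i : nat) : R :=
  match i with 0%N => - sigma | 1%N => b1 | 2%N => b2 | 4%N => r0 / 4 * y2 | _ => 0 end.

Definition model_s (k : nat) : R := match k with
  | 0%N => 1 | 1%N => r0 / 4 * y1 | 2%N => 2 * a * (r0 / 4 * y1) - a1 | 3%N => a2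
  | 4%N => b1 | 5%N => r0 / 4 * y2 | _ => 2 * b * (r0 / 4 * y2) + b2 end.

(** The derivative of [model_s k] along coordinate [i]; second derivatives of [a] and [b] mixing
    [x1] or [x2] with another coordinate vanish. *)
Definition model_ds (i k : nat) : R := match k with
  | 0%N => 0
  | 1%N => match i with 3%N => r0 / 4 | _ => 0 end
  | 2%N => 2 * (model_da i * (r0 / 4 * y1) + a * match i with 3%N => r0 / 4 | _ => 0 end)
         - match i with 1%N => a11 | 2%N => a12 | _ => 0 end
  | 3%N => match i with 1%N => a12 | 2%N => a22 | _ => 0 end
  | 4%N => match i with 1%N => b11 | 2%N => b12 | _ => 0 end
  | 5%N => match i with 4%N => r0 / 4 | _ => 0 end
  | _ => 2 * (model_db i * (r0 / 4 * y2) + b * match i with 4%N => r0 / 4 | _ => 0 end)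
         + match i with 1%N => b12 | 2%N => b22 | _ => 0 end end.

Definition model_k := b11 + a22 + sigma - r0 / 4 * y1 * b1 + a2 * (r0 / 4 * y2).

Lemma model_compat (i : 'I_5) :
  mx5 (fun r c => match r, c with 1%N, 1%N => 2 * model_da i | 2%N, 2%N => 2 * model_db i | _, _ => 0 end)
  = model_Gam sigma model_s i *m model_g a b + (model_Gam sigma model_s i *m model_g a b)^T.
Proof.
rewrite mx5M mx5T mx5D; apply: mx5_ext => r c.
by elim/ord5P: i; elim/ord5P: r; elim/ord5P: c => /=; ring.
Qed.

Lemma model_curvE (i j : 'I_5) :
  model_Gam sigma (model_ds i) j - model_Gam sigma (model_ds j) i
  + model_Gam sigma model_s j *m model_Gam sigma model_s i
  - model_Gam sigma model_s i *m model_Gam sigma model_s j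
  = model_curv r0 model_k a b i j.
Proof.
rewrite !mx5M !mx5N !mx5D; apply/matrixP => r c; rewrite [LHS]mxE.
by move: r c; elim/ord5P: i; elim/ord5P: j; elim/ord5P; elim/ord5P => /=;
  rewrite [RHS]mxE /model_k /=; field.
Qed.

(** The matrix is [nabla_i phi]; the entries outside row and column [i0] are those seen by the
    kernel of [eta]. *)
Lemma model_leaf (i j k : 'I_5) : j != i0 -> k != i0 ->
  (mx5 (fun r c => match r, c with 1%N, 3%N => 2 * model_da i | 2%N, 4%N => 2 * model_db i | _, _ => 0 end)
   + model_phi a b *m model_Gam sigma model_s i - model_Gam sigma model_s i *m model_phi a b) j k = 0.
Proof.
rewrite !mx5M !mx5N !mx5D mxE.
by elim/ord5P: i; elim/ord5P: j => // _; elim/ord5P: k => // _ /=; ring.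
Qed.

End ModelConnection.

Section ModelTensors.
Context {R : realType}.
Implicit Types (a b : R) (P : 'M[R]_5).

Lemma symprod_entry n (a b : 'cV[R]_n.+1) i j :
  symprod a b i j = 2^-1 * (a i 0 * b j 0 + b i 0 * a j 0).
Proof. by rewrite !mxE !big_ord1 !mxE. Qed.

Definition covec (i : 'I_5) : 'cV[R]_5 := delta_mx i 0.

Lemma covecE i j : covec i j 0 = (j == i)%:R.
Proof. by rewrite mxE eqxx andbT. Qed.

Lemma model_metricE a b :
  symprod (covec i0) (covec i0)
  + 2 *: symprod (covec i1) (a *: covec i1 - covec i3)
  + 2 *: symprod (covec i2) (b *: covec i2 + covec i4) = model_g a b.
Proof.
apply/matrixP => i j.
have D (c e : 'cV[R]_5) k : (c + e) k 0 = c k 0 + e k 0 by rewrite mxE.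
have N (c : 'cV[R]_5) k : (- c) k 0 = - c k 0 by rewrite mxE.
have Z x (c : 'cV[R]_5) k : (x *: c) k 0 = x * c k 0 by rewrite mxE.
have S (A B C : 'M[R]_5) : (A + 2 *: B + 2 *: C) i j = A i j + 2 * B i j + 2 * C i j.
  by rewrite !mxE.
rewrite [RHS]mxE S !symprod_entry.
rewrite !(D, N, Z) !covecE.
by move: i j {S}; elim/ord5P; elim/ord5P => /=; field.
Qed.

Lemma model_phiE a b P :
  [/\ P *m covec i0 = 0, P *m covec i1 = covec i1, P *m covec i2 = - covec i2,
      P *m (a *: covec i1 - covec i3) = - (a *: covec i1 - covec i3)
    & P *m (b *: covec i2 + covec i4) = b *: covec i2 + covec i4]
  <-> P = model_phi a b.
Proof.
have col_entry (Q : 'M[R]_5) i j : Q i j = (Q *m covec j) i 0 by rewrite -colE mxE.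
have E : [/\ model_phi a b *m covec i0 = 0, model_phi a b *m covec i1 = covec i1,
  model_phi a b *m covec i2 = - covec i2,
  model_phi a b *m covec i3 = (2 * a) *: covec i1 - covec i3
  & model_phi a b *m covec i4 = (2 * b) *: covec i2 + covec i4].
  by split; apply/colP => i; rewrite -col_entry [LHS]mxE !mxE; elim/ord5P: i => /=; ring.
have [E0 E1 E2 E3 E4] := E; split=> [[P0 P1 P2 P3 P4]|->].
  have P3' : P *m covec i3 = (2 * a) *: covec i1 - covec i3.
    move: P3; rewrite mulmxBr -scalemxAr P1 => /eqP.
    rewrite subr_eq => /eqP P3; apply/esym.
    apply: (addrI (- (a *: covec i1 - covec i3))); rewrite -P3.
    by apply/colP => i; rewrite !mxE; ring.
  have P4' : P *m covec i4 = (2 * b) *: covec i2 + covec i4.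
    move: P4; rewrite mulmxDr -scalemxAr P2 => P4.
    apply: (addrI (b *: - covec i2)); rewrite P4.
    by apply/colP => i; rewrite !mxE; ring.
  apply/matrixP => i j; rewrite !col_entry; congr (_ _ 0); move: j.
  by elim/ord5P; rewrite ?(P0, P1, P2, P3', P4', E0, E1, E2, E3, E4).
split; rewrite ?(mulmxBr, mulmxDr) -?scalemxAr ?(E0, E1, E2, E3, E4)//;
  by apply/colP => i; rewrite !mxE; ring.
Qed.

Lemma model_g_xi a b : delta_mx (0 : 'I_1) i0 *m model_g a b = delta_mx 0 i0.
Proof. by rewrite -rowE; apply/rowP => j; rewrite !mxE; elim/ord5P: j. Qed.

Lemma model_phi_rows a b : delta_mx (0 : 'I_1) i3 *m model_phi a b = - delta_mx 0 i3 /\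
  delta_mx (0 : 'I_1) i4 *m model_phi a b = delta_mx 0 i4.
Proof.
by split; rewrite -rowE; apply/rowP => j; rewrite !mxE; elim/ord5P: j; rewrite ?oppr0.
Qed.

Lemma model_g_cols a b : model_g a b *m (delta_mx (0 : 'I_1) i3)^T = - covec i1 /\
  model_g a b *m (delta_mx (0 : 'I_1) i4)^T = covec i2.
Proof.
by split; rewrite trmx_delta -colE; apply/colP => j; rewrite !mxE; elim/ord5P: j; rewrite ?oppr0.
Qed.

End ModelTensors.

Section QuadraticCoefficient.
Context {R : realType}.
Notation E := ('rV[R]_5).
Implicit Types (U : set E) (f w : E -> R) (i j k : 'I_5).

Lemma partial_coord_independent f i x : (i \notin [:: i1; i2]) ->
  (forall q q' : E, q 0 i1 = q' 0 i1 -> q 0 i2 = q' 0 i2 -> f q = f q') ->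
  partial i f x = 0.
Proof.
rewrite !inE negb_or => /andP[ni1 ni2] H; apply: partial_const_line => q t.
apply: H; rewrite !mxE/= 1?eq_sym.
  by rewrite (negbTE ni1) mulr0 addr0.
by rewrite (negbTE ni2) mulr0 addr0.
Qed.

Variables (U : set E) (w : E -> R) (tau c : R) (k : 'I_5).
Hypotheses (oU : open U) (sw : smooth U w) (nk : k \notin [:: i1; i2])
  (pw : forall i x, U x -> i \notin [:: i1; i2] -> partial i w x = 0).

(** Common shape of the metric coefficients [a] and [b]: [w] depends on [x1], [x2] only, [tau] is 1
    or [sigma], and [k] is the index of [y1] or [y2]. *)
Definition qcoef (q : E) := w q - tau * q 0 i0 + c * q 0 k ^+ 2.

Lemma smooth_qcoef : smooth U qcoef.
Proof.
apply: smoothD => //; last by apply: smoothM => //; [exact: smooth_cst|exact/smoothX/smooth_coordf].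
by apply: smoothB => //; apply: smoothM => //; [exact: smooth_cst|exact: smooth_coordf].
Qed.

Lemma partial_qcoef i x : U x -> partial i qcoef x =
  partial i w x - tau * (i == i0)%:R + 2 * c * x 0 k * (i == k)%:R.
Proof.
move=> Ux; have dw := smooth_diff sw Ux.
have dc j : differentiable (fun y : E => y 0 j) x := differentiable_coordf x j.
have dt : differentiable (fun y : E => tau * y 0 i0) x.
  by apply: differentiableM => //; exact: differentiable_cst.
have dk2 : differentiable (fun y : E => y 0 k * y 0 k) x by exact: differentiableM.
have dk : differentiable (fun y : E => c * (y 0 k * y 0 k)) x.
  by apply: differentiableM => //; exact: differentiable_cst.
have -> : qcoef = fun y => (w y - tau * y 0 i0) + c * (y 0 k * y 0 k).
  by apply/funext => y; rewrite /qcoef expr2.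
rewrite partialD//; last exact: differentiableB.
rewrite partialB// (partialM i (differentiable_cst tau x) (dc i0)).
rewrite (partialM i (differentiable_cst c x) dk2) partialM//.
by rewrite !partial_cst !partial_coordf /cst; ring.
Qed.

Lemma partial2_qcoef i j x : U x -> i \notin [:: i1; i2] -> j \in [:: i1; i2] ->
  partial i (partial j qcoef) x = 0.
Proof.
move=> Ux ni nj; rewrite (schwarz i j oU smooth_qcoef Ux).
have jk : (j == k) = false.
  by apply/negP => /eqP jk; move: nk; rewrite -jk nj.
have dk : differentiable (fun y : E => y 0 k) x := differentiable_coordf x k.
rewrite (@near_eq_partial _ _ _
  (fun y => - tau * (i == i0)%:R + 2 * c * (i == k)%:R * y 0 k)).
  have d1 := differentiable_cst (- tau * (i == i0)%:R) x.
  have d2 := differentiable_cst (2 * c * (i == k)%:R) x.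
  rewrite (partialD j d1 (differentiableM d2 dk)) (partialM j d2 dk).
  by rewrite !partial_cst partial_coordf jk mul0r mulr0 !addr0.
apply: filterS (open_near oU Ux) => y Uy; rewrite partial_qcoef// pw//.
by ring.
Qed.

End QuadraticCoefficient.

(** * Geometry of the model *)

Section Model.
Context {R : realType}.
Notation E := ('rV[R]_5).
Variables (r0 sigma : R) (U : set E) (f0 h0 : R -> R) (u0 v0 : R -> R -> R).
Hypotheses (oU : open U) (sD : smooth_data U f0 h0 u0 v0).

(** The term [f0'] comes from [df = f0' dx1 - dy1] in [th3]. *)
Definition profile1 (q : E) := partial i1 (fun q => f0 (q 0 i1)) q + u0 (q 0 i1) (q 0 i2).
Definition profile2 (q : E) := partial i2 (fun q => h0 (q 0 i2)) q + v0 (q 0 i1) (q 0 i2).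
Definition quad1 := qcoef profile1 1 (r0 / 8) i3.
Definition quad2 := qcoef profile2 sigma (r0 / 8) i4.

Lemma smooth_profile1 : smooth U profile1.
Proof. by case: sD => sf _ su _; apply: smoothD => //; exact: smooth_partial. Qed.

Lemma smooth_profile2 : smooth U profile2.
Proof. by case: sD => _ sh _ sv; apply: smoothD => //; exact: smooth_partial. Qed.

Lemma partial_profile (f : E -> R) i j x : smooth U f -> U x -> i \notin [:: i1; i2] ->
  (forall q q' : E, q 0 i1 = q' 0 i1 -> q 0 i2 = q' 0 i2 -> f q = f q') ->
  partial i (partial j f) x = 0.
Proof.
move=> sf Ux ni H; rewrite (schwarz i j oU sf Ux) (_ : partial i f = fun=> 0) ?partial_cst//.
by apply/funext => q; exact: partial_coord_independent.
Qed.

Lemma partial_profile1 i x : U x -> i \notin [:: i1; i2] -> partial i profile1 x = 0.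
Proof.
case: sD => sf _ su _ Ux ni.
rewrite partialD; [|exact: smooth_diff (smooth_partial _ sf) _ Ux|exact: smooth_diff su _ Ux].
rewrite (partial_profile _ sf)// => [|q q' ->//].
by rewrite add0r; apply: partial_coord_independent => // q q' -> ->.
Qed.

Lemma partial_profile2 i x : U x -> i \notin [:: i1; i2] -> partial i profile2 x = 0.
Proof.
case: sD => _ sh _ sv Ux ni.
rewrite partialD; [|exact: smooth_diff (smooth_partial _ sh) _ Ux|exact: smooth_diff sv _ Ux].
rewrite (partial_profile _ sh)// => [|q q' _ ->//].
by rewrite add0r; apply: partial_coord_independent => // q q' -> ->.
Qed.

Lemma smooth_quad1 : smooth U quad1. Proof. exact: (smooth_qcoef _ _ _ oU smooth_profile1). Qed.
Lemma smooth_quad2 : smooth U quad2. Proof. exact: (smooth_qcoef _ _ _ oU smooth_profile2). Qed.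

Notation da x i := (model_da r0 (partial i1 quad1 x) (partial i2 quad1 x) (x 0 i3) i).
Notation db x i := (model_db sigma r0 (partial i1 quad2 x) (partial i2 quad2 x) (x 0 i4) i).

Lemma partial_quad1 (i : 'I_5) x : U x -> partial i quad1 x = da x i.
Proof.
move=> Ux; have := partial_qcoef 1 (r0 / 8) i3 smooth_profile1 i Ux; rewrite -/quad1.
by elim/ord5P: i => //= ->; rewrite partial_profile1//; field.
Qed.

Lemma partial_quad2 (i : 'I_5) x : U x -> partial i quad2 x = db x i.
Proof.
move=> Ux; have := partial_qcoef sigma (r0 / 8) i4 smooth_profile2 i Ux; rewrite -/quad2.
by elim/ord5P: i => //= ->; rewrite partial_profile2//; field.
Qed.

Notation s x := (model_s r0 (quad1 x) (quad2 x) (partial i1 quad1 x) (partial i2 quad1 x)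
  (partial i1 quad2 x) (partial i2 quad2 x) (x 0 i3) (x 0 i4)).
Notation ds x i := (model_ds sigma r0 (quad1 x) (quad2 x) (partial i1 quad1 x) (partial i2 quad1 x)
  (partial i1 quad2 x) (partial i2 quad2 x) (partial i1 (partial i1 quad1) x)
  (partial i2 (partial i1 quad1) x) (partial i2 (partial i2 quad1) x)
  (partial i1 (partial i1 quad2) x) (partial i2 (partial i1 quad2) x)
  (partial i2 (partial i2 quad2) x) (x 0 i3) (x 0 i4) i).

Lemma dmx_mx5 (f : nat -> nat -> E -> R) (d : nat -> nat -> R) i x :
  (forall r c : 'I_5, partial i (f r c) x = d r c) ->
  dmx i (fun y => mx5 (fun r c => f r c y)) x = mx5 d.
Proof.
move=> H; apply/matrixP => r c; rewrite dmxE [RHS]mxE -H; congr (partial i _ x).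
by apply/funext => y; rewrite mxE.
Qed.

Lemma partial_scale (c : R) (f : E -> R) i x : differentiable f x ->
  partial i (fun y => c * f y) x = c * partial i f x.
Proof.
by move=> df; rewrite (partialM i (differentiable_cst c x) df) partial_cst mul0r add0r.
Qed.

Lemma dmx_model_g (i : 'I_5) x : U x -> dmx i (fun y => model_g (quad1 y) (quad2 y)) x =
  mx5 (fun r c => match r, c with 1%N, 1%N => 2 * da x i | 2%N, 2%N => 2 * db x i | _, _ => 0 end).
Proof.
move=> Ux; have dfa := smooth_diff smooth_quad1 Ux; have dfb := smooth_diff smooth_quad2 Ux.
apply: (@dmx_mx5 (fun r c y => metric_entry (quad1 y) (quad2 y) r c)) => r c.
rewrite -partial_quad1// -partial_quad2// -!partial_scale//.
by elim/ord5P: r; elim/ord5P: c => /=; rewrite ?partial_cst.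
Qed.

Lemma dmx_model_phi (i : 'I_5) x : U x -> dmx i (fun y => model_phi (quad1 y) (quad2 y)) x =
  mx5 (fun r c => match r, c with 1%N, 3%N => 2 * da x i | 2%N, 4%N => 2 * db x i | _, _ => 0 end).
Proof.
move=> Ux; have dfa := smooth_diff smooth_quad1 Ux; have dfb := smooth_diff smooth_quad2 Ux.
apply: (@dmx_mx5 (fun r c y => phi_entry (quad1 y) (quad2 y) r c)) => r c.
rewrite -partial_quad1// -partial_quad2// -!partial_scale//.
by elim/ord5P: r; elim/ord5P: c => /=; rewrite ?partial_cst.
Qed.

Lemma partial2_quad1 (i : 'I_5) x : U x ->
  partial i (partial i1 quad1) x =
    match val i with 1%N => partial i1 (partial i1 quad1) x | 2%N => partial i2 (partial i1 quad1) x
    | _ => 0 end /\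
  partial i (partial i2 quad1) x =
    match val i with 1%N => partial i2 (partial i1 quad1) x | 2%N => partial i2 (partial i2 quad1) x
    | _ => 0 end.
Proof.
move=> Ux.
have H k (ni : i \notin [:: i1; i2]) (nk : k \in [:: i1; i2]) : partial i (partial k quad1) x = 0.
  exact: (partial2_qcoef 1 (r0 / 8) oU smooth_profile1 _ partial_profile1).
move: i H; elim/ord5P => H; split.
- exact: (H i1 isT isT).
- exact: (H i2 isT isT).
- exact: erefl.
- exact: (schwarz i1 i2 oU smooth_quad1 Ux).
- exact: erefl.
- exact: erefl.
- exact: (H i1 isT isT).
- exact: (H i2 isT isT).
- exact: (H i1 isT isT).
- exact: (H i2 isT isT).
Qed.

Lemma partial2_quad2 (i : 'I_5) x : U x ->
  partial i (partial i1 quad2) x =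
    match val i with 1%N => partial i1 (partial i1 quad2) x | 2%N => partial i2 (partial i1 quad2) x
    | _ => 0 end /\
  partial i (partial i2 quad2) x =
    match val i with 1%N => partial i2 (partial i1 quad2) x | 2%N => partial i2 (partial i2 quad2) x
    | _ => 0 end.
Proof.
move=> Ux.
have H k (ni : i \notin [:: i1; i2]) (nk : k \in [:: i1; i2]) : partial i (partial k quad2) x = 0.
  exact: (partial2_qcoef sigma (r0 / 8) oU smooth_profile2 _ partial_profile2).
move: i H; elim/ord5P => H; split.
- exact: (H i1 isT isT).
- exact: (H i2 isT isT).
- exact: erefl.
- exact: (schwarz i1 i2 oU smooth_quad2 Ux).
- exact: erefl.
- exact: erefl.
- exact: (H i1 isT isT).
- exact: (H i2 isT isT).
- exact: (H i1 isT isT).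
- exact: (H i2 isT isT).
Qed.

Lemma partial_model_s (i : 'I_5) k x : U x -> partial i (fun y => s y k) x = ds x i k.
Proof.
move=> Ux; have dfa := smooth_diff smooth_quad1 Ux; have dfb := smooth_diff smooth_quad2 Ux.
have dafa j : differentiable (partial j quad1) x := smooth_diff (smooth_partial j smooth_quad1) Ux.
have dafb j : differentiable (partial j quad2) x := smooth_diff (smooth_partial j smooth_quad2) Ux.
have dc (j : 'I_5) : differentiable (fun y : E => y 0 j) x := differentiable_coordf x j.
have dr j : differentiable (fun y : E => r0 / 4 * y 0 j) x.
  by apply: differentiableM => //; exact: differentiable_cst.
have pr j : partial i (fun y : E => r0 / 4 * y 0 j) x = r0 / 4 * (i == j)%:R.
  by rewrite partial_scale// partial_coordf.
have [A1 A2] := partial2_quad1 i Ux; have [B1 B2] := partial2_quad2 i Ux.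
have ifE (j : 'I_5) (z : R) : (if i == j then z else 0) = z * (i == j)%:R.
  by case: eqP => _; rewrite ?mulr1 ?mulr0.
have d2a : differentiable (fun y : E => 2 * quad1 y) x.
  by apply: differentiableM => //; exact: differentiable_cst.
have d2b : differentiable (fun y : E => 2 * quad2 y) x.
  by apply: differentiableM => //; exact: differentiable_cst.
case: k => [|[|[|[|[|[|k]]]]]] /=.
- exact: partial_cst.
- by rewrite pr; elim/ord5P: i {pr A1 A2 B1 B2 ifE} => /=; rewrite ?mulr0 ?mulr1.
- rewrite partialB//; last exact: differentiableM.
  rewrite partialM// pr partial_scale// A1 partial_quad1//.
  by elim/ord5P: i {pr A1 A2 B1 B2 ifE} => /=; ring.
- exact: A2.
- exact: B1.
- by rewrite pr; elim/ord5P: i {pr A1 A2 B1 B2 ifE} => /=; rewrite ?mulr0 ?mulr1.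
- rewrite partialD//; last exact: differentiableM.
  rewrite partialM// pr partial_scale// B2 partial_quad2//.
  by elim/ord5P: i {pr A1 A2 B1 B2 ifE} => /=; ring.
Qed.

Lemma smooth_model_s k : smooth U (fun y => s y k).
Proof.
have sfa := smooth_quad1; have sfb := smooth_quad2.
have sc (c : R) : smooth U (fun=> c) := smooth_cst c oU.
have sr (j : 'I_5) : smooth U (fun y : E => r0 / 4 * y 0 j).
  by apply: smoothM => //; exact: smooth_coordf.
have sp (f : E -> R) : smooth U f -> smooth U (fun y => 2 * f y) by exact: smoothM.
case: k => [|[|[|[|[|[|k]]]]]] /=.
- exact: sc.
- exact: sr.
- apply: smoothB => //; last exact: smooth_partial.
  by apply: smoothM => //; exact: sp.
- exact: smooth_partial.
- exact: smooth_partial.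
- exact: sr.
- apply: smoothD => //; last exact: smooth_partial.
  by apply: smoothM => //; exact: sp.
Qed.

Lemma dmx_model_Gam (i j : 'I_5) x : U x ->
  dmx i (fun y => model_Gam sigma (s y) j) x = model_Gam sigma (ds x i) j.
Proof.
move=> Ux.
apply: (@dmx_mx5 (fun r c y => (model_index sigma j r c).1 * s y (model_index sigma j r c).2)).
move=> r c; have df := smooth_diff (smooth_model_s (model_index sigma j r c).2) Ux.
by rewrite (partial_scale _ _ df) partial_model_s.
Qed.

Variable S : pc_data R 4.
Hypothesis gE : forall x, U x -> pc_g S x = model_g (quad1 x) (quad2 x).

Lemma model_pseudo_riemannian : pseudo_riemannian U (pc_g S).
Proof.
split=> [|x Ux]; last by rewrite gE// model_g_sym model_g_unit.
move=> i j; have sc (c : R) : smooth U (fun=> c) := smooth_cst c oU.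
apply: (@smooth_ext _ _ U (fun y => metric_entry (quad1 y) (quad2 y) i j)) => //.
  by move=> x Ux; rewrite gE// mxE.
have sp f : smooth U f -> smooth U (fun y => 2 * f y) by exact: smoothM.
have sfa := sp _ smooth_quad1; have sfb := sp _ smooth_quad2.
by elim/ord5P: i; elim/ord5P: j => /=; first [exact: sc | exact: sfa | exact: sfb].
Qed.

Lemma Gam_model (j : 'I_5) x : U x -> Gam (pc_g S) j x = model_Gam sigma (s x) j.
Proof.
move=> Ux; have rG := model_pseudo_riemannian.
have ug := model_g_unit (quad1 x) (quad2 x).
have Csym (i k l : 'I_5) : (model_Gam sigma (s x) i *m model_g (quad1 x) (quad2 x)) k l
    = (model_Gam sigma (s x) k *m model_g (quad1 x) (quad2 x)) i l.
  by apply: mulmx_row_eq => m; exact: model_Gam_sym.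
have Cmet i : dmx i (pc_g S) x = model_Gam sigma (s x) i *m model_g (quad1 x) (quad2 x)
    + (model_Gam sigma (s x) i *m model_g (quad1 x) (quad2 x))^T.
  by rewrite (dmx_ext i oU Ux gE) dmx_model_g// (model_compat _ _ (quad1 x) (quad2 x)).
have := koszul_unique rG Ux Csym Cmet j; rewrite gE// => /(congr1 (mulmx^~ (invmx (model_g (quad1 x) (quad2 x))))).
by rewrite !mulmxK.
Qed.

Lemma curvmx_model (i j : 'I_5) x : U x -> curvmx (pc_g S) i j x =
  model_curv r0 (model_k sigma r0 (partial i2 quad1 x) (partial i1 quad2 x)
    (partial i2 (partial i2 quad1) x) (partial i1 (partial i1 quad2) x) (x 0 i3) (x 0 i4))
    (quad1 x) (quad2 x) i j.
Proof.
move=> Ux; rewrite -(model_curvE _ _ _ _ (partial i1 quad1 x) _ _ (partial i2 quad2 x)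
  (partial i1 (partial i1 quad1) x) (partial i2 (partial i1 quad1) x) _ _
  (partial i2 (partial i1 quad2) x) (partial i2 (partial i2 quad2) x)).
rewrite /curvmx !Gam_model//.
have H k y : U y -> Gam (pc_g S) k y = model_Gam sigma (s y) k by move=> Uy; exact: Gam_model.
by rewrite (dmx_ext i oU Ux (H j)) (dmx_ext j oU Ux (H i)) !dmx_model_Gam.
Qed.

Lemma Ric_model (X Y : E -> E) x : U x -> smooth_mx U X -> smooth_mx U Y ->
  Ric (pc_g S) X Y x = r0 / 4 *
    (X x *m (pc_g S x - covec i0 *m (covec i0)^T) *m (Y x)^T) 0 0.
Proof.
move=> Ux sX sY; rewrite /Ric.
pose K i j := curvmx (pc_g S) i j x.
have E1 k : curvature (pc_g S) (fun=> ebase k) X Y x 0 k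
    = \sum_j \sum_m X x 0 j * Y x 0 m * K k j m k.
  rewrite (curvatureE oU model_pseudo_riemannian Ux (smooth_mx_cst _ oU) sX sY).
  rewrite (bigD1 k)//= [X in _ + X]big1 ?addr0 => [|l lk]; last first.
    by rewrite big1// => j _; rewrite mxE (negbTE lk) andbF mul0r scale0r.
  rewrite summxE; apply: eq_bigr => j _; rewrite !mxE !eqxx mul1r mulr_sumr.
  by apply: eq_bigr => m _; rewrite mulrA.
have E2 : (X x *m (pc_g S x - covec i0 *m (covec i0)^T) *m (Y x)^T) 0 0
    = \sum_j \sum_m X x 0 j * Y x 0 m * (pc_g S x - covec i0 *m (covec i0)^T) j m.
  rewrite mxE exchange_big/=; apply: eq_bigr => m _; rewrite !mxE mulr_suml.
  by apply: eq_bigr => j _; rewrite mulrAC.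
rewrite E2 mulr_sumr; under eq_bigr do rewrite E1.
rewrite exchange_big/=; apply: eq_bigr => j _; rewrite exchange_big mulr_sumr/=.
apply: eq_bigr => m _; rewrite -mulr_sumr mulrCA; congr (_ * _).
under eq_bigr do rewrite /K curvmx_model//.
by rewrite model_ricci gE// trmx_delta.
Qed.

Lemma scal_model x : U x -> scal (pc_g S) x = r0.
Proof.
move=> Ux; have sc i : smooth_mx U (fun=> ebase i : E) := smooth_mx_cst _ oU.
have inv : invmx (pc_g S x) = model_ginv (quad1 x) (quad2 x).
  have ug := model_g_unit (quad1 x) (quad2 x).
  by rewrite gE// -[LHS]mulmx1 -(model_gK (quad1 x) (quad2 x)) mulKmx.
rewrite /scal inv -[RHS](model_scal r0 (quad1 x) (quad2 x)).
apply: eq_bigr => i _; apply: eq_bigr => j _; rewrite Ric_model// gE// trmx_delta.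
by congr (_ * (_ * _)); rewrite /ebase -rowE trmx_delta -colE [LHS]mxE [LHS]mxE.
Qed.

Hypothesis phiE : forall x, U x -> pc_phi S x = model_phi (quad1 x) (quad2 x).
Hypothesis xiE : forall x, U x -> pc_xi S x = ebase i0.
Hypothesis etaE : forall x, U x -> pc_eta S x = covec i0.

Lemma model_paracontact : almost_paracontact_metric U S.
Proof.
split; first split; [|by apply: (smooth_mx_ext oU _ (smooth_mx_cst (ebase i0) oU)) => x /xiE
  |by apply: (smooth_mx_ext oU _ (smooth_mx_cst (covec i0) oU)) => x /etaE
  |exact: model_pseudo_riemannian|].
  move=> i j; have sc (c : R) : smooth U (fun=> c) := smooth_cst c oU.
  apply: (@smooth_ext _ _ U (fun y => phi_entry (quad1 y) (quad2 y) i j)) => //.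
    by move=> x Ux; rewrite phiE// mxE.
  have sp f : smooth U f -> smooth U (fun y => 2 * f y) by exact: smoothM.
  have sfa := sp _ smooth_quad1; have sfb := sp _ smooth_quad2.
  by elim/ord5P: i; elim/ord5P: j => /=; first [exact: sc | exact: sfa | exact: sfb].
move=> x Ux; rewrite /phi /met /Defs.eta gE// phiE// xiE// etaE//.
have e1 (X : E) : X *m covec i0 *m ebase i0 = (X *m covec i0) 0 0 *: ebase i0.
  by rewrite {1}[X *m covec i0]mx11_scalar mul_scalar_mx.
split=> [X||X Y|X].
- by rewrite -mulmxA model_phiK mulmxBr mulmx1 mulmxA e1.
- by rewrite mul_delta_mx mxE !eqxx.
- have -> : X *m model_phi (quad1 x) (quad2 x) *m model_g (quad1 x) (quad2 x)
      *m (Y *m model_phi (quad1 x) (quad2 x))^T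
    = X *m (model_phi (quad1 x) (quad2 x) *m model_g (quad1 x) (quad2 x) *m (model_phi (quad1 x) (quad2 x))^T)
      *m Y^T by rewrite trmx_mul !mulmxA.
  rewrite model_phi_metric mulmxDr mulmxDl mulmxN mulNmx.
  have -> : X *m (delta_mx i0 (0 : 'I_1) *m delta_mx (0 : 'I_1) i0) *m Y^T
    = (X *m covec i0) *m (Y *m covec i0)^T by rewrite trmx_mul trmx_delta !mulmxA.
  move: (X *m _ *m _) (X *m _) (Y *m _) => A B C.
  by rewrite !mxE big_ord1 !mxE.
- rewrite model_g_xi; transitivity ((X *m covec i0)^T 0 0); first by rewrite [RHS]mxE.
  by rewrite trmx_mul trmx_delta.
Qed.

Lemma model_paracosymplectic : almost_paracosymplectic U S.
Proof.
split; first exact: model_paracontact.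
- have cl i j x : U x -> partial i (fun y => pc_eta S y j 0) x = 0.
    move=> Ux; rewrite -dmxE (dmx_ext i oU Ux etaE) dmx_cst mxE.
    by [].
  by move=> x Ux i j; rewrite !cl// subrr.
- have cl i j k x : U x -> partial i (fun y => fundamental_form S y j k) x = 0.
    move=> Ux; rewrite -dmxE (dmx_ext (H := fun=> model_form) i oU Ux) ?dmx_cst ?mxE// => y Uy.
    by rewrite fundamental_formE gE// phiE// model_phi_form.
  by move=> x Ux i j k; rewrite !cl// !addr0.
Qed.

Lemma model_weakly : weakly_paracosymplectic U S.
Proof.
split=> [|X Y Z sX sY sZ x Ux]; first exact: model_paracosymplectic.
have rG := model_pseudo_riemannian.
have [sphi _ _ _] := paracontact_smooth model_paracontact.
rewrite (curvatureE oU rG Ux sX sY (smooth_mxM oU sZ sphi)).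
rewrite (curvatureE oU rG Ux sX sY sZ) /phi mulmx_suml; apply: eq_bigr => i _.
rewrite mulmx_suml; apply: eq_bigr => j _; rewrite -scalemxAl; congr (_ *: _).
by rewrite curvmx_model// phiE// -!mulmxA model_curv_phi.
Qed.

(** On the kernel of [eta] the values of [nabla phi] are multiples of [xi], which is orthogonal to
    that kernel. *)
Lemma model_leaves : para_kahler_leaves U S.
Proof.
apply: (leaf_condition_parallel oU model_paracontact) => x Ux u b c _ + +.
rewrite etaE// gE// => b0 c0.
have covF0 (i j k : 'I_5) : j != i0 -> k != i0 -> covF (pc_g S) (pc_phi S) i x j k = 0.
  move=> j0 k0; rewrite /covF (dmx_ext i oU Ux phiE) dmx_model_phi// Gam_model// phiE//.
  exact: model_leaf.
have bi0 : b 0 i0 = 0 by move/matrixP/(_ 0 0): b0; rewrite -colE !mxE.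
have row0 k : k != i0 -> (b *m covFAt (pc_g S) (pc_phi S) u x) 0 k = 0.
  move=> k0; rewrite mxE big1// => j _; have [->|j0] := eqVneq j i0.
    by rewrite bi0 mul0r.
  rewrite summxE big1 ?mulr0// => i _.
  by rewrite mxE covF0// mulr0.
have -> : b *m covFAt (pc_g S) (pc_phi S) u x
    = (b *m covFAt (pc_g S) (pc_phi S) u x) 0 i0 *: delta_mx 0 i0.
  apply/rowP => k; rewrite [RHS]mxE [X in _ * X]mxE eqxx/=.
  by have [->|k0] := eqVneq k i0; rewrite ?mulr1// row0// mulr0.
rewrite -scalemxAl model_g_xi -scalemxAl.
by rewrite -[delta_mx 0 i0 *m _]trmxK trmx_mul trmxK trmx_delta c0 trmx0 scaler0.
Qed.

Lemma model_einstein : eta_einstein U S.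
Proof.
move=> X Y sX sY x Ux; rewrite Ric_model// scal_model//; congr (_ * _).
rewrite /met /Defs.eta etaE// mulmxBr mulmxBl.
have -> : X x *m (covec i0 *m (covec i0)^T) *m (Y x)^T
  = (X x *m covec i0) *m (Y x *m covec i0)^T by rewrite trmx_mul !mulmxA.
move: (X x *m _ *m _) (X x *m _) (Y x *m _) => A B C.
by rewrite !mxE big_ord1 !mxE.
Qed.

Lemma model_shape : shape_type sigma U S.
Proof.
(* The metric duals of [dx1] and [dx2]; the sign comes from the term [- 2 dx1 dy1] of the metric. *)
move=> x Ux; exists U, (fun=> - ebase i3), (fun=> ebase i4); split=> //.
split; [exact: smooth_mx_cst..|move=> y Uy].
have [r3 r4] := model_phi_rows (quad1 y) (quad2 y); have [c3 c4] := model_g_cols (quad1 y) (quad2 y).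
have g3 (X : E) : X *m model_g (quad1 y) (quad2 y) *m (- ebase i3)^T = X *m covec i1.
  by rewrite -mulmxA linearN/= mulmxN c3 opprK.
have g4 (X : E) : X *m model_g (quad1 y) (quad2 y) *m (ebase i4)^T = X *m covec i2.
  by rewrite -mulmxA c4.
rewrite /phi /met gE// phiE//; split.
- split; [rewrite oppr_eq0|]; apply/negP => /eqP/matrixP.
    by move=> /(_ 0 i3)/eqP; rewrite !mxE !eqxx oner_eq0.
  by move=> /(_ 0 i4)/eqP; rewrite !mxE !eqxx oner_eq0.
- by rewrite mulNmx r3.
- exact: r4.
- by rewrite g4 mulNmx -rowE !mxE oppr0.
- move=> X; have sxi : smooth_mx U (pc_xi S) by case: (paracontact_smooth model_paracontact).
  have xiG (i : 'I_5) : nab (pc_g S) i (pc_xi S) y = match val i with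
      | 1%N => ebase i3 | 2%N => - sigma *: ebase i4 | _ => 0 end.
    rewrite /nab (dmx_ext i oU Uy xiE) dmx_cst add0r xiE// Gam_model// -rowE.
    by apply/rowP => j; rewrite 2!mxE; elim/ord5P: i; elim/ord5P: j; rewrite /= ?mxE/=; ring.
  rewrite g3 g4 -!colE !mxE /shape_op nabla_sum; last exact: smooth_mxdiff sxi Uy.
  rewrite sum5 !xiG/= !scaler0 add0r !addr0 scale1r scalerN opprD !scalerA mulrN scaleNr opprK.
  by rewrite [X in X *: ebase i4]mulrC.
Qed.

End Model.

Section CanonicalCoframe.
Context {R : realType}.
Notation E := ('rV[R]_5).
Variables (r0 sigma : R) (U : set E) (f0 h0 : R -> R) (u0 v0 : R -> R -> R).
Hypotheses (oU : open U) (sD : smooth_data U f0 h0 u0 v0).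
Notation th := (canonical_coframe r0 sigma f0 h0 u0 v0
  (coordf i0) (coordf i1) (coordf i2) (coordf i3) (coordf i4)).
Notation a := (quad1 r0 f0 u0).
Notation b := (quad2 r0 sigma h0 v0).

Lemma dfun_coordf i x : dfun (coordf i) x = covec i :> 'cV[R]_5.
Proof. by apply/colP => j; rewrite covecE mxE; exact: partial_coordf. Qed.

Lemma dfun_profile (f : E -> R) k x : k \in [:: i1; i2] ->
  (forall q q' : E, q 0 k = q' 0 k -> f q = f q') ->
  dfun f x = partial k f x *: covec k.
Proof.
move=> nk H; apply/colP => j; rewrite [RHS]mxE covecE mxE.
have [->|jk] := eqVneq j k; first by rewrite mulr1.
rewrite mulr0; apply: partial_const_line => q t; apply: H.
by rewrite !mxE eq_sym (negbTE jk) mulr0 addr0.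
Qed.

Lemma model_coframe x : U x ->
  [/\ th i0 x = covec i0, th i1 x = covec i1, th i2 x = covec i2,
      th i3 x = a x *: covec i1 - covec i3 & th i4 x = b x *: covec i2 + covec i4].
Proof.
case: sD => sf sh _ _ Ux.
have df := smooth_diff sf Ux; have dh := smooth_diff sh Ux.
have dc j : differentiable (coordf j : E -> R) x := differentiable_coordf x j.
have D3 : dfun (fun q : E => f0 (coordf i1 q) - coordf i3 q) x
    = dfun (fun q : E => f0 (q 0 i1)) x - covec i3.
  rewrite -(dfun_coordf _ x); apply/colP => j; rewrite !mxE.
  exact: (partialB j df (dc i3)).
have D4 : dfun (fun q : E => h0 (coordf i2 q) + coordf i4 q) x
    = dfun (fun q : E => h0 (q 0 i2)) x + covec i4.
  rewrite -(dfun_coordf _ x); apply/colP => j; rewrite !mxE.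
  exact: (partialD j dh (dc i4)).
rewrite /canonical_coframe /= !dfun_coordf D3 D4.
rewrite (@dfun_profile _ i1)// => [|q q' ->//].
rewrite (@dfun_profile (fun q => h0 (q 0 i2)) i2)// => [|q q' ->//].
split=> //; rewrite addrAC -scalerDl; congr (_ *: _ + _).
  by rewrite /quad1 /qcoef /profile1 /coordf; ring.
by rewrite /quad2 /qcoef /profile2 /coordf; ring.
Qed.

(** Replaces the coframe conditions by explicit matrices, which gives existence of the structure as
    well as the starting point for its properties. *)
Lemma modelP S : model r0 sigma f0 h0 u0 v0 U S <->
  forall x, U x -> [/\ pc_xi S x = ebase i0, pc_eta S x = covec i0,
    pc_phi S x = model_phi (a x) (b x) & pc_g S x = model_g (a x) (b x)].
Proof.
rewrite /model /=; split=> H x Ux; have := H x Ux; have [t0 t1 t2 t3 t4] := model_coframe Ux.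
  rewrite /= t0 t1 t2 t3 t4 => -[-> -> P ->]; split=> //.
    exact/model_phiE.
  exact: model_metricE.
rewrite /= t0 t1 t2 t3 t4 => -[-> -> P ->]; split=> //.
  by apply/model_phiE.
by rewrite model_metricE.
Qed.

End CanonicalCoframe.

Unset Implicit Arguments.

Theorem theorem6 (R : realType) (r0 : R) (hr0 : r0 != 0) :
  (forall (sigma : R) (U : set 'rV[R]_5) (f0 h0 : R -> R) (u0 v0 : R -> R -> R),
     sigma = 1 \/ sigma = -1 ->
     open U -> connected U -> smooth_data U f0 h0 u0 v0 ->
     (exists S : pc_data R 4, model r0 sigma f0 h0 u0 v0 U S) /\
     (forall S : pc_data R 4, model r0 sigma f0 h0 u0 v0 U S ->
        [/\ almost_paracosymplectic U S,
            weakly_paracosymplectic U S,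
            para_kahler_leaves U S,
            eta_einstein U S /\ (forall x, U x -> scal (pc_g S) x = r0)
          & (sigma = 1 -> elliptic U S) /\ (sigma = -1 -> hyperbolic U S)]))
  /\
  (forall (sigma : R) (M : topologicalType) (I : Type)
          (atlas : I -> chart R 4 M) (S : I -> pc_data R 4),
     connected_smooth_manifold atlas ->
     tensor_fields atlas S ->
     in_charts atlas S (@weakly_paracosymplectic R 4) ->
     in_charts atlas S (@para_kahler_leaves R 3) ->
     in_charts atlas S eta_einstein ->
     in_charts atlas S (fun U T => forall x, U x -> scal (pc_g T) x = r0) ->
     (sigma = 1 /\ in_charts atlas S elliptic) \/
     (sigma = -1 /\ in_charts atlas S hyperbolic) ->
     forall (p : M) (i : I), chart_dom (atlas i) p ->
       has_canonical_form r0 sigma (chart_img atlas i) (S i)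
         (chart_map (atlas i) p)).
Proof.
split=> [sigma U f0 h0 u0 v0 _ oU _ sD|sigma M I atlas S man _ weak leaves ein sc ty p i dp].
  split.
    exists (PcData (fun x => model_phi (quad1 r0 f0 u0 x) (quad2 r0 sigma h0 v0 x))
      (fun=> ebase i0) (fun=> covec i0)
      (fun x => model_g (quad1 r0 f0 u0 x) (quad2 r0 sigma h0 v0 x))).
    by apply/modelP.
  move=> S /(modelP _ _ sD) mS.
  have gE x (Ux : U x) := let: And4 _ _ _ e := mS x Ux in e.
  have phiE x (Ux : U x) := let: And4 _ _ e _ := mS x Ux in e.
  have etaE x (Ux : U x) := let: And4 _ e _ _ := mS x Ux in e.
  have xiE x (Ux : U x) := let: And4 e _ _ _ := mS x Ux in e.
  have sh := model_shape oU sD gE phiE xiE etaE.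
  split; [exact: (model_paracosymplectic oU sD gE phiE xiE etaE)
    |exact: (model_weakly oU sD gE phiE xiE etaE)
    |exact: (model_leaves oU sD gE phiE xiE etaE)
    |split; [exact: (model_einstein oU sD gE etaE)|exact: (scal_model oU sD gE)]
    |by split=> s1; move: sh; rewrite s1].
(* The converse is local: everything takes place in the open image of one chart. *)
have [_ [/(_ i)[_ oi] _ _ _ _]] := man.
apply: (canonical_form_local oi (weak i) (leaves i) (ein i) (sc i) _ _ hr0).
- by case: ty => -[-> /(_ i)].
- by case: ty => -[-> _]; rewrite ?oppr_eq0 oner_eq0.
- by exists p.
Qed.
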